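(* Let $G_n=\mathrm O(W_n)$. (1) If $T$ is a raising operator applicable on $\psi\in\Psi(G_n)$, then $T(\psi)\gneq_C\psi$. In particular, if $\psi\ge_O\psi'$, then $\psi\ge_C\psi'$. (2) Let $\pi$ be an irreducible representation of $G_n$ of Arthur type. Then $\psi^{max}(\pi)$ and $\psi^{min}(\pi)$ are the unique elements of $\Psi(\pi)$ satisfying $$\psi^{max}(\pi)\ge_C\psi\ge_C\psi^{min}(\pi)$$ for all $\psi\in\Psi(\pi)$.
   Context: $F$ is a non-Archimedean local field of characteristic $0$; $W_n$ is a nondegenerate quadratic space over $F$ of dimension $2n$ and discriminant $d$ ($\mathrm O(W_n)$ may or may not be quasi-split); $\chi_W$ is the character attached to $F(\sqrt d)/F$. $\rho$ denotes an irreducible unitary supercuspidal representation of some $\mathrm{GL}_d(F)$, identified with a bounded irreducible $d$-dimensional representation of the Weil group $W_F$; $S_a$ is the $a$-dimensional irreducible representation of $\mathrm{SL}_2(\mathbb C)$. $\Psi(G_n)$ is the set of isomorphism classes of $2n$-dimensional orthogonal representations $\psi=\bigoplus_i\rho_i\otimes S_{a_i}\otimes S_{b_i}$ of $W_F\times\mathrm{SL}_2(\mathbb C)\times\mathrm{SL}_2(\mathbb C)$ of determinant $\chi_W$. $\Pi_\psi$ is the local Arthur packet (Arthur, Mœglin, Mœglin–Renard); $\Psi(\pi)=\{\psi\in\Psi(G_n)\mid\pi\in\Pi_\psi\}$; $\pi$ is of Arthur type if $\Psi(\pi)\ne\emptyset$. $\phi_\psi(w,x)=\psi(w,x,\mathrm{diag}(|w|^{1/2},|w|^{-1/2}))$.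 A summand is of good parity if it is self-dual and orthogonal. Order $\ge_O$: write $\langle A,B\rangle_\rho=\rho\otimes S_{A+B+1}\otimes S_{A-B+1}$ ($\langle A,A+1\rangle_\rho=0$). A raising operator $T$ replaces $\psi$ by a different parameter $T(\psi)$ obtained by one of the following moves on summands of good parity (''applicable'' means that the move can be performed): (i) replace $\langle A_j,B_i\rangle_\rho+\langle A_i,B_j\rangle_\rho$ by $\langle A_i,B_i\rangle_\rho+\langle A_j,B_j\rangle_\rho$, where $A_j>A_i$, $B_j>B_i$, $A_i\ge B_j-1$; (ii) replace $\langle A_i,B_i\rangle_\rho+\langle A_j,B_j\rangle_\rho$ by $\langle A_j,B_i\rangle_\rho+\langle A_i,B_j\rangle_\rho$, where $A_j>A_i$, $-B_j>-B_i$, $A_i\ge-B_j-1$ (second summand omitted if $A_i=-B_j-1$); (iii) replace $\langle A_k,-\frac12\rangle_\rho$ by $\langle A_k,\frac12\rangle_\rho$. $\psi_1\ge_O\psi_2$ means $\psi_1=\psi_2$ or $\psi_1=T_r\circ\cdots\circ T_1(\psi_2)$ for raising operators $T_i$. For $\pi$ of Arthur type, $\Psi(\pi)$ has a unique maximal element $\psi^{max}(\pi)$ and a unique minimal element $\psi^{min}(\pi)$ for $\ge_O$. Closure order $\ge_C$: put $\widehat{G_n}(\mathbb C)=\mathrm O_{2n}(\mathbb C)$; $L$-parameters of $G_n$ are taken up to $\mathrm O_{2n}(\mathbb C)$-conjugacy. The infinitesimal parameter of $\phi$ is $\lambda_\phi(w)=\phi(w,\mathrm{diag}(|w|^{1/2},|w|^{-1/2}))$.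 For an infinitesimal parameter $\lambda$, $H_\lambda$ is the centralizer of $\lambda(W_F)$ in $\mathrm O_{2n}(\mathbb C)$ and $V_\lambda=\{x\in\mathfrak{so}_{2n}(\mathbb C)\mid\mathrm{Ad}(\lambda(w))x=|w|x\ \forall w\in W_F\}$, on which $H_\lambda$ acts with finitely many orbits. To $\phi$ with $\lambda_\phi=\lambda$ attach the $H_\lambda$-orbit $C_\phi$ of $d(\phi|_{\mathrm{SL}_2(\mathbb C)})\begin{pmatrix}0&1\\0&0\end{pmatrix}\in V_\lambda$ (this gives a bijection with $H_\lambda$-orbits). $\phi_1\ge_C\phi_2$ means that $\lambda_{\phi_1}=\lambda_{\phi_2}$ and $\overline{C_{\phi_1}}\supseteq C_{\phi_2}$; $\psi_1\ge_C\psi_2$ means $\phi_{\psi_1}\ge_C\phi_{\psi_2}$; $\gneq_C$ is the strict relation. All members of $\Psi(\pi)$ have the same infinitesimal parameter as $\pi$. *)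

(* Defs.v *)
From Stdlib Require List.
From HB Require Import structures.
From mathcomp Require Import all_boot all_order all_algebra.
From mathcomp Require Import archimedean complex mxtens.
From mathcomp Require Import all_classical all_reals all_analysis.
Set Implicit Arguments.
Unset Strict Implicit.
Unset Printing Implicit Defensive.
Import Order.TTheory GRing.Theory Num.Theory.
Import numFieldNormedType.Exports.
Local Open Scope classical_set_scope.
Local Open Scope ring_scope.

(* The complex numbers, as a numClosedFieldType so that the generic topology of
   numerical fields applies. *)
Definition Cplx (R : realType) : numClosedFieldType := R[i]%C.

(* [v] is only meaningful on nonzero elements; the value at 0 is +oo. *)
Definition val_ge (F : fieldType) (v : F -> int) (m : int) (x : F) : bool :=
  (x == 0) || (m <= v x).

Record local_field (F : fieldType) := LocalField {
  lval : F -> int;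
  lvalM : forall x y, x != 0 -> y != 0 -> lval (x * y) = lval x + lval y;
  lvalD : forall m x y,
    val_ge lval m x -> val_ge lval m y -> val_ge lval m (x + y);
  lval_unif : exists2 x, x != 0 & lval x = 1;
  lcomplete : forall u : nat -> F,
    (forall m : int, exists N : nat, forall i j : nat,
       (N <= i)%N -> (N <= j)%N -> val_ge lval m (u i - u j)) ->
    exists l : F, forall m : int, exists N : nat, forall i : nat,
      (N <= i)%N -> val_ge lval m (u i - l);
  (* a complete irredundant list of representatives of the residue field *)
  residues : seq F;
  residues_int : {in residues, forall r, val_ge lval 0 r};
  residues_uniq : uniq residues;
  residues_inj : {in residues &, forall r s, val_ge lval 1 (r - s) -> r = s};
  residues_full : forall x, val_ge lval 0 x ->
    exists2 r, r \in residues & val_ge lval 1 (x - r)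
}.

Definition residue_card (F : fieldType) (K : local_field F) : nat :=
  size (residues K).

Lemma residue_card_gt0 (F : fieldType) (K : local_field F) :
  (0 < residue_card K)%N.
Proof.
have [|r rP _] := @residues_full F K 0; first by rewrite /val_ge eqxx.
by rewrite /residue_card; case: (residues K) rP.
Qed.

Section Weil.
Variables (F : fieldType) (K : local_field F).
Variables (Fbar : closedFieldType) (iota : {rmorphism F -> Fbar}).

Definition int_elt (x : Fbar) : Prop :=
  exists p : {poly F}, [/\ p \is monic,
    forall i, val_ge (lval K) 0 p`_i & root (map_poly iota p) x].

(* The maximal ideal of the ring of integers of [Fbar]: the x for which some
   positive power is divisible by a uniformizer. *)
Definition in_maxideal (x : Fbar) : Prop :=
  int_elt x /\
  exists k : nat, exists2 u : F, u != 0 /\ lval K u = 1 &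
    int_elt (x ^+ k.+1 / iota u).

(* s acts on the residue field of [Fbar] as the k-th power of x |-> x ^ q. *)
Definition acts_as_frob (s : Fbar -> Fbar) (k : int) : Prop :=
  forall x, int_elt x ->
    match k with
    | Posz m => in_maxideal (s x - x ^+ (residue_card K ^ m))
    | Negz m => in_maxideal (s x ^+ (residue_card K ^ m.+1) - x)
    end.

(* [wdeg] is determined by [wval], the residue field of [Fbar] being infinite. *)
Record weil := Weil {
  wval :> {rmorphism Fbar -> Fbar};
  wval_bij : bijective wval;
  wval_fix : forall x, wval (iota x) = iota x;
  wdeg : int;
  wval_frob : acts_as_frob wval wdeg
}.

Lemma in_maxideal0 : in_maxideal 0.
Proof.
have i0 : int_elt 0.
  exists 'X; split; rewrite ?monicX //; last by rewrite map_polyX rootX.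
  move=> i; rewrite coefX /val_ge; case: (i == 1)%N; rewrite ?eqxx //.
  apply/orP; right; have := @lvalM _ K 1 1 (oner_neq0 _) (oner_neq0 _).
  by rewrite mulr1 => /eqP; rewrite eq_sym -subr_eq0 addrK => /eqP ->.
split=> //; exists 0%N; have [u u0 uv] := lval_unif K.
by exists u => //; rewrite expr1 mul0r.
Qed.

Lemma idfun_frob : acts_as_frob idfun 0.
Proof. by move=> x _; rewrite /= expn0 expr1 subrr; exact: in_maxideal0. Qed.

Definition weil1 : weil :=
  @Weil idfun (inv_bij (fun x : Fbar => erefl x)) (fun=> erefl) 0 idfun_frob.

End Weil.

(* Representations are given by matrices acting on column vectors. *)
Definition rep_iso (C : fieldType) (T : Type) (m n : nat)
    (r : T -> 'M[C]_m) (s : T -> 'M[C]_n) : Prop :=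
  exists (P : 'M[C]_(m, n)) (P' : 'M[C]_(n, m)),
    [/\ P *m P' = 1%:M, P' *m P = 1%:M & forall g, r g *m P = P *m s g].

Definition rep_orthogonal (C : fieldType) (T : Type) (m : nat)
    (r : T -> 'M[C]_m) : Prop :=
  exists B : 'M[C]_m, [/\ B^T = B, B \in unitmx &
    forall g, (r g)^T *m B *m r g = B].

Section SL2.
Variable C : numClosedFieldType.

Record SL2 := MkSL2 { sl2val :> 'M[C]_2; sl2_det : \det sl2val = 1 }.

Definition mx2 (a b c d : C) : 'M[C]_2 :=
  \matrix_(i, j) if i == 0 then (if j == 0 then a else b)
                 else (if j == 0 then c else d).

Lemma det_mx2 a b c d : \det (mx2 a b c d) = a * d - b * c.
Proof.
rewrite (expand_det_row _ ord0) !big_ord_recl big_ord0 /cofactor !det_mx11 !mxE /=.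
by rewrite addr0 expr0 mul1r expr1 mulN1r mulrN.
Qed.

Lemma det_unip2 t : \det (mx2 1 t 0 1) = 1.
Proof. by rewrite det_mx2 mulr1 mulr0 subr0. Qed.

Definition sl2_unip (t : C) : SL2 := MkSL2 (det_unip2 t).

Lemma det_one2 : \det (1%:M : 'M[C]_2) = 1.
Proof. exact: det1. Qed.

Definition sl2_one : SL2 := MkSL2 det_one2.

(* The a-dimensional irreducible representation of SL_2: column i holds the
   coefficients of (g_00 X + g_10 Y)^i (g_01 X + g_11 Y)^(a-1-i), with Y = 1.
   For a = 0 it is the zero representation. *)
Definition Srep (a : nat) (g : SL2) : 'M[C]_a :=
  \matrix_(k < a, i < a)
    ((sl2val g 0 0 *: 'X + (sl2val g 1 0)%:P) ^+ i *
     (sl2val g 0 1 *: 'X + (sl2val g 1 1)%:P) ^+ (a.-1 - i))`_k.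

End SL2.

Section ArthurParams.
Variables (F : fieldType) (K : local_field F).
Variables (Fbar : closedFieldType) (iota : {rmorphism F -> Fbar}).
Variable R : realType.
Local Notation W := (weil K iota).
Local Notation C := (Cplx R).
Local Notation SL := (SL2 C).

(* The absolute value |w|, with |w| = q when w acts on the residue field as
   x |-> x ^ q. *)
Definition wnorm (w : W) : C := (residue_card K)%:R ^ wdeg w.

Lemma wnorm_neq0 (w : W) : wnorm w != 0.
Proof.
by rewrite expfz_neq0 // pnatr_eq0 -lt0n residue_card_gt0.
Qed.

Lemma det_wdiag (w : W) :
  \det (mx2 (sqrtC (wnorm w)) 0 0 (sqrtC (wnorm w))^-1) = 1.
Proof. by rewrite det_mx2 mul0r subr0 divff // sqrtC_eq0 wnorm_neq0. Qed.

(* diag (|w|^(1/2), |w|^(-1/2)) *)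
Definition wdiag (w : W) : SL := MkSL2 (det_wdiag w).

(* Bounded irreducible continuous representations of W_F.  A basis of
   neighbourhoods of w consists of the sets of w' of the same degree (that is,
   w^-1 w' in inertia) agreeing with w on a finite subset of [Fbar]. *)
Record bounded_irrep (d : nat) (r : W -> 'M[C]_d) : Prop := BoundedIrrep {
  brep1 : forall w : W, w =1 id -> r w = 1%:M;
  brepM : forall u v w : W, w =1 u \o v -> r w = r u *m r v;
  brep_cont : forall (w : W) (e : C), 0 < e -> exists s : seq Fbar,
    forall w' : W, wdeg w' = wdeg w -> {in s, w' =1 w} ->
      forall i j, `|r w' i j - r w i j| < e;
  brep_bounded : exists M : C, forall w i j, `|r w i j| <= M;
  brep_dim : (0 < d)%N;
  (* U stands for the subspace spanned by its columns *)
  brep_irr : forall U : 'M[C]_d,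
    (forall w, ((r w *m U)^T <= U^T)%MS) -> U = 0 \/ U \in unitmx
}.

(* rho (x) S_a (x) S_b *)
Record block := Block {
  bdim : nat;
  brho : W -> 'M[C]_bdim;
  ba : nat;
  bb : nat
}.

Definition block_dim (b : block) : nat := (bdim b * (ba b * bb b))%N.

Definition block_rep (b : block) (g : W * SL * SL) : 'M[C]_(block_dim b) :=
  brho b g.1.1 *t (Srep (ba b) g.1.2 *t Srep (bb b) g.2).

Fixpoint sum_dim (s : seq block) : nat :=
  if s is b :: s' then (block_dim b + sum_dim s')%N else 0%N.

Fixpoint sum_rep (s : seq block) (g : W * SL * SL) : 'M[C]_(sum_dim s) :=
  if s is b :: s' then block_mx (block_rep b g) 0 0 (sum_rep s' g) else 0.

Definition block_ok (b : block) : Prop :=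
  [/\ bounded_irrep (@brho b), (0 < ba b)%N & (0 < bb b)%N].

(* The character of W_F attached to F(sqrt d) / F. *)
Definition quad_char (d : F) (w : W) : C :=
  if `[< forall x : Fbar, x ^+ 2 = iota d -> w x = x >] then 1 else -1.

(* 2n-dimensional, with determinant the character of F(sqrt d) / F; elements are
   considered up to the equivalence [same_param]. *)
Record Psi (n : nat) (d : F) := MkPsi {
  psi_rep :> W * SL * SL -> 'M[C]_(2 * n);
  psi_sum : exists2 s : seq block, List.Forall block_ok s & rep_iso psi_rep (sum_rep s);
  psi_orth : rep_orthogonal psi_rep;
  psi_det : forall g, \det (psi_rep g) = quad_char d g.1.1
}.

Definition same_param n d (psi psi' : Psi n d) : Prop := rep_iso psi psi'.

Definition phi_of n d (psi : Psi n d) (g : W * SL) : 'M[C]_(2 * n) :=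
  psi (g.1, g.2, wdiag g.1).

Definition orthogonal_mx m (g : 'M[C]_m) : Prop := g^T *m g = 1%:M.

Definition orthogonal_valued m (phi : W * SL -> 'M[C]_m) : Prop :=
  forall g, orthogonal_mx (phi g).

Definition inf_param m (phi : W * SL -> 'M[C]_m) (w : W) : 'M[C]_m :=
  phi (w, wdiag w).

Definition H_of m (lam : W -> 'M[C]_m) : set 'M[C]_m :=
  [set h | orthogonal_mx h /\ forall w, h *m lam w = lam w *m h].

Definition V_of m (lam : W -> 'M[C]_m) : set 'M[C]_m :=
  [set x | x^T = - x /\
           forall w, lam w *m x *m invmx (lam w) = wnorm w *: x].

(* The image of [[0, 1], [0, 0]] under the differential of phi on SL_2. *)
Definition nilp m (phi : W * SL -> 'M[C]_m) : 'M[C]_m :=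
  \matrix_(i, j)
    derive1 (fun t : C => phi (weil1 K iota, sl2_unip t) i j) (0 : C).

Definition orbit_of m (phi : W * SL -> 'M[C]_m) : set 'M[C]_m :=
  [set h *m nilp phi *m invmx h | h in H_of (inf_param phi)].

(* Closure in V_lambda, for the Euclidean topology; orbits being constructible,
   it is also the Zariski closure. *)
Definition orbit_closure m (phi : W * SL -> 'M[C]_m) : set 'M[C]_m :=
  closure (orbit_of phi) `&` V_of (inf_param phi).

(* For two homomorphisms to O_m(C), hence sharing V_lambda on the nose. *)
Definition phi_geC m (phi1 phi2 : W * SL -> 'M[C]_m) : Prop :=
  inf_param phi1 =1 inf_param phi2 /\ orbit_of phi2 `<=` orbit_closure phi1.

(* L-parameters are O_m(C)-conjugacy classes of O_m(C)-valued homomorphisms: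
   representatives are chosen in the classes of phi_psi1 and phi_psi2. *)
Definition geC n d (psi1 psi2 : Psi n d) : Prop :=
  exists phi1 phi2 : W * SL -> 'M[C]_(2 * n),
    [/\ orthogonal_valued phi1, rep_iso phi1 (phi_of psi1),
        orthogonal_valued phi2, rep_iso phi2 (phi_of psi2) &
        phi_geC phi1 phi2].

Definition gtC n d (psi1 psi2 : Psi n d) : Prop :=
  geC psi1 psi2 /\ ~ geC psi2 psi1.

(* A and B are half-integers with A + B and A - B natural numbers, so that
   < A, B >_rho is a nonzero summand. *)
Definition seg (A B : rat) : bool :=
  (A + B \is a Num.nat) && (A - B \is a Num.nat).

(* < A, B >_rho; it is zero-dimensional when A = B - 1 or A = - B - 1. *)
Definition jord d (r : W -> 'M[C]_d) (A B : rat) : block :=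
  Block r (Num.truncn (A + B + 1)) (Num.truncn (A - B + 1)).

Definition good_parity (b : block) : Prop := rep_orthogonal (block_rep b).

Inductive raise_blocks d (r : W -> 'M[C]_d) : seq block -> seq block -> Prop :=
| RaiseI (Ai Aj Bi Bj : rat) of
    seg Ai Bi & seg Aj Bj & seg Aj Bi &
    Ai < Aj & Bi < Bj & Bj - 1 <= Ai :
    raise_blocks r [:: jord r Aj Bi; jord r Ai Bj]
                   [:: jord r Ai Bi; jord r Aj Bj]
| RaiseII (Ai Aj Bi Bj : rat) of
    seg Ai Bi & seg Aj Bj & seg Aj Bi &
    Ai < Aj & - Bi < - Bj & - Bj - 1 <= Ai :
    raise_blocks r [:: jord r Ai Bi; jord r Aj Bj]
                   [:: jord r Aj Bi; jord r Ai Bj]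
| RaiseIII (Ak : rat) of seg Ak (- 2^-1) :
    raise_blocks r [:: jord r Ak (- 2^-1)] [:: jord r Ak 2^-1].

(* [raises psi psi'] means psi' = T(psi) for some raising operator T applicable
   on psi. *)
Definition raises n d (psi psi' : Psi n d) : Prop :=
  ~ same_param psi psi' /\
  exists (m : nat) (r : W -> 'M[C]_m) (rest old new : seq block),
    [/\ bounded_irrep r, List.Forall block_ok rest, raise_blocks r old new,
        List.Forall good_parity old &
        rep_iso psi (sum_rep (old ++ rest)) /\
        rep_iso psi' (sum_rep (new ++ rest))].

Inductive geO n d : Psi n d -> Psi n d -> Prop :=
| geO_refl psi1 psi2 of same_param psi1 psi2 : geO psi1 psi2
| geO_step psi1 psi psi2 of raises psi psi1 & geO psi psi2 : geO psi1 psi2.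

Definition maximal_in n d (P : Psi n d -> Prop) (psi : Psi n d) : Prop :=
  P psi /\ forall psi', P psi' -> geO psi' psi -> same_param psi' psi.

Definition minimal_in n d (P : Psi n d -> Prop) (psi : Psi n d) : Prop :=
  P psi /\ forall psi', P psi' -> geO psi psi' -> same_param psi' psi.

Definition unique_maximal n d (P : Psi n d -> Prop) (psi : Psi n d) : Prop :=
  maximal_in P psi /\ forall psi', maximal_in P psi' -> same_param psi' psi.

Definition unique_minimal n d (P : Psi n d -> Prop) (psi : Psi n d) : Prop :=
  minimal_in P psi /\ forall psi', minimal_in P psi' -> same_param psi' psi.

(* The quadratic space is F^m with (nondegenerate) Gram matrix Q. *)
Definition in_O m (Q g : 'M[F]_m) : Prop := g^T *m Q *m g = Q.

Definition disc n (Q : 'M[F]_(2 * n)) : F := (-1) ^+ n * \det Q.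

(* Irreducible smooth complex representations of O(F^m, Q); the values of
   [irr_act] outside the group play no role. *)
Record irrep m (Q : 'M[F]_m) := Irrep {
  irr_sp : lmodType C;
  irr_act : 'M[F]_m -> irr_sp -> irr_sp;
  irr_lin : forall g, in_O Q g -> linear (irr_act g);
  irr1 : irr_act 1%:M =1 id;
  irrM : forall g h, in_O Q g -> in_O Q h ->
    irr_act (g *m h) =1 irr_act g \o irr_act h;
  irr_smooth : forall v, exists k : int, forall g, in_O Q g ->
    (forall i j, val_ge (lval K) k ((g - 1%:M) i j)) -> irr_act g v = v;
  irr_neq0 : exists v : irr_sp, v != 0;
  irr_irr : forall U : set irr_sp,
    U 0 -> (forall (a : C) u v, U u -> U v -> U (a *: u + v)) ->
    (forall g v, in_O Q g -> U v -> U (irr_act g v)) ->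
    U = [set 0] \/ U = setT
}.

Definition irrep_iso m (Q : 'M[F]_m) (pi pi' : irrep Q) : Prop :=
  exists f : irr_sp pi -> irr_sp pi', [/\ linear f, bijective f &
    forall g v, in_O Q g -> f (irr_act g v) = irr_act g (f v)].

(* An assignment, to each parameter, of a set of irreducible representations,
   both taken up to isomorphism. *)
Record packets n (Q : 'M[F]_(2 * n)) := Packets {
  in_packet : Psi n (disc Q) -> irrep Q -> Prop;
  in_packet_iso : forall psi psi' pi pi',
    same_param psi psi' -> irrep_iso pi pi' ->
    in_packet psi pi -> in_packet psi' pi'
}.

Definition Psi_of n (Q : 'M[F]_(2 * n)) (Pi : packets Q) (pi : irrep Q) :
  Psi n (disc Q) -> Prop := fun psi => in_packet Pi psi pi.

Definition arthur_type n (Q : 'M[F]_(2 * n)) (Pi : packets Q) (pi : irrep Q) :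
  Prop := exists psi, Psi_of Pi pi psi.

End ArthurParams.

(* Main.v *)
(* The three raising moves are instances of a single one, which replaces
   rho S_(p+al) S_(q+al+be) + rho S_(p+be) S_q by
   rho S_(p+al+be) S_(q+al) + rho S_p S_(q+be), with al, be > 0: for the summands
   < A, B' > + < A', B > and < A, B > + < A', B' >, take al = A - A',
   be = B - B', p = A' + B' + 1 and q = A' - B + 1.

   Write X^(al+be) + 1 = f g with deg f = al and deg g = be.  Multiplication by N
   on a suitable k[N,y]-module has the new Jordan type.  In a monomial basis
   indexed by the two old strings it is the old shift up to terms raising the
   power of y, so conjugating by powers of t gives a polynomial family of
   nilpotents that is of the new type for t <> 0 and is the old one for t = 0.
   The module carries a form for which N is self-adjoint; a triangular change
   of basis brings it to an antidiagonal form independent of t, so the family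
   stays in V_lambda.  Representations preserving forms and conjugate under GL
   are conjugate under O, because square roots of a matrix can be taken among
   its polynomials; hence the family proves that the new orbit contains the old
   one in its closure.

   The ranks of the powers of the nilpotent element do not increase when passing
   to the closure, and the power p + al + be - 1 vanishes on the old pair but not
   on the new one.  So moves are strict, and the sum of these ranks, which is
   bounded, puts each member of Psi(pi) below a maximal element and above a
   minimal one. *)
Require Import Defs.
From HB Require Import structures.
From mathcomp Require Import all_boot all_order all_algebra.
From mathcomp Require Import archimedean complex mxtens.
From mathcomp Require Import all_classical all_reals all_analysis.
From mathcomp Require Import perm zify ring lra.
Set Implicit Arguments.
Unset Strict Implicit.
Unset Printing Implicit Defensive.
Import Order.TTheory GRing.Theory Num.Theory.
Import numFieldNormedType.Exports.
Local Open Scope classical_set_scope.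
Local Open Scope ring_scope.

(** In [phi_psi] the second SL_2 survives only as a torus, so S_a (x) S_b is b strings of length a;
    y keeps track of the string, and N^i y^j has weight i + j up to a shift. With m = al + be, v = F
    e1 + e2 and F G = N^m + y^m, one has G v - (y^m e1 + G e2) = N^m e1. Hence N^(p+m) kills e1 and
    N^p kills v, which gives the new strings; the old ones are read off the leading terms of F and
    G. No quotient module is formed. An element is the functional that it induces through an
    explicit pairing of monomials, and the relations become identities between coefficients of f g.
    The obstacle is that the degeneration must stay inside V_lambda: the torus part must be
    constant, and N must be skew for one form of prescribed sign. Degrees are therefore preserved by
    all intertwiners, the sign (-1)^degree turns self-adjoint into skew, and the antidiagonal form
    is invariant under the rescaling because paired weights have a constant sum. The sign left over
    is compensated by the form on rho, read off from good parity; the other summands carry a form by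
    a cancellation argument. *)

(** * Square roots of invertible matrices *)

Section MatrixSquareRoot.
Variable k : closedFieldType.
Hypothesis two_neq0 : 2%:R != 0 :> k.

Lemma closed_quadratic_root (a b c : k) : a != 0 ->
  exists x, a * x ^+ 2 + b * x + c = 0.
Proof.
move=> a0; pose P : {poly k} := a *: 'X^2 + b *: 'X + c%:P.
have sP : size P = 3.
  rewrite /P -addrA size_polyDl size_scale// size_polyXn// ltnS.
  rewrite (leq_trans (size_polyD _ _))// geq_max.
  rewrite (leq_trans (size_scale_leq _ _)) ?size_polyX//=.
  by rewrite (leq_trans (size_polyC_leq1 _)).
have /closed_rootP [x] : size P != 1 by rewrite sP.
by move=> /rootP Px; exists x; rewrite -[RHS]Px /P !hornerE.
Qed.

(** Hensel lifting, one linear factor at a time. Repeated roots are allowed, so this also covers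
    characteristic polynomials of matrices that are not diagonalizable. *)
Lemma sqrtX_mod_prod (rs : seq k) : all (fun r => r != 0) rs ->
  exists u : {poly k}, (\prod_(r <- rs) ('X - r%:P)) %| u ^+ 2 - 'X.
Proof.
elim: rs => [_|r rs IH /= /andP[r0 /IH {IH} [u /dvdpP [h hE]]]].
  by exists 0; rewrite big_nil dvd1p.
rewrite big_cons; set P := \prod_(_ <- _) _ in hE *.
(* The left-hand side is the value at r of ((u + c P)^2 - X) / P. If P(r) = 0 the equation is linear
   in c, and solvable because u(r)^2 = r is nonzero. *)
suff [c hc] : exists c : k, P.[r] * c ^+ 2 + 2%:R * u.[r] * c + h.[r] = 0.
  exists (u + c *: P).
  have uE : u ^+ 2 = h * P + 'X by rewrite -hE subrK.
  have -> : (u + c *: P) ^+ 2 - 'X = (h + (c *: u) *+ 2 + c ^+ 2 *: P) * P.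
    by rewrite sqrrD uE -!mul_polyC !rmorphXn /=; ring.
  rewrite dvdp_mul2r ?dvdp_XsubCl; last first.
    by rewrite monic_neq0// monic_prod_XsubC.
  rewrite /root !(hornerD, hornerZ, hornerMn); apply/eqP; rewrite -[RHS]hc; ring.
have [P0|P0] := eqVneq P.[r] 0; last first.
  have [c] := closed_quadratic_root (2%:R * u.[r]) h.[r] P0.
  by exists c.
have u0 : 2%:R * u.[r] != 0.
  rewrite mulf_neq0//; apply: contra r0 => /eqP u0.
  have := congr1 (fun v : {poly k} => v.[r]) hE.
  by rewrite !hornerE u0 P0 mulr0 expr0n/= sub0r => /eqP; rewrite oppr_eq0.
by exists (- h.[r] / (2%:R * u.[r])); rewrite P0 mul0r add0r mulrC divfK// addNr.
Qed.

(* The square root is a polynomial in [B], hence lies in every algebra of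
   matrices containing [B]. *)
Lemma mx_sqrt n (B : 'M[k]_n) : B \in unitmx ->
  exists2 S : 'M[k]_n, S *m S = B &
    forall P : 'M[k]_n -> Prop, P 1%:M ->
      (forall a X Y, P X -> P Y -> P (a *: X + Y)) ->
      (forall X, P X -> P (B *m X)) -> P S.
Proof.
case: n B => [|n] B uB; first by exists 1%:M => //; apply/matrixP; case.
have [rs rsE] := closed_field_poly_normal (char_poly B).
rewrite (monicP (char_poly_monic B)) scale1r in rsE.
have rs0 : all (fun r => r != 0) rs.
  apply/allP => r rrs; apply: contraL uB => /eqP r0; rewrite -row_free_unit.
  have : root (char_poly B) 0 by rewrite rsE root_prod_XsubC -r0.
  rewrite -eigenvalue_root_char => /eigenvalueP [v vB v0].
  apply/negP => /row_freeP [B' BB']; case/eqP: v0.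
  by rewrite -[v]mulmx1 -BB' mulmxA vB scale0r mul0mx.
have [u] := sqrtX_mod_prod rs0; rewrite -rsE => /dvdpP [h hE].
exists (horner_mx B u).
  have := congr1 (horner_mx B) hE.
  rewrite rmorphB rmorphXn rmorphM /= horner_mx_X Cayley_Hamilton mulr0 expr2.
  by move/eqP; rewrite subr_eq0 => /eqP.
move=> P P1 PD PB; have P0 : P 0.
  by have := PD (-1) _ _ P1 P1; rewrite scaleN1r addNr.
elim/poly_ind: u {hE} => [|u c IH]; first by rewrite rmorph0.
rewrite rmorphD rmorphM /= horner_mx_X horner_mx_C addrC -scalemx1.
apply: PD => //; rewrite -[_ * _]/(_ *m _).
by have -> : horner_mx B u *m B = B *m horner_mx B u;
  [apply: comm_horner_mx|apply: PB].
Qed.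

End MatrixSquareRoot.

(** * The pairing on the module with two generators *)

Section Residue.
Variables (k : fieldType) (p q al be : nat) (f g : {poly k}).
Hypotheses (al_gt0 : (0 < al)%N) (be_gt0 : (0 < be)%N).
Hypotheses (size_f : size f = al.+1) (size_g : size g = be.+1).
Hypothesis fg1 : f * g = 'X^(al + be) + 1.
Let m := (al + be)%N.

(* The k[N,y]-module with generators e1 (true), e2 (false) and relations
   y^(q+m) e1, y^q e2, N^p (F e1 + e2), N^p (y^m e1 + G e2), where F and G are
   the homogenizations of f and g, so that F G = N^m + y^m, carries a symmetric
   form for which N and y are self-adjoint; [gdual w v I J] is the pairing of
   N^i y^j e_w and N^i' y^j' e_v for i + i' = I and j + j' = J. *)
Definition gdual (w v : bool) (I J : nat) : k :=
  match w, v with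
  | true, true =>
      if (I < p + m)%N && (I + J + be + 2 == p + m + q + m)%N
      then g`_(p + m - 1 - I) else 0
  | false, false =>
      if (I < p + m)%N && (I + J + al + 2 == p + m + q)%N
      then f`_(p + m - 1 - I) else 0
  | _, _ => if (I + 1 == p + m)%N && (J + 1 == q)%N then -1 else 0
  end.

Lemma coef_fg s : (f * g)`_s = (s == m)%:R + (s == 0)%:R.
Proof. by rewrite fg1 coefD coefXn coef1. Qed.

(** The guard [r <= s] matters: without it the truncated [s - r] would bring in the constant
    coefficient of [v]. *)
Lemma conv_coef (u v : {poly k}) s a : size u = a.+1 ->
  \sum_(r < a.+1) u`_r * (if (r <= s)%N then v`_(s - r) else 0) = (u * v)`_s.
Proof.
move=> su; rewrite coefM.
have -> : \sum_(r < s.+1) u`_r * v`_(s - r) =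
          \sum_(r < s.+1 + a.+1 | (r < s.+1)%N) u`_r * v`_(s - r).
  by rewrite (big_ord_widen (s.+1 + a.+1) (fun r => u`_r * v`_(s - r))) ?leq_addr.
rewrite (big_ord_widen (s.+1 + a.+1)
  (fun r => u`_r * (if (r <= s)%N then v`_(s - r) else 0))) ?leq_addl//.
rewrite big_mkcond [RHS]big_mkcond; apply: eq_bigr => r _.
case: ltnP => ra; last by rewrite nth_default ?su// mul0r; case: ifP.
by rewrite ltnS; case: ifP; rewrite ?mulr0.
Qed.

Lemma gdualC w v I J : gdual w v I J = gdual v w I J.
Proof. by case: w v => [] []. Qed.

(** Pairing of F e1 + e2 with e1. The convolution produces the coefficients of f g = X^m + 1: the
    constant one is cancelled by the -1 in [gdual], the leading one remains. The next three lemmas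
    treat F e1 + e2 against e2, then y^m e1 + G e2 against e1 and e2. *)
Lemma gdual_f_true I J :
  \sum_(r < al.+1) f`_r * gdual true true (I + r) (J + al - r)
   + gdual true false I J = ((I + 1 == p) && (J + 1 == q + m)%N)%:R.
Proof.
case: (boolP ((I < p + m) && (I + J + 2 == p + q + m))%N); last first.
  move=> nc; rewrite big1 ?add0r => [|r _].
    rewrite /gdual; case: ifP => [|_]; first lia.
    by case: (boolP (_ && _)) => //; lia.
  rewrite /gdual; case: ifP => [|]; last by rewrite mulr0.
  by have := ltn_ord r; move: nc; rewrite /m; lia.
move=> /andP[h1 /eqP h2].
transitivity ((f * g)`_(p + m - 1 - I) + gdual true false I J).
  congr (_ + _); rewrite -(conv_coef g (p + m - 1 - I) size_f).
  apply: eq_bigr => r _; congr (_ * _); rewrite /gdual.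
  have := ltn_ord r; move: h1 h2; rewrite /m => h1 h2 hr.
  case: ifP => h3; case: ifP => h4 //; try by exfalso; lia.
  by congr (_`_ _); lia.
rewrite coef_fg /gdual.
have -> : (p + m - 1 - I == m)%N = ((I + 1 == p) && (J + 1 == q + m)%N) by lia.
have -> : (p + m - 1 - I == 0)%N = ((I + 1 == p + m) && (J + 1 == q)%N).
  by move: h1 h2; rewrite /m; lia.
by case: ((I + 1 == p + m) && _)%N; rewrite ?addrK ?addr0.
Qed.

Lemma gdual_f_false I J :
  \sum_(r < al.+1) f`_r * gdual false true (I + r) (J + al - r)
   + gdual false false I J = 0.
Proof.
rewrite /gdual; case: ifP => [/andP[h1 /eqP h2]|nc]; last first.
  rewrite addr0 big1// => r _; case: ifP => [h|]; last by rewrite mulr0.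
  by have := ltn_ord r; lia.
case: (leqP (p + m - 1 - I) al) => hs; last first.
  rewrite [X in _ + X]nth_default ?size_f// addr0 big1// => r _.
  by case: ifP => [h|]; [have := ltn_ord r; lia | rewrite mulr0].
rewrite -ltnS in hs; rewrite (bigD1 (Ordinal hs))//= big1 ?addr0.
  by case: ifP => h; [rewrite mulrN1 addNr | lia].
move=> r /negP hr; case: ifP => [h|]; last by rewrite mulr0.
by case: hr; apply/eqP/val_inj => /=; lia.
Qed.

Lemma gdual_g_true I J :
  \sum_(r < be.+1) g`_r * gdual true false (I + r) (J + be - r)
   + gdual true true I (J + m) = 0.
Proof.
rewrite /gdual; case: ifP => [/andP[h1 /eqP h2]|nc]; last first.
  rewrite addr0 big1// => r _; case: ifP => [h|]; last by rewrite mulr0.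
  by have := ltn_ord r; lia.
case: (leqP (p + m - 1 - I) be) => hs; last first.
  rewrite [X in _ + X]nth_default ?size_g// addr0 big1// => r _.
  by case: ifP => [h|]; [have := ltn_ord r; lia | rewrite mulr0].
rewrite -ltnS in hs; rewrite (bigD1 (Ordinal hs))//= big1 ?addr0.
  by case: ifP => h; [rewrite mulrN1 addNr | lia].
move=> r /negP hr; case: ifP => [h|]; last by rewrite mulr0.
by case: hr; apply/eqP/val_inj => /=; lia.
Qed.

Lemma gdual_g_false I J :
  \sum_(r < be.+1) g`_r * gdual false false (I + r) (J + be - r)
   + gdual false true I (J + m) = ((I + 1 == p) && (J + 1 == q)%N)%:R.
Proof.
case: (boolP ((I < p + m) && (I + J + 2 == p + q))%N); last first.
  move=> nc; rewrite big1 ?add0r => [|r _].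
    rewrite /gdual; case: ifP => [|_]; first by move: nc; rewrite /m; lia.
    by case: (boolP (_ && _)) => //; lia.
  rewrite /gdual; case: ifP => [|]; last by rewrite mulr0.
  by have := ltn_ord r; move: nc; rewrite /m; lia.
move=> /andP[h1 /eqP h2].
transitivity ((g * f)`_(p + m - 1 - I) + gdual false true I (J + m)).
  congr (_ + _); rewrite -(conv_coef f (p + m - 1 - I) size_g).
  apply: eq_bigr => r _; congr (_ * _); rewrite /gdual.
  have := ltn_ord r; move: h1 h2; rewrite /m => h1 h2 hr.
  case: ifP => h3; case: ifP => h4 //; try by exfalso; lia.
  by congr (_`_ _); lia.
rewrite mulrC coef_fg /gdual.
have -> : (p + m - 1 - I == m)%N = ((I + 1 == p) && (J + 1 == q)%N) by lia.
have -> : (p + m - 1 - I == 0)%N = ((I + 1 == p + m) && (J + m + 1 == q)%N).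
  by move: h1 h2; rewrite /m; lia.
by case: ((I + 1 == p + m) && _)%N; rewrite ?addrK ?addr0.
Qed.

End Residue.

(** * Invertibility of Gram matrices that are triangular for a weight *)

Section AntiTriangular.
Variables (k : fieldType) (n : nat) (G : 'M[k]_n) (wt : 'I_n -> int) (c : int).
Variable star : 'I_n -> 'I_n.
Hypothesis wt_star : forall x, wt x + wt (star x) = c.
Hypothesis G_star : forall x, G x (star x) != 0.
Hypothesis G_wt : forall x y, G x y != 0 -> wt x + wt y <= c.
Hypothesis G_eq : forall x y, G x y != 0 -> wt x + wt y = c -> x = star y.

(** In a null vector take a nonzero coordinate [x] of least weight: in column [star x] of the
    product only the term of [x] can survive. *)
Lemma anti_triangular_unit : (forall x, star (star x) = x) -> G \in unitmx.
Proof.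
move=> starK; rewrite unitmxE unitfE; apply/negP => /det0P [v v0 vG].
have [x vx] : exists x, v 0 x != 0.
  by apply/rV0Pn; apply: contra v0 => /eqP ->.
case: (@arg_minP _ _ _ x (fun y => v 0 y != 0) wt vx) => {vx}x vx xmin.
have /eqP := congr1 (fun u : 'rV_n => u 0 (star x)) vG.
rewrite !mxE (bigD1 x)//= big1 ?addr0 ?mulf_eq0 ?(negPf vx) ?(negPf (G_star _))//.
move=> z zx; apply/eqP; rewrite mulf_eq0; apply/norP => -[vz Gz].
have := xmin _ vz; have := G_wt Gz; have := wt_star x => e1 e2 e3.
have e4 : wt z + wt (star x) = c by lia.
by case/negP: zx; rewrite (G_eq Gz e4) starK.
Qed.

End AntiTriangular.

(* (true, i, j) stands for N^i y^j e1 and (false, i, j) for N^i y^j e2. *)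
Section Boxes.
Variables (p q al be : nat).

Definition monom : Type := (bool * nat * nat)%type.

Definition mdeg (w : monom) : nat := (w.1.2 + w.2 + ~~ w.1.1 * al)%N.
(** The exponents of y run over q + m values for e1 and q values for e2; shifting the latter by m /
    2 gives both ranges the same centre. Doubling keeps the weight an integer. *)
Definition mwt (w : monom) : nat := (2 * w.2 + ~~ w.1.1 * (al + be))%N.
Definition mshift (w : monom) : monom := (w.1.1, w.1.2.+1, w.2).
Definition oldbox (w : monom) : bool :=
  if w.1.1 then (w.1.2 < p + al)%N && (w.2 < q + al + be)%N
  else (w.1.2 < p + be)%N && (w.2 < q)%N.

Definition ostar (w : monom) : monom :=
  if w.1.1 then (true, p + al - 1 - w.1.2, q + al + be - 1 - w.2)%N
  else (false, p + be - 1 - w.1.2, q - 1 - w.2)%N.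

Lemma ostarK w : oldbox w -> ostar (ostar w) = w.
Proof.
by case: w => [[[] i] j]; rewrite /oldbox/ostar/= => h; congr (_, _, _); lia.
Qed.

Lemma oldbox_star w : oldbox w -> oldbox (ostar w).
Proof. by case: w => [[[] i] j]; rewrite /oldbox/ostar/= => h; lia. Qed.

Lemma mwt_star w : oldbox w -> (mwt w + mwt (ostar w))%N = (2 * (q + al + be - 1))%N.
Proof. by case: w => [[[] i] j]; rewrite /oldbox/ostar/mwt/= => h; lia. Qed.

(* In this basis (false, i, j) stands for N^i y^j (F e1 + e2). *)
Definition newbox (w : monom) : bool :=
  if w.1.1 then (w.1.2 < p + (al + be))%N && (w.2 < q + al)%N
  else (w.1.2 < p)%N && (w.2 < q + be)%N.

Definition nstar (w : monom) : monom :=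
  if w.1.1 then (true, p + (al + be) - 1 - w.1.2, q + al - 1 - w.2)%N
  else (false, p - 1 - w.1.2, q + be - 1 - w.2)%N.

(** The shifts centre the ranges of lengths q + al and q + be at the same point as [mwt] does for
    the old strings. *)
Definition nwt (w : monom) : nat := (2 * w.2 + if w.1.1 then be else al)%N.

Lemma nstarK w : newbox w -> nstar (nstar w) = w.
Proof.
by case: w => [[[] i] j]; rewrite /newbox/nstar/= => h; congr (_, _, _); lia.
Qed.

Lemma newbox_star w : newbox w -> newbox (nstar w).
Proof. by case: w => [[[] i] j]; rewrite /newbox/nstar/= => h; lia. Qed.

Lemma nwt_star w : newbox w ->
  (nwt w + nwt (nstar w))%N = (2 * (q + al + be - 1))%N.
Proof. by case: w => [[[] i] j]; rewrite /newbox/nstar/nwt/= => h; lia. Qed.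

End Boxes.

(** * Relations of the module and triangularity of its form *)

Section Monomials.
Variables (k : fieldType) (p q al be : nat) (f g : {poly k}).
Hypotheses (al_gt0 : (0 < al)%N) (be_gt0 : (0 < be)%N).
Hypotheses (size_f : size f = al.+1) (size_g : size g = be.+1).
Hypotheses (f_monic : f \is monic) (g_monic : g \is monic).
Hypothesis fg1 : f * g = 'X^(al + be) + 1.
Let m := (al + be)%N.
Local Notation gdual := (gdual p q al be f g).
Local Notation oldbox := (oldbox p q al be).
Local Notation ostar := (ostar p q al be).
Local Notation mdeg := (mdeg al).
Local Notation mwt := (mwt al be).

Definition mpair (z w : monom) : k := gdual z.1.1 w.1.1 (z.1.2 + w.1.2) (z.2 + w.2).

Lemma mpairC z w : mpair z w = mpair w z.
Proof. by rewrite /mpair gdualC (addnC w.1.2) (addnC w.2). Qed.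

Lemma mpair_shift z w : mpair (mshift z) w = mpair z (mshift w).
Proof. by rewrite /mpair/= addSnnS. Qed.

Lemma mpair_deg z w : mpair z w != 0 ->
  (mdeg z + mdeg w + 2 = p + q + m + al)%N.
Proof.
case: z w => [[[] i] j] [[[] i'] j']; rewrite /mpair/mdeg/gdual/=;
  by case: ifP => [h _|]; rewrite ?eqxx//; rewrite /m; lia.
Qed.

(** The degrees of f and g bound the exponent of N from below, hence by homogeneity that of y from
    above; equality picks out the leading coefficients. The mixed pairings stay strictly below since
    m > 0. *)
Lemma mpair_wt z w : mpair z w != 0 -> oldbox z -> oldbox w ->
  (mwt z + mwt w <= 2 * (q + al + be - 1))%N /\
  ((mwt z + mwt w)%N = (2 * (q + al + be - 1))%N -> z = ostar w).
Proof.
case: z w => [[[] i] j] [[[] i'] j']; rewrite /mpair/mwt/oldbox/gdual/ostar/=;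
  case: ifP => [h nz b1 b2|]; rewrite ?eqxx//; try lia.
- have sz : (p + m - 1 - (i + i') < be.+1)%N.
    by rewrite -size_g ltnNge; apply: contra nz => /(nth_default 0) ->.
  by move: h sz b1 b2; rewrite /m => h sz b1 b2; split; [lia|move=> e; congr (_, _, _); lia].
- have sz : (p + m - 1 - (i + i') < al.+1)%N.
    by rewrite -size_f ltnNge; apply: contra nz => /(nth_default 0) ->.
  by move: h sz b1 b2; rewrite /m => h sz b1 b2; split; [lia|move=> e; congr (_, _, _); lia].
Qed.

Lemma mpair_ostar w : oldbox w -> mpair w (ostar w) = 1.
Proof.
have fl : f`_al = 1 by rewrite -(monicP f_monic) lead_coefE size_f.
have gl : g`_be = 1 by rewrite -(monicP g_monic) lead_coefE size_g.
case: w => [[[] i] j]; rewrite /mpair/oldbox/ostar/gdual/= => h;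
  (case: ifP => h'; last by lia).
- by rewrite -[RHS]gl; congr (_`_ _); lia.
- by rewrite -[RHS]fl; congr (_`_ _); lia.
Qed.

(** The relation y^(q+m) e1 = 0 as the vanishing of functionals; the next two lemmas do the same for
    y^q e2 = 0 and N^(p+m) e1 = 0. *)
Lemma mpair_true_big z i j : (q + m <= j)%N -> mpair z (true, i, j) = 0.
Proof.
move=> h; case: z => [[[] i'] j']; rewrite /mpair/gdual/=; case: ifP => // h'.
  by rewrite nth_default// size_g; move: h h'; rewrite /m; lia.
by move: h h'; rewrite /m; lia.
Qed.

Lemma mpair_false_big z i j : (q <= j)%N -> mpair z (false, i, j) = 0.
Proof.
move=> h; case: z => [[[] i'] j']; rewrite /mpair/gdual/=; case: ifP => // h'.
  by lia.
by rewrite nth_default// size_f; lia.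
Qed.

Lemma mpair_u_kill z i j : (p + m <= i)%N -> mpair z (true, i, j) = 0.
Proof.
by move=> h; case: z => [[[] i'] j']; rewrite /mpair/gdual/=; case: ifP => //; lia.
Qed.

(** The pairing of [z] with N^i y^j (F e1 + e2). *)
Definition mpair_v (z : monom) i j : k :=
  \sum_(r < al.+1) f`_r * mpair z (true, i + r, j + al - r)%N
  + mpair z (false, i, j).

Lemma mpair_vE z i j : mpair_v z i j =
  if z.1.1 then ((z.1.2 + i + 1 == p) && (z.2 + j + 1 == q + m))%N%:R else 0.
Proof.
have h1 := gdual_f_true p q al_gt0 be_gt0 size_f size_g fg1 (z.1.2 + i) (z.2 + j).
have h2 := gdual_f_false p q al_gt0 be_gt0 size_f size_g (z.1.2 + i) (z.2 + j).
rewrite /mpair_v; case: z h1 h2 => [[[] i'] j']/= h1 h2.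
  rewrite -[RHS]h1; congr (_ + _); apply: eq_bigr => r _.
  by congr (_ * gdual _ _ _ _) => /=; have := ltn_ord r; lia.
rewrite -[RHS]h2; congr (_ + _); apply: eq_bigr => r _.
by congr (_ * gdual _ _ _ _) => /=; have := ltn_ord r; lia.
Qed.

Lemma mpair_v_kill z i j : (p <= i)%N -> mpair_v z i j = 0.
Proof.
by move=> h; rewrite mpair_vE; case: ifP => // _; rewrite (_ : _ && _ = false)//; lia.
Qed.

(** The relation N^p (y^m e1 + G e2) = 0. *)
Lemma mpair_g z i j : (p <= i)%N ->
  \sum_(r < be.+1) g`_r * mpair z (false, i + r, j + be - r)%N
  + mpair z (true, i, j + m)%N = 0.
Proof.
move=> pi.
have h1 := gdual_g_true p q al_gt0 be_gt0 size_f size_g (z.1.2 + i) (z.2 + j).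
have := gdual_g_false p q al_gt0 be_gt0 size_f size_g fg1 (z.1.2 + i) (z.2 + j).
rewrite (_ : _ && _ = false)/=; last by lia.
move=> h2; case: z h1 h2 => [[[] i'] j']/= h1 h2.
  rewrite -[RHS]h1; congr (_ + _); last by congr (gdual _ _ _ _) => /=; lia.
  by apply: eq_bigr => r _; congr (_ * gdual _ _ _ _) => /=; have := ltn_ord r; lia.
rewrite -[RHS]h2; congr (_ + _); last by congr (gdual _ _ _ _) => /=; lia.
by apply: eq_bigr => r _; congr (_ * gdual _ _ _ _) => /=; have := ltn_ord r; lia.
Qed.

End Monomials.

Lemma sign_parity (k : pzRingType) a b : odd a = odd b -> (-1) ^+ a = (-1) ^+ b :> k.
Proof. by move=> e; rewrite -signr_odd e signr_odd. Qed.

Lemma mulmx_neq0 (k : fieldType) m n p (X : 'M[k]_(m, n)) (Y : 'M[k]_(n, p)) x y : (X *m Y) x y != 0 ->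
  exists2 z, X x z != 0 & Y z y != 0.
Proof.
rewrite mxE => s0; case: (pickP (fun z => (X x z != 0) && (Y z y != 0))).
  by move=> z /andP[]; exists z.
move=> h; case/eqP: s0; apply: big1 => z _; apply/eqP; rewrite mulf_eq0.
by have := h z; case: eqP; case: eqP.
Qed.

(** * Matrices homogeneous in degree and triangular in weight *)

Section WeightedMatrices.
Variables (k : fieldType) (n : nat) (deg wt : 'I_n -> nat).

Definition weak_raising (d : nat) (X : 'M[k]_n) : Prop :=
  forall x y, X x y != 0 -> deg x = (deg y + d)%N /\ (wt y <= wt x)%N.
Definition strict_raising (d : nat) (X : 'M[k]_n) : Prop :=
  forall x y, X x y != 0 -> deg x = (deg y + d)%N /\ (wt y < wt x)%N.

Lemma strict_weak d X : strict_raising d X -> weak_raising d X.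
Proof. by move=> h x y /h [-> /ltnW]. Qed.

Lemma weakD d X Y : weak_raising d X -> weak_raising d Y -> weak_raising d (X + Y).
Proof.
move=> hX hY x y; rewrite mxE.
by have [->|/hX//] := eqVneq (X x y) 0; rewrite add0r => /hY.
Qed.

Lemma strictD d X Y :
  strict_raising d X -> strict_raising d Y -> strict_raising d (X + Y).
Proof.
move=> hX hY x y; rewrite mxE.
by have [->|/hX//] := eqVneq (X x y) 0; rewrite add0r => /hY.
Qed.

Lemma strictZ d a X : strict_raising d X -> strict_raising d (a *: X).
Proof. by move=> hX x y; rewrite mxE mulf_eq0 negb_or => /andP[_ /hX]. Qed.

Lemma strict_mull d e X Y :
  strict_raising d X -> weak_raising e Y -> strict_raising (d + e) (X *m Y).
Proof.
move=> hX hY x y /mulmx_neq0 [z /hX [-> lt1] /hY [-> le2]]; split; first lia.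
exact: leq_ltn_trans lt1.
Qed.

Lemma strict_mulr d e X Y :
  weak_raising d X -> strict_raising e Y -> strict_raising (d + e) (X *m Y).
Proof.
move=> hX hY x y /mulmx_neq0 [z /hX [-> lt1] /hY [-> le2]]; split; first lia.
exact: leq_trans lt1.
Qed.

(** S' = 1 - Z S', and Z strictly raises the weight: an induction on the weight of the row replaces
    the Neumann series. *)
Lemma strict_inv Z S' : strict_raising 0 Z -> (1%:M + Z) *m S' = 1%:M ->
  strict_raising 0 (S' - 1%:M).
Proof.
move=> hZ; rewrite mulmxDl mul1mx => e.
have -> : S' - 1%:M = - (Z *m S') by rewrite -e opprD addNKr.
suff h N : forall x y, (wt x < N)%N -> (- (Z *m S')) x y != 0 ->
    deg x = (deg y + 0)%N /\ (wt y < wt x)%N.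
  by move=> x y; apply: (h (wt x).+1).
elim: N => // N IH x y ltN.
have eS : S' = 1%:M - Z *m S' by rewrite -e addrK.
rewrite mxE oppr_eq0 => /mulmx_neq0 [z /hZ [-> ltz]].
rewrite eS mxE; have [->|/IH IHz _] := eqVneq ((- (Z *m S')) z y) 0.
  by rewrite addr0 mxE; have [<-|] := eqVneq z y; rewrite ?eqxx// !addn0.
by have [|-> lty] := IHz; [lia|split; lia].
Qed.

End WeightedMatrices.

(** A monomial pushed out of the range of [mon] matches no row, so its column is zero. *)
Definition shift_mx (k : fieldType) n (mon : 'I_n -> monom) : 'M[k]_n :=
  \matrix_(x, y) (mon x == mshift (mon y))%:R.

Lemma mulmx1C_eq (k : fieldType) m n (A : 'M[k]_(m, n)) (B : 'M[k]_(n, m)) :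
  m = n -> B *m A = 1%:M -> A *m B = 1%:M.
Proof. by move=> e; case: n / e A B => A B; exact: mulmx1C. Qed.

(** * The degeneration in coordinates *)

Section Degeneration.
Variables (k : closedFieldType) (two_neq0 : 2%:R != 0 :> k).
Variables (p q al be : nat) (f g : {poly k}).
Hypotheses (al_gt0 : (0 < al)%N) (be_gt0 : (0 < be)%N).
Hypotheses (size_f : size f = al.+1) (size_g : size g = be.+1).
Hypotheses (f_monic : f \is monic) (g_monic : g \is monic).
Hypothesis fg1 : f * g = 'X^(al + be) + 1.
Local Notation m := (al + be)%N.
Local Notation newbox := (newbox p q al be).
Local Notation oldbox := (oldbox p q al be).
Local Notation ostar := (ostar p q al be).
Local Notation nstar := (nstar p q al be).
Local Notation nwt := (nwt al be).
Local Notation mpair := (mpair p q al be f g).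
Local Notation mpair_v := (mpair_v p q al be f g).
Local Notation mdeg := (mdeg al).
Local Notation mwt := (mwt al be).
Variables (n nn : nat) (mo : 'I_n -> monom) (mn : 'I_nn -> monom).
Hypothesis mo_inj : injective mo.
Hypothesis mo_box : forall x, oldbox (mo x).
Hypothesis mo_surj : forall w, oldbox w -> exists x, mo x = w.
Hypothesis mn_inj : injective mn.
Hypothesis mn_box : forall x, newbox (mn x).
Hypothesis mn_surj : forall w, newbox w -> exists x, mn x = w.
Hypothesis eq_n : n = nn.
Local Notation c := (2 * (q + al + be - 1))%N.
Local Notation odeg := (fun x => mdeg (mo x)).
Local Notation owt := (fun x => mwt (mo x)).
Local Notation Nold := (shift_mx k mo).
Local Notation Nnew := (shift_mx k mn).

(** A functional stands for an element of the module; [d] is its degree and [th] a lower bound for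
    the weights of the old monomials that occur. *)
Definition in_span (th d : nat) (phi : monom -> k) : Prop :=
  exists2 v : 'I_n -> k, forall z, phi z = \sum_x v x * mpair z (mo x) &
    forall x, v x != 0 -> odeg x = d /\ (th <= owt x)%N.

Lemma eq_in_span th d phi psi : phi =1 psi -> in_span th d psi -> in_span th d phi.
Proof. by move=> e [v h1 h2]; exists v => // z; rewrite e. Qed.

Lemma in_span0 th d phi : phi =1 (fun=> 0) -> in_span th d phi.
Proof.
move=> e; exists (fun=> 0) => [z|x]; last by rewrite eqxx.
by rewrite e big1// => x _; rewrite mul0r.
Qed.

Lemma in_spanD th d phi psi : in_span th d phi -> in_span th d psi ->
  in_span th d (fun z => phi z + psi z).
Proof.
move=> [u hu ud] [v hv vd]; exists (fun x => u x + v x) => [z|x].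
  by rewrite hu hv -big_split/=; apply: eq_bigr => x _; rewrite mulrDl.
by have [->|/ud//] := eqVneq (u x) 0; rewrite add0r => /vd.
Qed.

Lemma in_spanZ th d a phi : in_span th d phi -> in_span th d (fun z => a * phi z).
Proof.
move=> [u hu ud]; exists (fun x => a * u x) => [z|x].
  by rewrite hu big_distrr/=; apply: eq_bigr => x _; rewrite mulrA.
by rewrite mulf_eq0 negb_or => /andP[_ /ud].
Qed.

Lemma in_span_sum th d r (phi : nat -> monom -> k) :
  (forall i, (i < r)%N -> in_span th d (phi i)) ->
  in_span th d (fun z => \sum_(i < r) phi i z).
Proof.
elim: r => [|r IH] h; first by apply: in_span0 => z; rewrite big_ord0.
apply: (@eq_in_span _ _ _ (fun z => \sum_(i < r) phi i z + phi r z)).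
  by move=> z; rewrite big_ord_recr.
by apply: in_spanD; [apply: IH => i ir; apply: h; lia|apply: h].
Qed.

Lemma in_span_old th w : oldbox w -> (th <= mwt w)%N ->
  in_span th (mdeg w) (mpair^~ w).
Proof.
move=> /mo_surj [x <-] hth; exists (fun y => (y == x)%:R) => [z|y].
  rewrite (bigD1 x)//= eqxx mul1r big1 ?addr0// => y /negPf ->; exact: mul0r.
by have [->|] := eqVneq y x; rewrite /= ?eqxx.
Qed.

Lemma in_span_true th i j : (i < p + al)%N -> (th <= 2 * j)%N ->
  in_span th (i + j) (mpair^~ (true, i, j)).
Proof.
move=> hi hth; have [hj|hj] := ltnP j (q + al + be).
  have -> : (i + j = mdeg (true, i, j))%N by rewrite /mdeg/=; lia.
  by apply: in_span_old; rewrite /oldbox/mwt/= ?hi ?hj//; lia.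
by apply: in_span0 => z; apply: mpair_true_big => //; lia.
Qed.

Lemma in_span_false th i j : (i < p + be)%N -> (th <= 2 * j + m)%N ->
  in_span th (i + j + al) (mpair^~ (false, i, j)).
Proof.
move=> hi hth; have [hj|hj] := ltnP j q.
  have -> : (i + j + al = mdeg (false, i, j))%N by rewrite /mdeg/=; lia.
  by apply: in_span_old; rewrite /oldbox/mwt/= ?hi ?hj//; lia.
by apply: in_span0 => z; apply: mpair_false_big.
Qed.

(** N differs from the old shift only at the end of a string. There a relation whose leading
    coefficient is 1 rewrites the product in monomials of larger weight. *)
Lemma shift_remainder y :
  in_span (owt y).+1 (odeg y).+1 (fun z => mpair z (mshift (mo y))
    - (if oldbox (mshift (mo y)) then mpair z (mshift (mo y)) else 0)).
Proof.
have := mo_box y; case: (mo y) => [[a i] j]; rewrite /mshift/=.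
case: (boolP (oldbox (a, i.+1, j))) => [_ _|nb yb]; first by apply: in_span0 => z; rewrite subrr.
case: a nb yb => nb yb.
  (* End of an e1-string: N^p (F e1 + e2) = 0 is solved for N^(p+al) e1. *)
  have ei : i.+1 = (p + al)%N by move: nb yb; rewrite /oldbox/=; lia.
  rewrite ei; apply: (@eq_in_span _ _ _
    (fun z => -1 * (\sum_(r < al) f`_r * mpair z (true, p + r, j + al - r)%N
                    + mpair z (false, p, j)))).
    move=> z; have := mpair_v_kill q al_gt0 be_gt0 size_f size_g f_monic g_monic fg1 z j (leqnn p).
    rewrite /mpair_v big_ord_recr/=.
    have -> : f`_al = 1 by rewrite -(monicP f_monic) lead_coefE size_f.
    rewrite mul1r addnK subr0 mulN1r => e.
    by apply/eqP; rewrite -subr_eq0 opprK; apply/eqP; rewrite -[RHS]e; ring.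
  apply/in_spanZ/in_spanD.
    apply: (@in_span_sum _ _ _ (fun r z => f`_r * mpair z (true, p + r, j + al - r)%N)).
    move=> r hr; apply: in_spanZ.
    have -> : (mdeg (true, i, j)).+1 = (p + r + (j + al - r))%N.
      by rewrite /mdeg/=; lia.
    by apply: in_span_true; rewrite /mwt/=; lia.
  have -> : (mdeg (true, i, j)).+1 = (p + j + al)%N by rewrite /mdeg/=; lia.
  by apply: in_span_false; rewrite /mwt/=; lia.
(* End of an e2-string: N^p (y^m e1 + G e2) = 0 is solved for N^(p+be) e2. *)
have ei : i.+1 = (p + be)%N by move: nb yb; rewrite /oldbox/=; lia.
rewrite ei; apply: (@eq_in_span _ _ _
  (fun z => -1 * (\sum_(r < be) g`_r * mpair z (false, p + r, j + be - r)%N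
                  + mpair z (true, p, j + m)%N))).
  move=> z; have := mpair_g q al_gt0 be_gt0 size_f size_g f_monic g_monic fg1 z j (leqnn p).
  rewrite big_ord_recr/=.
  have -> : g`_be = 1 by rewrite -(monicP g_monic) lead_coefE size_g.
  rewrite mul1r addnK subr0 mulN1r => e.
  by apply/eqP; rewrite -subr_eq0 opprK; apply/eqP; rewrite -[RHS]e; ring.
apply/in_spanZ/in_spanD.
  apply: (@in_span_sum _ _ _ (fun r z => g`_r * mpair z (false, p + r, j + be - r)%N)).
  move=> r hr; apply: in_spanZ.
  have -> : (mdeg (false, i, j)).+1 = (p + r + (j + be - r) + al)%N.
    by rewrite /mdeg/=; lia.
  by apply: in_span_false; rewrite /mwt/=; lia.
have -> : (mdeg (false, i, j)).+1 = (p + (j + m))%N by rewrite /mdeg/=; lia.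
by apply: in_span_true; rewrite /mwt/=; lia.
Qed.

Lemma shift_old_sum z y : \sum_x Nold x y * mpair z (mo x) =
  if oldbox (mshift (mo y)) then mpair z (mshift (mo y)) else 0.
Proof.
case: ifP => [/mo_surj [x ex]|nb].
  rewrite (bigD1 x)//= mxE ex eqxx mul1r big1 ?addr0// => x' xx'.
  rewrite mxE (_ : _ == _ = false) ?mul0r//; apply/negP => /eqP e.
  by case/negP: xx'; apply/eqP/mo_inj; rewrite e.
apply: big1 => x _; rewrite mxE (_ : _ == _ = false) ?mul0r//.
by apply/negP => /eqP e; rewrite -e mo_box in nb.
Qed.

(** [A] is multiplication by N in the old basis, read through the pairing. *)
Lemma multiplication_mx : exists2 A : 'M[k]_n,
  forall z y, mpair z (mshift (mo y)) = \sum_x A x y * mpair z (mo x) &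
  strict_raising odeg owt 1 (A - Nold).
Proof.
have [v hv vd] := fin_all_exists2 (fun y : 'I_n => shift_remainder y).
exists (Nold + \matrix_(x, y) v y x) => [z y|x y].
  have -> : \sum_x (Nold + \matrix_(x, y) v y x) x y * mpair z (mo x)
     = \sum_x Nold x y * mpair z (mo x) + \sum_x v y x * mpair z (mo x).
    by rewrite -big_split; apply: eq_bigr => x _; rewrite !mxE mulrDl.
  by rewrite -hv shift_old_sum addrC subrK.
by rewrite addrC addKr mxE => /vd [-> ?]; rewrite addn1.
Qed.

Lemma shift_old_weak : weak_raising odeg owt 1 Nold.
Proof.
move=> x y; rewrite mxE; case: (mo x =P _) => [->|_]; last by rewrite /= eqxx.
by move=> _; rewrite /mdeg /mwt/=; split; lia.
Qed.

Lemma in_span_shift d phi :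
  in_span 0 d phi -> in_span 0 d.+1 (fun z => phi (mshift z)).
Proof.
have [A hA Ad] := multiplication_mx.
have Aw : weak_raising odeg owt 1 A.
  rewrite -[A](subrK Nold); apply: weakD shift_old_weak; exact: strict_weak.
move=> [v hv vd]; exists (fun y => \sum_x A y x * v x) => [z|y].
  rewrite hv; under eq_bigr => x _ do rewrite mpair_shift// hA big_distrr/=.
  rewrite exchange_big/=; apply: eq_bigr => y _; rewrite big_distrl/=.
  by apply: eq_bigr => x _; rewrite mulrA [v x * _]mulrC.
move=> s0; case: (pickP (fun x => (A y x != 0) && (v x != 0))).
  by move=> x /andP[/Aw [-> _] /vd [-> _]]; rewrite addn1.
move=> h; case/eqP: s0; apply: big1 => x _; apply/eqP; rewrite mulf_eq0.
by have := h x; case: eqP; case: eqP.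
Qed.

(** The old monomials span the module: induction on the power of N, multiplying by N at each
    step. *)
Lemma in_span_mpair w : in_span 0 (mdeg w) (mpair^~ w).
Proof.
case: w => [[a i] j]; elim: i => [|i IH].
  case: a.
    have -> : mdeg (true, 0, j)%N = (0 + j)%N by rewrite /mdeg/=; lia.
    by apply: in_span_true => //; lia.
  have -> : mdeg (false, 0, j)%N = (0 + j + al)%N by rewrite /mdeg/=; lia.
  by apply: in_span_false => //; lia.
have -> : mdeg (a, i.+1, j) = (mdeg (a, i, j)).+1 by rewrite /mdeg/=; lia.
apply: eq_in_span (in_span_shift IH) => z.
by rewrite mpair_shift.
Qed.

Definition new_functional (w : monom) (z : monom) : k :=
  if w.1.1 then mpair z w else mpair_v z w.1.2 w.2.

Lemma in_span_new w : in_span 0 (mdeg w) (new_functional w).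
Proof.
rewrite /new_functional; case: w => [[[] i] j]/=; first exact: in_span_mpair.
apply: in_spanD; last exact: in_span_mpair.
apply: (@in_span_sum _ _ _ (fun r z => f`_r * mpair z (true, i + r, j + al - r)%N)).
move=> r hr; apply: in_spanZ.
have -> : mdeg (false, i, j) = mdeg (true, i + r, j + al - r)%N.
  by rewrite /mdeg/=; lia.
exact: in_span_mpair.
Qed.

Lemma new_functional_shift w z :
  new_functional w (mshift z) = new_functional (mshift w) z.
Proof.
case: w => [[[] i] j]; rewrite /new_functional/= ?mpair_shift//.
by rewrite /mpair_v mpair_shift; under eq_bigr => r _ do rewrite mpair_shift.
Qed.

Lemma new_functional_out w z : ~~ newbox (mshift w) ->
  newbox w -> new_functional (mshift w) z = 0.
Proof.
case: w => [[[] i] j]; rewrite /new_functional/newbox/mshift/= => h1 h2.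
  by apply: mpair_u_kill => //; lia.
by apply: mpair_v_kill => //; lia.
Qed.

Definition gram : 'M[k]_n := \matrix_(x, y) mpair (mo x) (mo y).

Lemma ostar_ord : exists star : 'I_n -> 'I_n,
  forall x, mo (star x) = ostar (mo x).
Proof.
have h (x : 'I_n) : exists y, mo y = ostar (mo x).
  by apply: mo_surj; apply: oldbox_star => //; exact: mo_box.
by have [star hs] := fin_all_exists h; exists star.
Qed.

Lemma gram_unit : gram \in unitmx.
Proof.
have [star hs] := ostar_ord.
have starK x : star (star x) = x.
  by apply: mo_inj; rewrite !hs; apply: ostarK => //; exact: mo_box.
apply: (@anti_triangular_unit _ _ _ (fun x => (owt x)%:Z) c%:Z star) => //.
- move=> x /=; rewrite hs -PoszD; congr Posz.
  by apply: mwt_star (mo_box x).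
- by move=> x; rewrite mxE hs mpair_ostar ?oner_eq0//; exact: mo_box.
- move=> x y; rewrite mxE => nz /=.
  by have [] := mpair_wt al_gt0 be_gt0 size_f size_g f_monic g_monic nz (mo_box x) (mo_box y); lia.
move=> x y; rewrite mxE => nz /= e; apply: mo_inj; rewrite hs.
have [_] := mpair_wt al_gt0 be_gt0 size_f size_g f_monic g_monic nz (mo_box x) (mo_box y).
by apply; lia.
Qed.

Definition new_pair (y y' : monom) : k :=
  if y'.1.1 then new_functional y y'
  else \sum_(r < al.+1) f`_r * new_functional y (true, y'.1.2 + r, y'.2 + al - r)%N
       + new_functional y (false, y'.1.2, y'.2).

Lemma new_pair_vv i j i' j' : new_pair (false, i, j) (false, i', j') =
  if (i + i' < p)%N && (i + i' + (j + j') + al + 2 == p + (q + m))%N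
  then f`_(p - 1 - (i + i')) else 0.
Proof.
rewrite /new_pair/= {2}/new_functional/= mpair_vE//= addr0.
transitivity (\sum_(r < al.+1) f`_r *
    ((i + i' + r + 1 == p) && (j + (j' + al - r) + 1 == q + m))%N%:R).
  apply: eq_bigr => r _; congr (_ * _); rewrite /new_functional/= mpair_vE//=.
  by congr ((_ && _)%:R); lia.
case: ifP => [/andP[h1 /eqP h2]|nc]; last first.
  rewrite big1// => r _; case: (boolP (_ && _)) => [h|_]; last by rewrite mulr0.
  by have := ltn_ord r; lia.
case: (leqP (p - 1 - (i + i')) al) => hs; last first.
  rewrite [RHS]nth_default ?size_f// big1// => r _.
  case: (boolP (_ && _)) => [h|_]; last by rewrite mulr0.
  by have := ltn_ord r; lia.
rewrite -ltnS in hs; rewrite (bigD1 (Ordinal hs))//= big1 ?addr0.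
  by rewrite (_ : _ && _ = true) ?mulr1//; lia.
move=> r /negP hr; case: (boolP (_ && _)) => [h|_]; last by rewrite mulr0.
by case: hr; apply/eqP/val_inj => /=; lia.
Qed.

Lemma new_pair_uv i j i' j' :
  new_pair (true, i, j) (false, i', j') =
    ((i + i' + 1 == p) && (j + j' + 1 == q + m))%N%:R.
Proof.
rewrite /new_pair/= /new_functional/= -[RHS]/(if true then _ else 0).
transitivity (mpair_v (true, i, j) i' j'); last by rewrite mpair_vE.
rewrite /mpair_v mpairC//; congr (_ + _); apply: eq_bigr => r _.
by rewrite mpairC.
Qed.

Lemma new_pair_vu i j i' j' :
  new_pair (false, i, j) (true, i', j') =
    ((i + i' + 1 == p) && (j + j' + 1 == q + m))%N%:R.
Proof.
rewrite /new_pair/= /new_functional/= mpair_vE//=.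
by congr ((_ && _)%:R); lia.
Qed.

Lemma new_pair_uu i j i' j' :
  new_pair (true, i, j) (true, i', j') =
  if (i + i' < p + m)%N && (i + i' + (j + j') + be + 2 == p + m + q + m)%N
  then g`_(p + m - 1 - (i + i')) else 0.
Proof. by rewrite /new_pair/= /new_functional/= /mpair/= addnC (addnC j'). Qed.

(** Opposite to [mpair_wt]: now the exponent of N is bounded above, hence that of y below. Equality
    picks out the constant coefficients of f and g, which are nonzero because f g has constant term
    1. *)
Lemma new_pair_wt y y' : new_pair y y' != 0 ->
  newbox y -> newbox y' ->
  (2 * (q + al + be - 1) <= nwt y + nwt y')%N /\
  ((2 * (q + al + be - 1))%N = (nwt y + nwt y')%N -> y = nstar y').
Proof.
case: y y' => [[[] i] j] [[[] i'] j']; rewrite /nwt/newbox/nstar/=.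
- rewrite new_pair_uu; case: ifP => [h nz b1 b2|]; last by rewrite eqxx.
  have sz : (p + m - 1 - (i + i') < be.+1)%N.
    by rewrite -size_g ltnNge; apply: contra nz => /(nth_default 0) ->.
  by split; [lia|move=> e; congr (_, _, _); lia].
- rewrite new_pair_uv; case: (boolP (_ && _)) => [h _|_]; last by rewrite eqxx.
  by split; lia.
- rewrite new_pair_vu; case: (boolP (_ && _)) => [h _|_]; last by rewrite eqxx.
  by split; lia.
rewrite new_pair_vv; case: ifP => [h nz b1 b2|]; last by rewrite eqxx.
have sz : (p - 1 - (i + i') < al.+1)%N.
  by rewrite -size_f ltnNge; apply: contra nz => /(nth_default 0) ->.
by split; [lia|move=> e; congr (_, _, _); lia].
Qed.

Lemma coef0_fg : f`_0 != 0 /\ g`_0 != 0.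
Proof.
have : (f * g)`_0 = 1.
  by rewrite (coef_fg fg1) eqxx (_ : 0 == _ = false) ?add0r//; lia.
rewrite coef0M => e; have := oner_neq0 k; rewrite -e mulf_eq0 negb_or.
by move/andP.
Qed.

Lemma new_pair_nstar y : newbox y -> new_pair y (nstar y) != 0.
Proof.
have [f0 g0] := coef0_fg.
case: y => [[[] i] j]; rewrite /newbox/nstar/= => h.
  rewrite new_pair_uu; case: ifP => h'; last by lia.
  by rewrite (_ : (_ - _)%N = 0%N)//; lia.
rewrite new_pair_vv; case: ifP => h'; last by lia.
by rewrite (_ : (_ - _)%N = 0%N)//; lia.
Qed.

Lemma new_pair_unit : (\matrix_(x, y) new_pair (mn x) (mn y) : 'M[k]_nn) \in unitmx.
Proof.
have h (x : 'I_nn) : exists y, mn y = nstar (mn x).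
  by apply: mn_surj; apply: newbox_star; exact: mn_box.
have [star hs] := fin_all_exists h.
(* The weights are negated because [new_pair_wt] bounds them from below. *)
apply: (@anti_triangular_unit _ _ _ (fun x => - (nwt (mn x))%:Z)
   (- (2 * (q + al + be - 1))%N%:Z) star) => //.
- by move=> x /=; rewrite hs -(nwt_star (mn_box x)); lia.
- by move=> x; rewrite mxE hs new_pair_nstar ?mn_box.
- by move=> x y; rewrite mxE => /new_pair_wt -/(_ (mn_box x) (mn_box y)) [] ? _ /=; lia.
- move=> x y; rewrite mxE => /new_pair_wt -/(_ (mn_box x) (mn_box y)) [] _ e e'.
  by apply: mn_inj; rewrite hs e//; move: e' => /=; lia.
by move=> x; apply: mn_inj; rewrite !hs nstarK ?mn_box.
Qed.

(** With G the Gram matrix twisted by (-1)^degree, multiplication by N is skew for G. Writing G = J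
    (1 + Z) with J antidiagonal, the factor 1 + Z is self-adjoint for J, and so is a square root S
    of it. Hence G = S^T J S, and conjugation by S makes N skew for J. *)
Lemma signed_form : exists2 J : 'M[k]_n,
  [/\ J^T = (-1) ^+ (p + q + m + al) *: J, J \in unitmx,
      forall x y, J x y != 0 -> (odeg x + odeg y + 2 = p + q + m + al)%N &
      forall x y, J x y != 0 -> (owt x + owt y)%N = c] &
  exists2 A : 'M[k]_n, A^T *m J + J *m A = 0 &
    strict_raising odeg owt 1 (A - Nold) /\
    exists K : 'M[k]_(n, nn), exists K' : 'M[k]_(nn, n),
      [/\ K *m K' = 1%:M, K' *m K = 1%:M, A *m K = K *m Nnew &
          forall x y, K x y != 0 -> odeg x = mdeg (mn y)].
Proof.
have [star hs] := ostar_ord.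
have starK x : star (star x) = x.
  by apply: mo_inj; rewrite !hs; apply: ostarK => //; exact: mo_box.
have pair_star x : mpair (mo x) (mo (star x)) = 1.
  by rewrite hs mpair_ostar//; exact: mo_box.
have pdeg x y : mpair (mo x) (mo y) != 0 -> (odeg x + odeg y + 2 = p + q + m + al)%N.
  by move=> nz; apply: mpair_deg nz.
have pwt x y : mpair (mo x) (mo y) != 0 -> y != star x -> (owt x + owt y < c)%N.
  move=> nz ne.
  have [] := mpair_wt al_gt0 be_gt0 size_f size_g f_monic g_monic nz (mo_box x) (mo_box y).
  rewrite leq_eqVlt => /predU1P [-> /(_ erefl)|//].
  by rewrite -hs => /mo_inj e; rewrite e starK eqxx in ne.
have sdeg x : (odeg x + odeg (star x) + 2 = p + q + m + al)%N.
  by apply: pdeg; rewrite pair_star oner_eq0.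
have swt x : (owt x + owt (star x))%N = c.
  by rewrite /= hs mwt_star//; exact: mo_box.
pose sg x : k := (-1) ^+ odeg x.
pose eps : k := (-1) ^+ (p + q + m + al).
have sg_sym x y : mpair (mo x) (mo y) != 0 -> sg y = eps * sg x.
  move=> /pdeg e; rewrite /sg /eps -exprD; apply: sign_parity; move: e => /=; lia.
pose J : 'M[k]_n := \matrix_(x, y) (sg x * (y == star x)%:R).
pose G : 'M[k]_n := \matrix_(x, y) (sg x * mpair (mo x) (mo y)).
have sgsg x : sg x * sg x = 1 by rewrite /sg -expr2 sqrr_sign.
have epseps : eps * eps = 1 by rewrite /eps -expr2 sqrr_sign.
have Jnz x y : J x y != 0 -> y = star x.
  by rewrite mxE; have [->//|] := eqVneq y (star x); rewrite mulr0 eqxx.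
have JT : J^T = eps *: J.
  apply/matrixP => x y; rewrite !mxE.
  have [->|ne] := eqVneq x (star y).
    rewrite starK eqxx !mulr1 (sg_sym (star y) y) ?mulrA ?epseps//.
    by rewrite mpairC pair_star oner_eq0.
  rewrite (_ : (y == star x) = false) ?mulr0//.
  by apply/negP => /eqP e; rewrite e starK eqxx in ne.
have JJ : J *m J = eps%:M.
  apply/matrixP => x y; rewrite !mxE (bigD1 (star x))//= big1 ?addr0.
    rewrite !mxE eqxx mulr1 starK (sg_sym x (star x)) ?pair_star ?oner_eq0//.
    by rewrite mulrA [sg x * _]mulrCA sgsg mulr1 mulr_natr eq_sym.
  by move=> z /negPf zx; rewrite mxE zx mulr0 mul0r.
have JiJ : (eps *: J) *m J = 1%:M.
  by rewrite -scalemxAl JJ -mul_scalar_mx -scalar_mxM epseps.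
have [_ uJ] := mulmx1_unit JiJ.
have GT : G^T = eps *: G.
  apply/matrixP => x y; rewrite !mxE mpairC.
  have [->|nz] := eqVneq (mpair (mo x) (mo y)) 0; first by rewrite !mulr0.
  by rewrite (sg_sym _ _ nz) mulrA.
have uG : G \in unitmx.
  have -> : G = diag_mx (\row_x sg x) *m gram.
    by apply/matrixP => x y; rewrite mul_diag_mx !mxE.
  rewrite unitmx_mul gram_unit andbT unitmxE det_diag unitfE.
  by apply/prodf_neq0 => x _; rewrite mxE signr_eq0.
pose Z := eps *: (J *m (G - J)).
have JBG : J *m (1%:M + Z) = G.
  rewrite mulmxDr mulmx1 /Z -scalemxAr mulmxA JJ mul_scalar_mx scalerA epseps.
  by rewrite scale1r addrC subrK.
(* J has the same entries as G at the star pairs; every other pairing has weight sum below [c], so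
   the involution turns it into a strict raise. *)
have Zstrict : strict_raising odeg owt 0 Z.
  move=> x y; rewrite mxE mulf_eq0 negb_or => /andP[_].
  case/mulmx_neq0 => z /Jnz ->; rewrite !mxE starK.
  have [->|ne] := eqVneq y x.
    by rewrite mpairC pair_star subrr eqxx.
  rewrite mulr0 subr0 mulf_eq0 negb_or => /andP[_ nz].
  have := pdeg _ _ nz; have := sdeg x; have := swt x; have := pwt _ _ nz.
  by rewrite starK => /(_ ne) /=; lia.
have uB : 1%:M + Z \in unitmx.
  by move: uG; rewrite -JBG unitmx_mul => /andP[].
have [S SS Salg] := mx_sqrt two_neq0 uB.
(* S is a polynomial in 1 + Z, hence a scalar plus a strictly raising matrix. *)
have [s Sstrict] : exists s, strict_raising odeg owt 0 (S - s%:M).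
  apply: (Salg (fun X => exists s, strict_raising odeg owt 0 (X - s%:M))).
  - by exists 1 => x y; rewrite subrr mxE eqxx.
  - move=> a X Y [u hX] [v hY]; exists (a * u + v).
    rewrite (_ : _ - _ = a *: (X - u%:M) + (Y - v%:M)).
      by apply: strictD => //; exact: strictZ.
    by rewrite scalerBr raddfD/= -scale_scalar_mx opprD addrACA.
  move=> X [u hX]; exists u.
  rewrite mulmxDl mul1mx addrAC; apply: strictD => //.
  apply: (@strict_mull _ _ _ _ 0 0 _ _ Zstrict).
  rewrite -[X](subrK u%:M); apply: weakD; first exact: strict_weak.
  move=> x y; rewrite mxE; have [->|_] := eqVneq x y; rewrite ?eqxx//.
  by rewrite addn0.
have BTJ : (1%:M + Z)^T *m J = J *m (1%:M + Z).
  have : eps *: ((1%:M + Z)^T *m J) = eps *: G.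
    by rewrite -GT -JBG trmx_mul JT -scalemxAr.
  move/(congr1 (fun X => eps *: X)); rewrite !scalerA epseps !scale1r => ->.
  by rewrite JBG.
have [SJ SB] : J *m S = S^T *m J /\ S *m (1%:M + Z) = (1%:M + Z) *m S.
  apply: (Salg (fun X => J *m X = X^T *m J /\ X *m (1%:M + Z) = (1%:M + Z) *m X)).
  - by rewrite trmx1 mul1mx mulmx1 mul1mx mulmx1.
  - move=> a X Y [hX1 hX2] [hY1 hY2]; split.
      by rewrite [(_ + _)^T]linearD/= [(_ *: _)^T]linearZ/= mulmxDl mulmxDr -scalemxAl -scalemxAr hX1 hY1.
    by rewrite (mulmxDl (a *: X)) (mulmxDr _ (a *: X)) -scalemxAl -scalemxAr hX2 hY2.
  move=> X [hX1 hX2]; split; last by rewrite -mulmxA hX2.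
  by rewrite -[in RHS]hX2 trmx_mul -[RHS]mulmxA -hX1 [RHS]mulmxA BTJ mulmxA.
have wscal a : weak_raising odeg owt 0 a%:M.
  move=> x y; rewrite mxE; have [->|_] := eqVneq x y; rewrite ?eqxx//.
  by rewrite addn0.
(* Strictly raising matrices have zero diagonal, so comparing one diagonal entry of S S = 1 + Z is
   enough; this takes an index, provided by e1 itself. *)
have ss1 : s * s = 1.
  have [x _] : exists x, mo x = (true, 0, 0)%N.
    by apply: mo_surj; rewrite /oldbox/=; lia.
  have h : strict_raising odeg owt 0 (1%:M - (s * s)%:M).
    have -> : 1%:M - (s * s)%:M = (S - s%:M) *m S + s%:M *m (S - s%:M) + -1 *: Z.
      rewrite mulmxBl mulmxBr SS -scalar_mxM scaleN1r.
      by rewrite addrA subrK addrAC addrK.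
    apply: strictD; last exact: strictZ.
    apply: strictD; last exact: (@strict_mulr _ _ _ _ 0 0).
    apply: (@strict_mull _ _ _ _ 0 0) => //.
    by rewrite -[S](subrK s%:M); apply: weakD => //; exact: strict_weak.
  have [|] := eqVneq ((1%:M - (s * s)%:M) x x) 0; last by move=> /h; rewrite ltnn => -[].
  by rewrite !mxE eqxx !mulr1n => /eqP; rewrite subr_eq0 => /eqP.
pose S1 := s *: S.
have S1S1 : S1 *m S1 = 1%:M + Z.
  by rewrite /S1 -scalemxAl -scalemxAr scalerA ss1 scale1r SS.
have uS1 : S1 \in unitmx by move: uB; rewrite -S1S1 unitmx_mul => /andP[].
pose Z1 := s *: (S - s%:M).
have Z1strict : strict_raising odeg owt 0 Z1 by exact: strictZ.
have S1E : S1 = 1%:M + Z1.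
  by rewrite /Z1 scalerBr scale_scalar_mx ss1 addrC subrK.
have Z2strict : strict_raising odeg owt 0 (invmx S1 - 1%:M).
  by apply: (strict_inv Z1strict); rewrite -S1E mulmxV.
have S1J : J *m S1 = S1^T *m J.
  by rewrite /S1 -scalemxAr SJ linearZ/= -scalemxAl.
have GS1 : G = S1^T *m J *m S1 by rewrite -S1J -mulmxA S1S1 JBG.
have [A hA Ad] := multiplication_mx.
have Aw : weak_raising odeg owt 1 A.
  rewrite -[A](subrK Nold); apply: weakD shift_old_weak; exact: strict_weak.
have GA : A^T *m G + G *m A = 0.
  apply/matrixP => x y; rewrite mxE [X in X + _]mxE [X in _ + X]mxE [RHS]mxE.
  have -> : \sum_j A^T x j * G j y = - sg x * mpair (mo y) (mshift (mo x)).
    rewrite hA big_distrr/=; apply: eq_bigr => z _; rewrite !mxE.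
    have [->|/Aw [e _]] := eqVneq (A z x) 0; first by rewrite !mul0r mulr0.
    rewrite /sg e addn1 exprS mpairC; ring.
  have -> : \sum_j G x j * A j y = sg x * mpair (mo x) (mshift (mo y)).
    by rewrite hA big_distrr/=; apply: eq_bigr => z _; rewrite !mxE; ring.
  by rewrite mpairC mpair_shift mulNr addNr.
exists J; first by split=> // x y /Jnz ->.
set S' := invmx S1 in Z2strict *.
have [A1 A1E] : exists A1, A1 = S1 *m A *m S' by exists (S1 *m A *m S').
have AS : A1 *m S1 = S1 *m A by rewrite A1E mulmxKV.
exists A1.
  have h : S1^T *m (A1^T *m J + J *m A1) *m S1 = 0.
    rewrite mulmxDr mulmxDl.
    have -> : S1^T *m (A1^T *m J) *m S1 = A^T *m G.
      by rewrite GS1 !mulmxA -(trmx_mul A1) AS trmx_mul.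
    have -> // : S1^T *m (J *m A1) *m S1 = G *m A.
    by rewrite GS1 -!mulmxA AS.
  have uST : S1^T \in unitmx by rewrite unitmx_tr.
  by rewrite -[LHS](mulmxK uS1) -[_ *m S1](mulKmx uST) [S1^T *m _]mulmxA h mulmx0 mul0mx.
split.
  (* Conjugation by a unipotent matrix changes A only by strictly raising terms. *)
  have -> : A1 - Nold = (A - Nold) + A *m (S' - 1%:M) + Z1 *m A *m S'.
    rewrite A1E [in LHS]S1E mulmxDl mul1mx mulmxDl mulmxBr mulmx1.
    by rewrite [A - Nold + _]addrC addrA subrK addrAC.
  have w1 : weak_raising odeg owt 0 S'.
    rewrite -[S'](subrK 1%:M); apply: weakD; first exact: strict_weak.
    exact: wscal.
  apply: strictD; first apply: strictD => //.
    exact: (@strict_mulr _ _ _ _ 1 0).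
  apply: (@strict_mull _ _ _ _ 1 0) => //.
  exact: (@strict_mull _ _ _ _ 0 1).
have [v hv vd] := fin_all_exists2 (fun y => in_span_new (mn y)).
pose K : 'M[k]_(n, nn) := \matrix_(x, y) v y x.
have hK y z : new_functional (mn y) z = \sum_x K x y * mpair z (mo x).
  by rewrite hv; apply: eq_bigr => x _; rewrite mxE.
(* The columns of K are the new basis in old coordinates; the invertible Gram matrix of the new
   basis then provides the inverse of K. *)
have KP : K^T *m gram *m K = \matrix_(x, y) new_pair (mn x) (mn y).
  apply/matrixP => y y'; rewrite -mulmxA mxE [RHS]mxE.
  transitivity (\sum_x K x y * new_functional (mn y') (mo x)).
    apply: eq_bigr => x _; rewrite !mxE hK; congr (_ * _).
    by apply: eq_bigr => x' _; rewrite !mxE mulrC.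
  have nE w : \sum_x K x y * mpair (mo x) w = new_functional (mn y) w.
    by rewrite hK; apply: eq_bigr => x _; rewrite mpairC.
  under eq_bigr => x _ do rewrite [new_functional _ _]/new_functional.
  rewrite /new_pair; case: ifP => _; first exact: nE.
  rewrite -nE; under [in RHS]eq_bigr => r _ do rewrite -nE big_distrr/=.
  rewrite exchange_big/= -big_split/=; apply: eq_bigr => x _.
  rewrite /mpair_v mulrDr; congr (_ + _); rewrite big_distrr/=.
  by apply: eq_bigr => r _; rewrite mulrCA.
have AK : A *m K = K *m Nnew.
  apply: (can_inj (mulKmx gram_unit)); apply/matrixP => z y.
  transitivity (new_functional (mshift (mn y)) (mo z)).
    rewrite -new_functional_shift hK mulmxA mxE.
    apply: eq_bigr => x _; rewrite mulrC mpair_shift hA; congr (_ * _).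
    by rewrite mxE; apply: eq_bigr => x' _; rewrite !mxE mulrC.
  rewrite mulmxA mxE.
  have gK y' : (gram *m K) z y' = new_functional (mn y') (mo z).
    by rewrite hK mxE; apply: eq_bigr => x' _; rewrite !mxE mulrC.
  under eq_bigr => y' _ do rewrite gK mxE.
  case: (boolP (newbox (mshift (mn y)))) => [/mn_surj [y1 e1]|nb].
    rewrite (bigD1 y1)//= -e1 eqxx mulr1 big1 ?addr0// => y' ne.
    rewrite (_ : _ == _ = false) ?mulr0//; apply/negP => /eqP e.
    by case/negP: ne; apply/eqP/mn_inj; rewrite e.
  rewrite new_functional_out ?mn_box// big1// => y' _.
  rewrite (_ : _ == _ = false) ?mulr0//; apply/negP => /eqP e.
  by case/negP: nb; rewrite -e mn_box.
pose K' := invmx (\matrix_(x, y) new_pair (mn x) (mn y)) *m K^T *m gram.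
have K'K : K' *m K = 1%:M.
  by rewrite /K' -2!mulmxA [K^T *m _]mulmxA KP mulVmx// new_pair_unit.
have KK' : K *m K' = 1%:M by apply: mulmx1C_eq.
exists (S1 *m K), (K' *m S'); split.
- by rewrite -mulmxA [K *m _]mulmxA KK' mul1mx mulmxV.
- by rewrite -mulmxA [S' *m _]mulmxA /S' mulVmx// mul1mx.
- by rewrite mulmxA AS -!mulmxA AK.
move=> x y; rewrite S1E mulmxDl mul1mx mxE.
have [->|nz _] := eqVneq (K x y) 0; last first.
  by move: nz; rewrite mxE => /vd [].
rewrite add0r => /mulmx_neq0 [z /Z1strict [-> _]].
by rewrite mxE => /vd [-> _]; rewrite addn0.
Qed.

Lemma graded_degeneration : exists (J : 'M[k]_n) (Nt : k -> 'M[k]_n),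
  [/\ J^T = (-1) ^+ (p + q + m + al) *: J, J \in unitmx &
      forall x y, J x y != 0 -> (odeg x + odeg y + 2 = p + q + m + al)%N] /\
  [/\ forall t, (Nt t)^T *m J + J *m Nt t = 0,
      Nt 0 = Nold,
      forall x y, exists P : {poly k}, forall t, Nt t x y = P.[t] &
      forall t, t != 0 -> exists (K : 'M[k]_(n, nn)) (K' : 'M[k]_(nn, n)),
        [/\ K *m K' = 1%:M, K' *m K = 1%:M, Nt t *m K = K *m Nnew &
            forall x y, K x y != 0 -> odeg x = mdeg (mn y)]].
Proof.
have [J [JT uJ Jdeg Jwt] [A AJ [Astrict [K [K' [KK' K'K AK Kdeg]]]]]] := signed_form.
have Aw : weak_raising odeg owt 1 A.
  rewrite -[A](subrK Nold); apply: weakD shift_old_weak; exact: strict_weak.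
(* Conjugation of A by diag(t^weight), extended to t = 0. The truncated exponent is harmless: A x y
   vanishes unless the weight of x is at least that of y. *)
exists J, (fun t => \matrix_(x, y) (t ^+ (owt x - owt y) * A x y)).
split; first by split.
split.
- move=> t; apply/matrixP => x y; rewrite !mxE.
  have /matrixP/(_ x y) := AJ; rewrite !mxE.
  (* J links only indices whose weights add up to [c], so both terms of the skewness relation are
     scaled by this same power, also at t = 0. *)
  move/(congr1 (fun u => t ^+ (c - owt x - owt y) * u)); rewrite mulr0 mulrDr => e0.
  rewrite -[RHS]e0.
  congr (_ + _); rewrite big_distrr; apply: eq_bigr => z _; rewrite !mxE /=.
    have [->|/Jwt e] := eqVneq (J z y) 0; first by rewrite !mulr0.
    by rewrite mulrA; congr (_ ^+ _ * _ * _); move: e => /=; lia.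
  have [->|/Jwt e] := eqVneq (J x z) 0; first by rewrite !mul0r mulr0.
  by rewrite mulrCA; congr (_ ^+ _ * _); move: e => /=; lia.
(* At t = 0 only the entries that keep the weight survive, and these form the old shift. *)
- apply/matrixP => x y; rewrite mxE.
  have [Nz|Nnz] := eqVneq (Nold x y) 0.
    rewrite Nz expr0n subn_eq0; case: leqP => h; last by rewrite mul0r.
    apply/eqP; rewrite mul1r; apply/negP => /negP nz.
    have /Astrict [_] : (A - Nold) x y != 0 by rewrite mxE [X in _ + X]mxE Nz subr0.
    by rewrite ltnNge h.
  have e : owt x = owt y.
    by move: Nnz; rewrite mxE; case: (mo x =P _) => [->//|_]; rewrite eqxx.
  rewrite /= e subnn mul1r; apply/eqP; rewrite -subr_eq0; apply/negP => /negP nz.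
  have /Astrict [_] : (A - Nold) x y != 0 by rewrite mxE [X in _ + X]mxE.
  by rewrite /= e ltnn.
- move=> x y; exists (A x y *: 'X^(owt x - owt y)) => t.
  by rewrite mxE hornerZ hornerXn mulrC.
move=> t t0; pose D := diag_mx (\row_(x < n) t ^+ owt x).
pose D' := diag_mx (\row_(x < n) t ^- owt x).
have DD' : D *m D' = 1%:M.
  rewrite mulmx_diag -diag_const_mx; congr diag_mx; apply/rowP => x.
  by rewrite !mxE divff// expf_neq0.
have D'D : D' *m D = 1%:M by exact: mulmx1C.
exists (D *m K), (K' *m D'); split.
- by rewrite mulmxA -[D *m K *m K']mulmxA KK' mulmx1.
- by rewrite mulmxA -[K' *m D' *m D]mulmxA D'D mulmx1.
- rewrite -[RHS]mulmxA -AK !mulmxA; congr (_ *m K).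
  apply/matrixP => x y; rewrite mul_mx_diag mul_diag_mx !mxE.
  have [->|/Aw [_ le]] := eqVneq (A x y) 0; first by rewrite mulr0 mul0r mulr0.
  by rewrite mulrAC -exprD subnK.
by move=> x y; rewrite mul_diag_mx mxE mulf_eq0 negb_or => /andP[_ /Kdeg].
Qed.

End Degeneration.

(** * Tensor indices as monomials, and the resulting family of nilpotents *)

Definition mon_of (a1 b1 a2 b2 : nat) (x : 'I_(a1 * b1 + a2 * b2)) : monom :=
  match fintype.split x with
  | inl y => (true, (mxtens_unindex y).1 : nat, (mxtens_unindex y).2 : nat)
  | inr y => (false, (mxtens_unindex y).1 : nat, (mxtens_unindex y).2 : nat)
  end.

Lemma mon_of_inj a1 b1 a2 b2 : injective (@mon_of a1 b1 a2 b2).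
Proof.
move=> x y e; apply: (can_inj (@splitK _ _)); move: e; rewrite /mon_of.
case: (fintype.split x) (fintype.split y) => [u|u] [v|v]//= [e1 e2];
  congr (_ _); rewrite -[u]mxtens_unindexK -[v]mxtens_unindexK;
  by congr mxtens_index; apply/eqP; rewrite xpair_eqE -!val_eqE /= e1 e2 !eqxx.
Qed.

Lemma mon_of_box a1 b1 a2 b2 (x : 'I_(a1 * b1 + a2 * b2)) :
  if (mon_of x).1.1 then ((mon_of x).1.2 < a1)%N && ((mon_of x).2 < b1)%N
  else ((mon_of x).1.2 < a2)%N && ((mon_of x).2 < b2)%N.
Proof. by rewrite /mon_of; case: fintype.split => u; apply/andP; split; exact: ltn_ord. Qed.

Lemma mon_of_surj a1 b1 a2 b2 (w : monom) :
  (if w.1.1 then (w.1.2 < a1)%N && (w.2 < b1)%N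
   else (w.1.2 < a2)%N && (w.2 < b2)%N) ->
  exists x : 'I_(a1 * b1 + a2 * b2), mon_of x = w.
Proof.
case: w => [[[] i] j]/= /andP[hi hj].
  exists (unsplit (inl (mxtens_index (Ordinal hi, Ordinal hj)))).
  by rewrite /mon_of unsplitK mxtens_indexK.
exists (unsplit (inr (mxtens_index (Ordinal hi, Ordinal hj)))).
by rewrite /mon_of unsplitK mxtens_indexK.
Qed.

Lemma Xn_add1_factor (k : closedFieldType) al be : (0 < al)%N ->
  exists f g : {poly k}, [/\ size f = al.+1, size g = be.+1, f \is monic,
    g \is monic & f * g = 'X^(al + be) + 1].
Proof.
move=> al0; pose P : {poly k} := 'X^(al + be) + 1.
have sP : size P = (al + be).+1.
  by rewrite /P size_polyDl ?size_polyXn// size_poly1 ltnS; lia.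
have mP : P \is monic.
  rewrite /P monicE lead_coefDl ?lead_coefXn// size_polyXn size_poly1; lia.
have [rs rsE] := closed_field_poly_normal P.
rewrite (monicP mP) scale1r in rsE.
have srs : size rs = (al + be)%N.
  by apply/eq_add_S; rewrite -sP rsE size_prod_XsubC.
exists (\prod_(z <- take al rs) ('X - z%:P)), (\prod_(z <- drop al rs) ('X - z%:P)).
rewrite !size_prod_XsubC !monic_prod_XsubC -big_cat cat_take_drop -rsE.
by rewrite size_takel ?size_drop srs ?leq_addr// addKn.
Qed.

Lemma string_degeneration (k : closedFieldType) (p q al be : nat) :
  2%:R != 0 :> k -> (0 < al)%N -> (0 < be)%N ->
  let mo := @mon_of (p + al) (q + al + be) (p + be) q in
  let mn := @mon_of (p + (al + be)) (q + al) p (q + be) in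
  exists (J : 'M[k]_((p + al) * (q + al + be) + (p + be) * q)) (Nt : k -> 'M[k]__),
  [/\ J^T = (-1) ^+ (p + q + be) *: J, J \in unitmx &
      forall x y, J x y != 0 ->
        (mdeg al (mo x) + mdeg al (mo y) + 2 = p + q + (al + be) + al)%N] /\
  [/\ forall t, (Nt t)^T *m J + J *m Nt t = 0,
      Nt 0 = shift_mx k mo,
      forall x y, exists P : {poly k}, forall t, Nt t x y = P.[t] &
      forall t, t != 0 -> exists K K',
        [/\ K *m K' = 1%:M, K' *m K = 1%:M, Nt t *m K = K *m shift_mx k mn &
            forall x y, K x y != 0 -> mdeg al (mo x) = mdeg al (mn y)]].
Proof.
move=> two0 al0 be0 mo mn.
have [f [g [sf sg fm gm fg]]] := Xn_add1_factor k be al0.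
have eq_dim : ((p + al) * (q + al + be) + (p + be) * q)%N =
              ((p + (al + be)) * (q + al) + p * (q + be))%N by nia.
have [J [Nt [[h1 h2 h3] h4]]] := @graded_degeneration k two0 p q al be f g
  al0 be0 sf sg fm gm fg _ _ mo mn (@mon_of_inj _ _ _ _) (@mon_of_box _ _ _ _)
  (@mon_of_surj _ _ _ _) (@mon_of_inj _ _ _ _) (@mon_of_box _ _ _ _)
  (@mon_of_surj _ _ _ _) eq_dim.
exists J, Nt; split=> //; split=> //; rewrite h1; congr (_ *: _).
(* The two exponents differ by 2 al. *)
by apply: sign_parity; lia.
Qed.

(** * Closures of sets of matrices and semicontinuity of the rank *)

Section Topology.
Variable K : numFieldType.

Lemma cvg_bigsum (T : topologicalType) (I : Type) (r : seq I) (f : I -> T -> K) x :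
  (forall i, {for x, continuous (f i)}) ->
  {for x, continuous (fun y => \sum_(i <- r) f i y)}.
Proof.
move=> fc; elim: r => [|i r IH].
  rewrite (_ : (fun _ => _) = cst 0); first exact: cst_continuous.
  by apply: funext => y; rewrite big_nil.
rewrite (_ : (fun _ => _) = (f i \+ (fun y => \sum_(j <- r) f j y))).
  exact: continuousD.
by apply: funext => y; rewrite big_cons.
Qed.

Lemma cvg_bigprod (T : topologicalType) (I : Type) (r : seq I) (f : I -> T -> K) x :
  (forall i, {for x, continuous (f i)}) ->
  {for x, continuous (fun y => \prod_(i <- r) f i y)}.
Proof.
move=> fc; elim: r => [|i r IH].
  rewrite (_ : (fun _ => _) = cst 1); first exact: cst_continuous.
  by apply: funext => y; rewrite big_nil.
rewrite (_ : (fun _ => _) = (f i \* (fun y => \prod_(j <- r) f j y))).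
  exact: continuousM.
by apply: funext => y; rewrite big_cons.
Qed.

Lemma horner_continuous (P : {poly K}) : continuous (horner P).
Proof.
move=> x; elim/poly_ind: P => [|P c IH].
  rewrite (_ : horner 0 = cst 0); first exact: cst_continuous.
  by apply: funext => y; rewrite horner0.
rewrite (_ : horner _ = ((horner P \* id) \+ cst c)).
  apply: continuousD; last exact: cst_continuous.
  by apply: continuousM => //; exact: id_continuous.
by apply: funext => y; rewrite !hornerE.
Qed.

Lemma derive1_horner0 (P : {poly K}) : derive1 (horner P) 0 = P`_1.
Proof.
elim/poly_ind: P => [|P c _].
  rewrite coef0 (_ : horner 0 = cst 0) ?derive1_cst//.
  by apply: funext => y; rewrite horner0.
rewrite coefD coefMX coefC addr0 /= -horner_coef0.
apply: cvg_lim; first exact: norm_hausdorff.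
(* For h nonzero the difference quotient of X P + c at 0 is exactly P(h). *)
apply: cvg_trans (_ : horner P @ 0^' `=>` _).
  apply: near_eq_cvg; near=> h.
  have h0 : h != 0 by near: h; exact: nbhs_dnbhs_neq.
  by rewrite addr0 !hornerD !hornerMX !hornerC mulr0 add0r addrK [RHS]mulrC mulfK.
apply: cvg_within_filter; exact: horner_continuous.
Unshelve. all: by end_near. Qed.

Lemma mx_continuous (T : topologicalType) m n (f : T -> 'M[K]_(m, n)) x :
  (forall i j, {for x, continuous (fun y => f y i j)}) -> {for x, continuous f}.
Proof.
move=> fc A [P hP PA]; apply: (@filterS _ _ _ [set y | forall i j, P i j (f y i j)]).
  by move=> y; exact: PA.
apply: filter_forall => i; apply: filter_forall => j.
exact: (fc i j _ (hP i j)).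
Qed.

Lemma closure_continuous (T U : topologicalType) (f : T -> U) (A : set T) x :
  {for x, continuous f} -> closure A x -> closure (f @` A) (f x).
Proof.
move=> fc Ax B /fc fB; have [y [Ay By]] := Ax _ fB.
by exists (f y); split=> //; exists y.
Qed.

Lemma closure_mulmx m n p q (L : 'M[K]_(m, n)) (M : 'M[K]_(p, q)) A X :
  closure A X -> closure [set L *m Y *m M | Y in A] (L *m X *m M).
Proof.
apply: (@closure_continuous _ _ (fun Y => L *m Y *m M)); apply: mx_continuous => i j.
rewrite (_ : (fun y => _) = (fun y : 'M[K]_(n, p) =>
   \sum_k (\sum_l L i l * y l k) * M k j)); last first.
  by apply: funext => y; rewrite mxE; apply: eq_bigr => k _; rewrite mxE.
apply: cvg_bigsum => k; apply: continuousM; last exact: cst_continuous.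
apply: cvg_bigsum => l; apply: continuousM; first exact: cst_continuous.
exact: coord_continuous.
Qed.

Lemma det_continuous n : continuous (fun Y : 'M[K]_n => \det Y).
Proof.
move=> X; rewrite (_ : (fun Y => _) = (fun Y : 'M[K]_n =>
   \sum_(s : 'S_n) (-1) ^+ s * \prod_i Y i (s i))) //.
apply: cvg_bigsum => s; apply: continuousM; first exact: cst_continuous.
by apply: cvg_bigprod => i; exact: coord_continuous.
Qed.

Lemma expmx_continuous n r : continuous (fun Y : 'M[K]_n => Y ^+ r).
Proof.
move=> X; elim: r => [|r IH].
  rewrite (_ : (fun _ => _) = cst 1); first exact: cst_continuous.
  by apply: funext => Y; rewrite expr0.
apply: mx_continuous => i j.
rewrite (_ : (fun Y => _) = (fun Y : 'M[K]_n => \sum_k Y i k * (Y ^+ r) k j)).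
  apply: cvg_bigsum => k; apply: continuousM; first exact: coord_continuous.
  apply: (@continuous_comp _ _ _ (fun Y : 'M[K]_n => Y ^+ r) (fun Z : 'M[K]_n => Z k j)) => //.
  exact: coord_continuous.
by apply: funext => Y; rewrite exprS mxE.
Qed.

(** [L] and [M] are chosen so that L X^r M is the identity of size rank(X^r). Its determinant stays
    nonzero near X, where A has points. *)
Lemma rank_closure n r d (A : set 'M[K]_n) X :
  (forall Y, A Y -> (\rank (Y ^+ r) <= d)%N) -> closure A X ->
  (\rank (X ^+ r) <= d)%N.
Proof.
move=> Ad AX; set e := \rank (X ^+ r).
pose L := pinvmx (col_base (X ^+ r)); pose M := pinvmx (row_base (X ^+ r)).
have LM : L *m (X ^+ r) *m M = 1%:M.
  transitivity (L *m (col_base (X ^+ r) *m row_base (X ^+ r)) *m M).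
    by rewrite mulmx_base.
  rewrite mulmxA -mulmxA mulmxVp ?row_base_free// mulmx1 mulVpmx//.
  exact: col_base_full.
pose f (Y : 'M[K]_n) := \det (L *m (Y ^+ r) *m M).
have fc : {for X, continuous f}.
  apply: (@continuous_comp _ _ _ (fun Y : 'M[K]_n => L *m (Y ^+ r) *m M)
    (fun Z => \det Z)); last exact: det_continuous.
  apply: mx_continuous => i j.
  rewrite (_ : (fun Y => _) = (fun y : 'M[K]_n =>
     \sum_k (\sum_l L i l * (y ^+ r) l k) * M k j)); last first.
    by apply: funext => y; rewrite mxE; apply: eq_bigr => k _; rewrite mxE.
  apply: cvg_bigsum => k; apply: continuousM; last exact: cst_continuous.
  apply: cvg_bigsum => l; apply: continuousM; first exact: cst_continuous.
  apply: (@continuous_comp _ _ _ (fun Y : 'M[K]_n => Y ^+ r) (fun Z : 'M[K]_n => Z l k)).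
    exact: expmx_continuous.
  exact: coord_continuous.
have : closure [set f Y | Y in A] (f X) by exact: closure_continuous.
rewrite /f LM det1 => /(_ [set z : K | z != 0]) [].
  apply/nbhs_ballP; exists 1 => //= z; rewrite -ball_normE /= => z1.
  by apply: contraTneq z1 => ->; rewrite subr0 normr1 ltxx.
move=> z [[Y AY <-]] /= dY; apply: leq_trans (Ad _ AY).
have uY : L *m Y ^+ r *m M \in unitmx by rewrite unitmxE unitfE.
apply: leq_trans (_ : (\rank (L *m Y ^+ r *m M) <= _)%N).
  by rewrite (mxrank_unit uY).
exact: leq_trans (mxrankM_maxl _ _) (mxrankM_maxr _ _).
Qed.

Lemma closure_horner n (A : set 'M[K]_n) (M : K -> 'M[K]_n) :
  (forall i j, exists P : {poly K}, forall t, M t i j = P.[t]) ->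
  (forall t, t != 0 -> A (M t)) -> closure A (M 0).
Proof.
move=> MP MA B B0.
have Mc : {for 0, continuous M}.
  apply: mx_continuous => i j; have [P hP] := MP i j.
  by rewrite (funext hP); exact: horner_continuous.
have /nbhs_ballP [e /= e0 eB] := Mc _ B0.
exists (M (e / 2)); split.
  by apply: MA; rewrite mulf_neq0 ?gt_eqF// invr_gt0.
apply: eB; rewrite -ball_normE /= sub0r normrN gtr0_norm ?divr_gt0//.
by rewrite ltr_pdivrMr// ltr_pMr// ltr1n.
Qed.

End Topology.

(** * Block-diagonal matrices and conjugation *)

Section BlockDiagonal.
Variable k : fieldType.

Lemma mul_block_diag m n p m' n' p' (A : 'M[k]_(m, n)) (B : 'M[k]_(m', n'))
    (A' : 'M[k]_(n, p)) (B' : 'M[k]_(n', p')) :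
  block_mx A 0 0 B *m block_mx A' 0 0 B' = block_mx (A *m A') 0 0 (B *m B').
Proof. by rewrite mulmx_block !mulmx0 !mul0mx !addr0 !add0r. Qed.

Lemma scale_block_diag m n m' n' c (A : 'M[k]_(m, n)) (B : 'M[k]_(m', n')) :
  c *: block_mx A 0 0 B = block_mx (c *: A) 0 0 (c *: B).
Proof. by rewrite scale_block_mx !scaler0. Qed.

Lemma tr_block_diag m n m' n' (A : 'M[k]_(m, n)) (B : 'M[k]_(m', n')) :
  (block_mx A 0 0 B)^T = block_mx A^T 0 0 B^T.
Proof. by rewrite tr_block_mx !trmx0. Qed.

Lemma add_block_diag m n m' n' (A A' : 'M[k]_(m, n)) (B B' : 'M[k]_(m', n')) :
  block_mx A 0 0 B + block_mx A' 0 0 B' = block_mx (A + A') 0 0 (B + B').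
Proof. by rewrite add_block_mx !addr0. Qed.

Lemma block_diag_unit m n (A : 'M[k]_m) (B : 'M[k]_n) :
  A \in unitmx -> B \in unitmx -> block_mx A 0 0 B \in unitmx.
Proof. by move=> uA uB; rewrite unitmxE det_ublock unitrM -!unitmxE uA. Qed.

Lemma exp_block_diag m n (A : 'M[k]_m) (B : 'M[k]_n) e :
  block_mx A 0 0 B ^+ e = block_mx (A ^+ e) 0 0 (B ^+ e).
Proof.
elim: e => [|e IH]; first by rewrite !expr0 -scalar_mx_block.
by rewrite !exprS IH -[LHS]/(_ *m _) mul_block_diag.
Qed.

End BlockDiagonal.

Lemma mulmx_conj (k : fieldType) m n (A : 'M[k]_(m, n)) (A' : 'M[k]_(n, m)) X Y :
  A' *m A = 1%:M -> A *m X *m A' *m (A *m Y *m A') = A *m (X *m Y) *m A'.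
Proof. by move=> e; rewrite !mulmxA -[_ *m A' *m A]mulmxA e mulmx1. Qed.

Lemma mulmx_conj_scale (k : fieldType) m n (A : 'M[k]_(m, n)) (A' : 'M[k]_(n, m)) c X Y :
  A' *m A = 1%:M -> X *m Y = c *: (Y *m X) ->
  A *m X *m A' *m (A *m Y *m A') = c *: (A *m Y *m A' *m (A *m X *m A')).
Proof. by move=> e h; rewrite !mulmx_conj// h -scalemxAr -scalemxAl. Qed.

Lemma exp_conj (k : fieldType) n (P X : 'M[k]_n) e : P \in unitmx ->
  (P *m X *m invmx P) ^+ e = P *m (X ^+ e) *m invmx P.
Proof.
move=> uP; elim: e => [|e IH]; first by rewrite !expr0 mulmx1 mulmxV.
by rewrite !exprS IH -![_ * _]/(_ *m _) mulmx_conj// mulVmx.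
Qed.

Lemma rank_exp_conj (k : fieldType) n (P X : 'M[k]_n) e : P \in unitmx ->
  \rank ((P *m X *m invmx P) ^+ e) = \rank (X ^+ e).
Proof.
move=> uP; rewrite exp_conj// mxrankMfree ?row_free_unit ?unitmx_inv//.
by rewrite eqmxMfull// row_full_unit.
Qed.

(** * Isomorphisms between families of matrices of possibly different sizes *)

Section RepIso.
Variables (k : fieldType) (T : Type).

Lemma rep_iso_eq m (r s : T -> 'M[k]_m) : r =1 s -> rep_iso r s.
Proof.
by move=> e; exists 1%:M, 1%:M; rewrite mulmx1; split=> // g; rewrite mulmx1 mul1mx e.
Qed.

Lemma rep_iso_sym m n (r : T -> 'M[k]_m) (s : T -> 'M[k]_n) :
  rep_iso r s -> rep_iso s r.
Proof.
move=> [P [P' [PP' P'P h]]]; exists P', P; split=> // g.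
by rewrite -[s g]mul1mx -P'P -!mulmxA [P *m (_ *m _)]mulmxA -h -!mulmxA PP' mulmx1.
Qed.

Lemma rep_iso_trans m n p (r : T -> 'M[k]_m) (s : T -> 'M[k]_n) (u : T -> 'M[k]_p) :
  rep_iso r s -> rep_iso s u -> rep_iso r u.
Proof.
move=> [P [P' [PP' P'P h]]] [Q [Q' [QQ' Q'Q h']]]; exists (P *m Q), (Q' *m P').
split=> [||g].
- by rewrite mulmxA -[P *m Q *m Q']mulmxA QQ' mulmx1.
- by rewrite mulmxA -[Q' *m P' *m P]mulmxA P'P mulmx1.
- by rewrite mulmxA h -mulmxA h' mulmxA.
Qed.

Lemma rep_iso_dim m n (r : T -> 'M[k]_m) (s : T -> 'M[k]_n) :
  rep_iso r s -> m = n.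
Proof.
move=> [P [P' [PP' P'P _]]]; apply/eqP; rewrite eqn_leq.
by rewrite (mulmx1_min PP') (mulmx1_min P'P).
Qed.

Lemma rep_iso_comp (U : Type) (f : U -> T) m n (r : T -> 'M[k]_m) (s : T -> 'M[k]_n) :
  rep_iso r s -> rep_iso (r \o f) (s \o f).
Proof. by move=> [P [P' [h1 h2 h3]]]; exists P, P'; split=> // g; exact: h3. Qed.

Lemma rep_iso_unit n (r s : T -> 'M[k]_n) : rep_iso r s ->
  exists2 P, P \in unitmx & forall g, s g = P *m r g *m invmx P.
Proof.
move=> /rep_iso_sym [P [P' [PP' P'P h]]]; have [uP _] := mulmx1_unit PP'.
by exists P => // g; rewrite -h mulmxK.
Qed.

Lemma unit_rep_iso n (r s : T -> 'M[k]_n) P : P \in unitmx ->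
  (forall g, P *m r g = s g *m P) -> rep_iso r s.
Proof.
move=> uP h; apply: rep_iso_sym; exists P, (invmx P).
by split; rewrite ?mulmxV ?mulVmx.
Qed.

Lemma rep_iso_sum m n p q (r : T -> 'M[k]_m) (s : T -> 'M[k]_n)
    (u : T -> 'M[k]_p) (v : T -> 'M[k]_q) : rep_iso r s -> rep_iso u v ->
  rep_iso (fun g => block_mx (r g) 0 0 (u g)) (fun g => block_mx (s g) 0 0 (v g)).
Proof.
move=> [P [P' [PP' P'P h]]] [Q [Q' [QQ' Q'Q h']]].
exists (block_mx P 0 0 Q), (block_mx P' 0 0 Q').
split=> [||g]; rewrite !mulmx_block !(mulmx0, mul0mx, addr0, add0r).
- by rewrite PP' QQ' -scalar_mx_block.
- by rewrite P'P Q'Q -scalar_mx_block.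
- by rewrite h h'.
Qed.

Lemma rep_iso_swap m n p (r : T -> 'M[k]_m) (s : T -> 'M[k]_n) (u : T -> 'M[k]_p) :
  rep_iso (fun g => block_mx (r g) 0 0 (block_mx (s g) 0 0 (u g)))
          (fun g => block_mx (s g) 0 0 (block_mx (r g) 0 0 (u g))).
Proof.
exists (block_mx 0 (row_mx 1%:M 0) (col_mx 1%:M 0) (block_mx 0 0 0 1%:M)).
exists (block_mx 0 (row_mx 1%:M 0) (col_mx 1%:M 0) (block_mx 0 0 0 1%:M)).
pose e := (mul_mx_row, mul_row_col, mul_col_row, mul_col_mx, mul_row_block,
  mul_block_col, mulmx0, mul0mx, addr0, add0r, mulmx1, mul1mx, mulmx_block).
pose e0 := (row_mx0, col_mx0, addr0, add0r).
split=> [||g]; rewrite mulmx_block !e !e0.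
- have -> : row_mx (col_mx 1%:M 0) 0 = block_mx 1%:M 0 0 0 :> 'M[k]_(n + p).
    by rewrite block_mxEh col_mx0.
  have -> : col_mx 0 (row_mx 0 1%:M) = block_mx 0 0 0 1%:M :> 'M[k]_(n + p).
    by rewrite block_mxEv row_mx0.
  by rewrite add_block_mx !e0 -!scalar_mx_block.
- have -> : row_mx (col_mx 1%:M 0) 0 = block_mx 1%:M 0 0 0 :> 'M[k]_(m + p).
    by rewrite block_mxEh col_mx0.
  have -> : col_mx 0 (row_mx 0 1%:M) = block_mx 0 0 0 1%:M :> 'M[k]_(m + p).
    by rewrite block_mxEv row_mx0.
  by rewrite add_block_mx !e0 -!scalar_mx_block.
by rewrite add_row_mx !e0 -block_mxEv.
Qed.

Lemma rep_iso_castmx m n (e1 e2 : m = n) (r : T -> 'M[k]_m) :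
  rep_iso (fun g => castmx (e1, e2) (r g)) r.
Proof. by case: n / e1 e2 => e2; apply: rep_iso_eq => g; rewrite castmx_id. Qed.

Lemma rep_iso_assoc m n p (r : T -> 'M[k]_m) (s : T -> 'M[k]_n) (u : T -> 'M[k]_p) :
  rep_iso (fun g => block_mx (r g) 0 0 (block_mx (s g) 0 0 (u g)))
          (fun g => block_mx (block_mx (r g) 0 0 (s g)) 0 0 (u g)).
Proof.
apply: rep_iso_trans (rep_iso_castmx (esym (addnA m n p)) (esym (addnA m n p)) _).
apply: rep_iso_eq => g.
have := @block_mxA _ m n p m n p (r g) 0 0 0 (s g) 0 0 0 (u g).
by rewrite /= !row_mx0 !col_mx0.
Qed.

Lemma rep_iso_dim0 m n (r : T -> 'M[k]_m) (s : T -> 'M[k]_n) : m = 0%N ->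
  rep_iso (fun g => block_mx (r g) 0 0 (s g)) s.
Proof.
move=> m0; subst m; exists (col_mx 0 1%:M), (row_mx 0 1%:M); split=> [||g].
- have e : 1%:M = 0 :> 'M[k]_0 by rewrite [LHS]flatmx0.
  by rewrite mul_col_row !mul0mx !mul1mx [RHS]scalar_mx_block e.
- by rewrite mul_row_col mul0mx add0r mulmx1.
by rewrite mul_block_col !mul0mx mulmx1 mulmx0 !add0r mul_col_mx mul0mx mul1mx.
Qed.

End RepIso.

(** * From linear to orthogonal conjugacy, and cancellation of forms *)

Section OrthogonalTrick.
Variable k : closedFieldType.
Hypothesis two_neq0 : 2%:R != 0 :> k.

Lemma mx_sqrt_comm n (B : 'M[k]_n) : B \in unitmx ->
  exists S : 'M[k]_n, [/\ S *m S = B, S \in unitmx, B^T = B -> S^T = S &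
    forall X, X *m B = B *m X -> X *m S = S *m X].
Proof.
move=> uB; have [S SS Salg] := mx_sqrt two_neq0 uB.
exists S; split=> //.
- by move: uB; rewrite -SS unitmx_mul => /andP[].
- move=> BT; have [] : S^T = S /\ B *m S = S *m B; last by [].
  apply: (Salg (fun X => X^T = X /\ B *m X = X *m B)).
  + by rewrite trmx1 mulmx1 mul1mx.
  + move=> a X Y [hX cX] [hY cY]; split.
      by rewrite [(_ + _)^T]linearD/= [(_ *: _)^T]linearZ/= hX hY.
    by rewrite mulmxDr mulmxDl -scalemxAr -scalemxAl cX cY.
  + by move=> X [hX cX]; rewrite trmx_mul hX BT {2}cX mulmxA.
- move=> X XB; apply: (Salg (fun Y => X *m Y = Y *m X)).
  + by rewrite mulmx1 mul1mx.
  + by move=> a Y Z hY hZ; rewrite mulmxDr mulmxDl -scalemxAr -scalemxAl hY hZ.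
  + by move=> Y hY; rewrite mulmxA XB -mulmxA hY mulmxA.
Qed.

(* [Some w] is to act by similitudes of ratio 1 and [None] infinitesimally. *)
Definition preserves (T : Type) n (B : 'M[k]_n) (x : option T -> 'M[k]_n) : Prop :=
  (forall w, (x (Some w))^T *m B *m x (Some w) = B) /\
  (x None)^T *m B + B *m x None = 0.

(** For the standard form the transpose is the inverse, or the opposite at [None]; a second
    preserved form is therefore an intertwiner. *)
Lemma preserves_adjoint_comm T n (B B' : 'M[k]_n) (x : option T -> 'M[k]_n) :
  preserves 1%:M x -> preserves B x -> forall g, x g *m B = B *m x g.
Proof.
move=> [x1 n1] [xB nB] [w|].
  have := x1 w; rewrite mulmx1 => /mulmx1C xx.
  by rewrite -[in LHS](xB w) !mulmxA xx mul1mx.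
move: n1 nB; rewrite mulmx1 mul1mx => /eqP; rewrite addr_eq0 => /eqP ->.
by rewrite mulNmx addrC => /eqP; rewrite subr_eq0 => /eqP.
Qed.

Lemma preserves_conj T m n (B : 'M[k]_n) (x : option T -> 'M[k]_m)
    (y : option T -> 'M[k]_n) P : (forall g, P *m x g = y g *m P) ->
  preserves B y -> preserves (P^T *m B *m P) x.
Proof.
move=> h [y1 n1]; split=> [w|].
  transitivity (P^T *m ((y (Some w))^T *m B *m y (Some w)) *m P); last by rewrite y1.
  by rewrite -!mulmxA -h !mulmxA -!trmx_mul h.
transitivity (P^T *m ((y None)^T *m B + B *m y None) *m P).
  by rewrite mulmxDr mulmxDl -!mulmxA -h !mulmxA -!trmx_mul h.
by rewrite n1 mulmx0 mul0mx.
Qed.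

(** Polar decomposition: the intertwiner P is divided by a square root of P^T P, which commutes with
    x. *)
Lemma orthogonal_conj T n (x y : option T -> 'M[k]_n) :
  preserves 1%:M x -> preserves 1%:M y -> rep_iso x y ->
  exists2 U : 'M[k]_n, U^T *m U = 1%:M & forall g, U *m x g = y g *m U.
Proof.
move=> x1 y1 /rep_iso_sym [P [P' [PP' _ h]]]; have [uP _] := mulmx1_unit PP'.
have hP g : P *m x g = y g *m P by rewrite h.
have hB := preserves_conj hP y1; rewrite mulmx1 in hB.
have uB : P^T *m P \in unitmx by rewrite unitmx_mul unitmx_tr uP.
have [S [SS uS ST Sc]] := mx_sqrt_comm uB.
have {}ST : S^T = S by apply: ST; rewrite trmx_mul trmxK.
exists (P *m invmx S) => [|g].
  rewrite trmx_mul trmx_inv ST mulmxA -[invmx S *m _ *m _]mulmxA -SS.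
  by rewrite mulmxA mulVmx// mul1mx mulmxV.
have xS : x g *m S = S *m x g by apply/Sc/(preserves_adjoint_comm 1%:M x1 hB).
rewrite -mulmxA; have -> : invmx S *m x g = x g *m invmx S.
  by rewrite -[x g in RHS](mulKmx uS) -xS mulmxA mulmxK.
by rewrite mulmxA hP mulmxA.
Qed.

(** A second preserved form becomes the standard one after a change of basis that leaves x fixed. *)
Lemma preserved_form_conj T n (B : 'M[k]_n) (x : option T -> 'M[k]_n) :
  preserves 1%:M x -> preserves B x -> B^T = B -> B \in unitmx ->
  exists2 S : 'M[k]_n, S \in unitmx /\ S^T *m S = B &
    forall g, S *m x g = x g *m S.
Proof.
move=> x1 xB BT uB; have [S [SS uS ST Sc]] := mx_sqrt_comm uB.
exists S; first by rewrite ST.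
by move=> g; rewrite Sc//; exact: (preserves_adjoint_comm 1%:M x1 xB).
Qed.

Lemma orthonormalize T n (r : T -> 'M[k]_n) : rep_orthogonal r ->
  exists2 s : T -> 'M[k]_n, rep_iso r s & forall g, (s g)^T *m s g = 1%:M.
Proof.
move=> [B [BT uB rB]]; have [S [SS uS ST _]] := mx_sqrt_comm uB.
have {}ST := ST BT; exists (fun g => S *m r g *m invmx S).
  by apply: (unit_rep_iso uS) => g; rewrite mulmxKV.
move=> g; rewrite !trmx_mul trmx_inv ST.
have -> : invmx S *m ((r g)^T *m S) *m (S *m r g *m invmx S) =
  invmx S *m ((r g)^T *m (S *m S) *m r g) *m invmx S by rewrite !mulmxA.
by rewrite SS rB -SS mulmxA mulVmx// mul1mx mulmxV.
Qed.

Lemma det_pencil n (M N : 'M[k]_n) :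
  exists P : {poly k}, forall c, P.[c] = \det (M + c *: N).
Proof.
exists (\det (map_mx polyC M + 'X *: map_mx polyC N)) => c.
rewrite -[LHS]/(horner_eval c _) -det_map_mx; congr (\det _).
by apply/matrixP => i j; rewrite !mxE /= /horner_eval !hornerE.
Qed.

Lemma rep_orthogonal_iso (T : Type) m n (r : T -> 'M[k]_m) (s : T -> 'M[k]_n) :
  rep_iso r s -> rep_orthogonal s -> rep_orthogonal r.
Proof.
move=> /[dup] /rep_iso_dim e; case: n / e s => s.
move=> /rep_iso_sym [P [P' [PP' P'P h]]] [B [BT uB hB]].
have [uP _] := mulmx1_unit PP'.
exists (P^T *m B *m P); split=> [||g].
- by rewrite !trmx_mul trmxK BT mulmxA.
- by rewrite !unitmx_mul unitmx_tr uP uB.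
transitivity (P^T *m ((s g)^T *m B *m s g) *m P); last by rewrite hB.
by rewrite -!mulmxA h !mulmxA -!trmx_mul h.
Qed.

Definition pair_orthogonal (T : Type) n (x : option T -> 'M[k]_n) : Prop :=
  exists B : 'M[k]_n, [/\ B^T = B, B \in unitmx & preserves B x].

Lemma pair_orthogonal_iso (T : Type) m n (x : option T -> 'M[k]_m) (y : option T -> 'M[k]_n) :
  rep_iso x y -> pair_orthogonal y -> pair_orthogonal x.
Proof.
move=> /[dup] /rep_iso_dim e; case: n / e y => y.
move=> /rep_iso_sym [P [P' [PP' P'P h]]] [B [BT uB hB]].
have [uP _] := mulmx1_unit PP'.
exists (P^T *m B *m P); split.
- by rewrite !trmx_mul trmxK BT mulmxA.
- by rewrite !unitmx_mul unitmx_tr uP uB.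
- by apply: preserves_conj hB.
Qed.

(* Adding a multiple of the form on the first summand makes its restriction
   nondegenerate; the Schur complement then is a form on the second one. *)
Lemma rep_orthogonal_cancel T m n (r : T -> 'M[k]_m) (s : T -> 'M[k]_n) :
  rep_orthogonal (fun g => block_mx (r g) 0 0 (s g)) -> rep_orthogonal r ->
  rep_orthogonal s.
Proof.
move=> [B [BT uB Binv]] [A [AT uA Ainv]].
have dB : \det B != 0 by rewrite -unitfE -unitmxE.
have dA : \det A != 0 by rewrite -unitfE -unitmxE.
have [P1 P1E] := det_pencil B (block_mx A 0 0 0).
have [P2 P2E] := det_pencil (ulsubmx B) A.
have P1n0 : P1 != 0.
  apply: contraNneq dB => P0; have := P1E 0.
  by rewrite P0 horner0 scale0r addr0 => <-.
(* P2(c) is det A times the characteristic polynomial of - A^-1 a at c, where a is the upper left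
   block of B. *)
have P2n0 : P2 != 0.
  have : char_poly (- (invmx A *m ulsubmx B)) != 0.
    by rewrite monic_neq0// char_poly_monic.
  move=> /closed_nonrootP [c]; apply: contraNneq => P0.
  have := P2E c; rewrite P0 horner0.
  have -> : ulsubmx B + c *: A = A *m (c%:M + invmx A *m ulsubmx B).
    by rewrite mulmxDr mulKVmx// mul_mx_scalar addrC.
  rewrite det_mulmx => /esym /eqP; rewrite mulf_eq0.
  rewrite (negPf dA) /= => /eqP d0.
  rewrite /root -[_.[c]]/(horner_eval c _) -det_map_mx -d0; apply/eqP.
  congr (\det _); apply/matrixP => i j.
  by rewrite !mxE /= /horner_eval hornerD hornerN hornerC hornerMn hornerX opprK.
have [c] : exists c, ~~ root (P1 * P2) c by apply/closed_nonrootP; rewrite mulf_neq0.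
rewrite rootM negb_or /root P1E P2E => /andP[c1 c2].
move: BT {uB dB} Binv c1 c2; rewrite -[B]submxK.
set a := ulsubmx B; set b := ursubmx B; set b' := dlsubmx B; set d := drsubmx B.
rewrite block_mxKul tr_block_mx => /eq_block_mx [aT _ bT dT] Binv.
rewrite scale_block_mx add_block_mx !scaler0 !addr0.
have {}Binv g : [/\ (r g)^T *m a *m r g = a, (r g)^T *m b *m s g = b &
                    (s g)^T *m d *m s g = d].
  have := Binv g; rewrite tr_block_mx !mulmx_block !trmx0.
  by rewrite !(mulmx0, mul0mx, addr0, add0r) => /eq_block_mx [].
set a' := a + c *: A => dB da.
have ua : a' \in unitmx by rewrite unitmxE unitfE.
have a'T : a'^T = a'.
  by rewrite /a' [(_ + _)^T]linearD/= [(_ *: _)^T]linearZ/= aT AT.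
have ainv g : (r g)^T *m a' *m r g = a'.
  have [h _ _] := Binv g.
  by rewrite /a' mulmxDr mulmxDl h -scalemxAr -scalemxAl Ainv.
(* The inverse of an invariant form is invariant for the contragredient action, as the Schur
   complement requires. *)
have xinv g : r g *m invmx a' *m (r g)^T = invmx a'.
  have : (r g)^T *m (a' *m r g *m invmx a') = 1%:M.
    by rewrite !mulmxA ainv mulmxV.
  move/mulmx1C; rewrite -!mulmxA => /(congr1 (mulmx (invmx a'))).
  by rewrite mulKmx// mulmx1 mulmxA.
have b'E : b' = b^T by [].
exists (d - b^T *m invmx a' *m b); split.
- rewrite [(_ - _)^T]raddfB/= dT !trmx_mul trmxK trmx_inv a'T mulmxA.
  by [].
- have : block_mx a' b b' d = block_mx 1%:M 0 (b' *m invmx a') 1%:M *m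
      block_mx a' b 0 (d - b^T *m invmx a' *m b).
    rewrite mulmx_block !mul1mx !mul0mx !addr0 mulmxKV//.
    by rewrite b'E addrC subrK.
  move=> e; move: dB; rewrite e det_mulmx det_lblock !det1 !mul1r det_ublock mulf_eq0.
  by rewrite negb_or => /andP[_]; rewrite unitmxE unitfE.
move=> g; have [_ hb hd] := Binv g; rewrite mulmxBr mulmxBl hd; congr (_ - _).
transitivity (((r g)^T *m b *m s g)^T *m invmx a' *m ((r g)^T *m b *m s g)).
  by rewrite !trmx_mul trmxK -[in LHS](xinv g) !mulmxA.
by rewrite hb.
Qed.

End OrthogonalTrick.

(** * Explicit matrices of the representations S_a *)

Section SymmetricPowers.
Variable k : numClosedFieldType.

Definition Srep_weights (a : nat) (u v : k) : 'M[k]_a :=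
  diag_mx (\row_(i < a) (u ^+ i * v ^+ (a.-1 - i))).

Lemma Srep_diag (a : nat) (x : SL2 k) : x 0 1 = 0 -> x 1 0 = 0 ->
  Srep a x = Srep_weights a (x 0 0) (x 1 1).
Proof.
move=> x01 x10; apply/matrixP => j i; rewrite !mxE x01 x10.
rewrite addr0 scale0r add0r -polyC_exp exprZn -scalerAl coefZ coefMC coefXn.
rewrite val_eqE; case: (j =P i) => [->|_].
  by rewrite mul1r mulr1n.
by rewrite mul0r mulr0.
Qed.

Lemma Srep_weights1 a : Srep_weights a 1 1 = 1%:M.
Proof.
rewrite -diag_const_mx; congr diag_mx; apply/rowP => i.
by rewrite !mxE !expr1n mul1r.
Qed.

Lemma Srep_weyl (a : nat) (x : SL2 k) :
  x 0 0 = 0 -> x 0 1 = 1 -> x 1 0 = -1 -> x 1 1 = 0 ->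
  forall i j : 'I_a, Srep a x i j = (-1) ^+ j *+ (i + j == a.-1)%N.
Proof.
move=> x00 x01 x10 x11 i j; rewrite !mxE x00 x01 x10 x11.
rewrite scale0r add0r scale1r addr0 -polyC_exp coefCM coefXn mulr_natr.
by congr (_ *+ nat_of_bool _); have := ltn_ord i; have := ltn_ord j; lia.
Qed.

(** Polynomial entries in t make the derivative at 0 a coefficient extraction. *)
Definition unip_mx (a : nat) : 'M[{poly k}]_a :=
  \matrix_(j < a, i < a) if (i <= j)%N then 'X^(j - i) *+ 'C(a.-1 - i, j - i) else 0.

Lemma Srep_unip (a : nat) t : Srep a (sl2_unip t) = map_mx (fun P => P.[t]) (unip_mx a).
Proof.
apply/matrixP => j i; rewrite !mxE /= scale1r addr0 mulrC coefMXn ltnNge.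
case: leqP => h /=; last by rewrite horner0.
rewrite hornerMn hornerXn exprD1n coef_sum.
under eq_bigr => l _ do rewrite coefMn exprZn coefZ coefXn.
have [lt|ge] := ltnP (j - i) (a.-1 - i).+1.
  rewrite (bigD1 (Ordinal lt))//= eqxx mulr1 big1 ?addr0// => l ne.
  rewrite (_ : (_ == _) = false) ?mulr0 ?mul0rn//.
  by apply/negP => /eqP e; case/negP: ne; apply/eqP/val_inj.
rewrite bin_small// mulr0n big1// => l _.
by rewrite (_ : (_ == _) = false) ?mulr0 ?mul0rn//; have := ltn_ord l; lia.
Qed.

Lemma Srep_unip0 (a : nat) : Srep a (sl2_unip 0 : SL2 k) = 1%:M.
Proof.
rewrite Srep_diag ?mxE// -[RHS](Srep_weights1 a).
by congr Srep_weights; rewrite mxE.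
Qed.

Definition shift_nat (a : nat) : 'M[k]_a := \matrix_(j, i) (j == i.+1 :> nat)%:R.

(** A rescaling of the monomial basis: it turns the derivative of S_a, whose subdiagonal entries are
    a - 1 - i, into the plain shift. *)
Definition ffact_mx (a : nat) : 'M[k]_a := diag_mx (\row_(i < a) (a.-1 ^_ i)%:R).

Lemma ffact_mx_unit a : ffact_mx a \in unitmx.
Proof.
rewrite unitmxE det_diag unitfE; apply/prodf_neq0 => i _.
by rewrite mxE pnatr_eq0 -lt0n ffact_gt0; have := ltn_ord i; lia.
Qed.

Lemma ffact_weights a (u v : k) :
  invmx (ffact_mx a) *m Srep_weights a u v = Srep_weights a u v *m invmx (ffact_mx a).
Proof.
have u1 := ffact_mx_unit a.
rewrite -[Srep_weights a u v in LHS](mulmxK u1) diag_mxC.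
by rewrite -[diag_mx _ *m diag_mx _ *m _]mulmxA mulKmx.
Qed.

Lemma unip_mx_coef1 a :
  map_mx (coefp 1) (unip_mx a) *m ffact_mx a = ffact_mx a *m shift_nat a.
Proof.
apply/matrixP => j i; rewrite mul_mx_diag mul_diag_mx !mxE /=.
case: (j =P i.+1 :> nat) => [ji|ne].
  rewrite ji leqW// subSn// subnn bin1 coefMn coefXn eqxx mulr1 ffactnSr natrM.
  by rewrite mulrC.
rewrite mulr0; case: leqP => h; last by rewrite coef0 mul0r.
by rewrite coefMn coefXn (_ : 1%N == _ = false) ?mul0rn ?mul0r//; lia.
Qed.

Lemma shift_nat_exp a e (i j : 'I_a) :
  (shift_nat a ^+ e) i j = (i == j + e :> nat)%N%:R.
Proof.
elim: e i j => [|e IH] i j; first by rewrite expr0 mxE addn0.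
rewrite exprSr mxE; have [lt|ge] := ltnP j.+1 a.
  rewrite (bigD1 (Ordinal lt))//= big1 ?addr0 => [|l ne].
    by rewrite IH !mxE /= eqxx mulr1 addSnnS.
  rewrite !mxE (_ : (_ == _) = false) ?mulr0//.
  by apply/negP => /eqP e'; case/negP: ne; apply/eqP/val_inj.
rewrite big1 => [|l _].
  by rewrite (_ : (_ == _) = false)//; have := ltn_ord i; lia.
by rewrite !mxE (_ : (_ == _) = false) ?mulr0//; have := ltn_ord l; lia.
Qed.

(** With z^2 = |w| this is the eigenvalue condition that defines V_lambda. *)
Lemma shift_weights a (z : k) : z != 0 ->
  Srep_weights a z z^-1 *m shift_nat a = z ^+ 2 *: (shift_nat a *m Srep_weights a z z^-1).
Proof.
move=> z0; apply/matrixP => j i; rewrite mul_diag_mx !mxE.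
under eq_bigr => l _ do rewrite !mxE.
rewrite (bigD1 i)//= big1 ?addr0 => [|l /negPf ne]; last first.
  by rewrite ne mulr0n mulr0.
rewrite eqxx mulr1n; case: (j =P i.+1 :> nat) => [ji|_]; last by rewrite !(mulr0, mul0r).
rewrite mulr1 mul1r ji (_ : a.-1 - i = (a.-1 - i.+1).+1)%N; last first.
  by have := ltn_ord j; rewrite ji; lia.
by rewrite !exprS expr0 mulr1; field.
Qed.

End SymmetricPowers.

(** * Kronecker products with block matrices *)

Section TensorBlocks.
Variable k : fieldType.

Lemma tensmx1 m n : (1%:M : 'M[k]_m) *t (1%:M : 'M[k]_n) = 1%:M.
Proof.
apply/matrixP => i j; case: (mxtens_indexP i) => i1 i2; case: (mxtens_indexP j) => j1 j2.
rewrite tensmxE !mxE (can_eq (@mxtens_indexK _ _)) xpair_eqE.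
by case: (i1 == j1); case: (i2 == j2); rewrite ?mulr1 ?mulr0.
Qed.

Lemma tensmxDr m n p q (A : 'M[k]_(m, n)) (B C : 'M[k]_(p, q)) :
  A *t (B + C) = A *t B + A *t C.
Proof. by apply/matrixP => i j; rewrite !mxE mulrDr. Qed.

Lemma tensmxZr m n p q c (A : 'M[k]_(m, n)) (B : 'M[k]_(p, q)) :
  A *t (c *: B) = c *: (A *t B).
Proof. by apply/matrixP => i j; rewrite !mxE mulrCA. Qed.

Lemma tensmxZl m n p q c (A : 'M[k]_(m, n)) (B : 'M[k]_(p, q)) :
  (c *: A) *t B = c *: (A *t B).
Proof. by apply/matrixP => i j; rewrite !mxE mulrA. Qed.

Lemma tensmxX1 m n (A : 'M[k]_n) e : ((1%:M : 'M[k]_m) *t A) ^+ e = 1%:M *t (A ^+ e).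
Proof.
elim: e => [|e IH]; first by rewrite !expr0 tensmx1.
by rewrite !exprS IH -[LHS]/(_ *m _) tensmx_mul mul1mx.
Qed.

Lemma tensmx1X m n (A : 'M[k]_m) e : (A *t (1%:M : 'M[k]_n)) ^+ e = (A ^+ e) *t 1%:M.
Proof.
elim: e => [|e IH]; first by rewrite !expr0 tensmx1.
by rewrite !exprS IH -[LHS]/(_ *m _) tensmx_mul mul1mx.
Qed.

Lemma tensmx_unitmx m n (A : 'M[k]_m) (B : 'M[k]_n) :
  A \in unitmx -> B \in unitmx -> A *t B \in unitmx.
Proof.
move=> uA uB; have : (A *t B) *m (invmx A *t invmx B) = 1%:M.
  by rewrite tensmx_mul !mulmxV// tensmx1.
by case/mulmx1_unit.
Qed.

(* The tensor product of [c] with the block matrix [X], the blocks being kept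
   apart. *)
Definition tens_blocks m n m1 m2 n1 n2 (c : 'M[k]_(m, n)) (X : 'M[k]_(m1 + m2, n1 + n2)) :
  'M[k]_(m * m1 + m * m2, n * n1 + n * n2) :=
  block_mx (c *t ulsubmx X) (c *t ursubmx X) (c *t dlsubmx X) (c *t drsubmx X).

Lemma tens_blocks_mul m n p m1 m2 n1 n2 p1 p2 (c : 'M[k]_(m, n)) (c' : 'M[k]_(n, p))
    (X : 'M[k]_(m1 + m2, n1 + n2)) (X' : 'M[k]_(n1 + n2, p1 + p2)) :
  tens_blocks c X *m tens_blocks c' X' = tens_blocks (c *m c') (X *m X').
Proof.
have e := mulmx_block (ulsubmx X) (ursubmx X) (dlsubmx X) (drsubmx X)
  (ulsubmx X') (ursubmx X') (dlsubmx X') (drsubmx X').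
rewrite !submxK in e; rewrite /tens_blocks e.
rewrite block_mxKul block_mxKur block_mxKdl block_mxKdr.
by rewrite mulmx_block !tensmx_mul -!tensmxDr.
Qed.

Lemma tens_blocks1 m n1 n2 :
  tens_blocks (1%:M : 'M[k]_m) (1%:M : 'M[k]_(n1 + n2)) = 1%:M.
Proof.
have e := scalar_mx_block n1 n2 (1 : k).
rewrite /tens_blocks e block_mxKul block_mxKur block_mxKdl block_mxKdr.
by rewrite !tensmx1 !tensmx0 -scalar_mx_block.
Qed.

Lemma tens_blocks_tr m n m1 m2 n1 n2 (c : 'M[k]_(m, n)) (X : 'M[k]_(m1 + m2, n1 + n2)) :
  (tens_blocks c X)^T = tens_blocks c^T X^T.
Proof.
by rewrite /tens_blocks tr_block_mx !trmx_tens trmx_ulsub trmx_ursub trmx_dlsub trmx_drsub.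
Qed.

Lemma tens_blocksD m n m1 m2 n1 n2 (c : 'M[k]_(m, n)) (X Y : 'M[k]_(m1 + m2, n1 + n2)) :
  tens_blocks c (X + Y) = tens_blocks c X + tens_blocks c Y.
Proof.
have e := add_block_mx (ulsubmx X) (ursubmx X) (dlsubmx X) (drsubmx X)
  (ulsubmx Y) (ursubmx Y) (dlsubmx Y) (drsubmx Y).
rewrite !submxK in e; rewrite /tens_blocks e.
by rewrite block_mxKul block_mxKur block_mxKdl block_mxKdr add_block_mx !tensmxDr.
Qed.

Lemma tens_blocks0 m n m1 m2 n1 n2 (c : 'M[k]_(m, n)) :
  tens_blocks c (0 : 'M[k]_(m1 + m2, n1 + n2)) = 0.
Proof.
rewrite /tens_blocks -[0 in LHS]block_mx0.
by rewrite block_mxKul block_mxKur block_mxKdl block_mxKdr !tensmx0 block_mx0.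
Qed.

Lemma tens_blocksZ m n m1 m2 n1 n2 a b (c : 'M[k]_(m, n)) (X : 'M[k]_(m1 + m2, n1 + n2)) :
  tens_blocks (a *: c) (b *: X) = (a * b) *: tens_blocks c X.
Proof.
have e := scale_block_mx b (ulsubmx X) (ursubmx X) (dlsubmx X) (drsubmx X).
rewrite !submxK in e; rewrite /tens_blocks e.
rewrite block_mxKul block_mxKur block_mxKdl block_mxKdr scale_block_mx.
by rewrite !tensmxZl !tensmxZr !scalerA.
Qed.

Lemma tens_blocks_unit m n1 n2 (c : 'M[k]_m) (X : 'M[k]_(n1 + n2)) :
  c \in unitmx -> X \in unitmx -> tens_blocks c X \in unitmx.
Proof.
move=> uc uX; have : tens_blocks c X *m tens_blocks (invmx c) (invmx X) = 1%:M.
  by rewrite tens_blocks_mul !mulmxV// tens_blocks1.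
by case/mulmx1_unit.
Qed.

Lemma tens_blocks_diag m m1 m2 n n1 n2 (c : 'M[k]_(m, n)) (A : 'M[k]_(m1, n1)) (B : 'M[k]_(m2, n2)) :
  tens_blocks c (block_mx A 0 0 B) = block_mx (c *t A) 0 0 (c *t B).
Proof.
by rewrite /tens_blocks block_mxKul block_mxKur block_mxKdl block_mxKdr !tensmx0.
Qed.

Lemma tens_blocks_intertwine m m1 m2 n1 n2 (c : 'M[k]_m) (X : 'M[k]_(m1 + m2))
    (X' : 'M[k]_(n1 + n2)) (A : 'M[k]_(m1 + m2, n1 + n2)) : X *m A = A *m X' ->
  tens_blocks c X *m tens_blocks 1%:M A = tens_blocks 1%:M A *m tens_blocks c X'.
Proof. by move=> h; rewrite !tens_blocks_mul mul1mx mulmx1 h. Qed.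

Lemma tens_blocks_skew m n1 n2 (c : 'M[k]_m) (J N : 'M[k]_(n1 + n2)) :
  N^T *m J + J *m N = 0 ->
  (tens_blocks 1%:M N)^T *m tens_blocks c J + tens_blocks c J *m tens_blocks 1%:M N = 0.
Proof.
move=> h; rewrite tens_blocks_tr !tens_blocks_mul trmx1 mul1mx mulmx1.
by rewrite -tens_blocksD h tens_blocks0.
Qed.

End TensorBlocks.

(** * Parameters as pairs of an infinitesimal parameter and a nilpotent *)

Section Pairs.
Variables (F : fieldType) (K : local_field F).
Variables (Fbar : closedFieldType) (iota : {rmorphism F -> Fbar}).
Variable R : realType.
Local Notation W := (weil K iota).
Local Notation C := (Cplx R).
Local Notation SL := (SL2 C).
Local Notation w1 := (weil1 K iota).
Local Notation block := (block K iota R).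

(* [Some w] is sent to the infinitesimal parameter at [w], [None] to the
   nilpotent element. *)
Definition pair_of m (phi : W * SL -> 'M[C]_m) (g : option W) : 'M[C]_m :=
  if g is Some w then inf_param phi w else Defs.nilp phi.

(** It makes the differential algebraic: [nilp] is the coefficient of t, and the second clause says
    that the constant term is the identity. *)
Definition unip_polynomial m (phi : W * SL -> 'M[C]_m) (P : 'M[{poly C}]_m) : Prop :=
  (forall t, phi (w1, sl2_unip t) = map_mx (fun p => p.[t]) P) /\
  phi (w1, sl2_unip 0) = 1%:M.

Lemma nilp_polynomial m (phi : W * SL -> 'M[C]_m) P : unip_polynomial phi P ->
  Defs.nilp phi = map_mx (coefp 1) P.
Proof.
move=> [h _]; apply/matrixP => i j; rewrite [RHS]mxE /= -derive1_horner0 [LHS]mxE.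
suff -> : (fun t : C => phi (w1, sl2_unip t) i j) = horner (P i j) by [].
by apply: funext => t; rewrite h mxE.
Qed.

Lemma map_coefp1_mul m n p (A : 'M[C]_(m, n)) (P : 'M[{poly C}]_n) (B : 'M[C]_(n, p)) :
  map_mx (coefp 1) (map_mx polyC A *m P *m map_mx polyC B) = A *m map_mx (coefp 1) P *m B.
Proof.
apply/matrixP => i j; rewrite !mxE /= coef_sum; apply: eq_bigr => l _.
rewrite !mxE coefMC coef_sum; congr (_ * _); apply: eq_bigr => l' _.
by rewrite !mxE coefCM.
Qed.

Lemma map_horner_mul m n p (A : 'M[C]_(m, n)) (P : 'M[{poly C}]_n) (B : 'M[C]_(n, p)) t :
  map_mx (fun p => p.[t]) (map_mx polyC A *m P *m map_mx polyC B) =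
  A *m map_mx (fun p => p.[t]) P *m B.
Proof.
apply/matrixP => i j; rewrite !mxE horner_sum; apply: eq_bigr => l _.
rewrite !mxE hornerM hornerC horner_sum; congr (_ * _); apply: eq_bigr => l' _.
by rewrite !mxE hornerM hornerC.
Qed.

Lemma pair_of_iso m n (phi : W * SL -> 'M[C]_m) (psi : W * SL -> 'M[C]_n) P :
  unip_polynomial psi P -> rep_iso phi psi ->
  (exists P', unip_polynomial phi P') /\ rep_iso (pair_of phi) (pair_of psi).
Proof.
move=> hP [A [A' [AA' A'A h]]].
have phiE g : phi g = A *m psi g *m A' by rewrite -h -mulmxA AA' mulmx1.
have hP' : unip_polynomial phi (map_mx polyC A *m P *m map_mx polyC A').
  by split=> [t|]; rewrite phiE; [rewrite hP.1 map_horner_mul|rewrite hP.2 mulmx1].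
split; first by exists (map_mx polyC A *m P *m map_mx polyC A').
exists A, A'; split=> // -[w|]; rewrite /pair_of; first exact: h.
rewrite (nilp_polynomial hP') (nilp_polynomial hP) map_coefp1_mul.
by rewrite -[_ *m A' *m A]mulmxA A'A mulmx1.
Qed.

Definition wroot (w : W) : C := sqrtC (wnorm R w).

Lemma wroot_neq0 w : wroot w != 0.
Proof. by rewrite sqrtC_eq0 wnorm_neq0. Qed.

Lemma wroot_sqr w : wroot w ^+ 2 = wnorm R w.
Proof. exact: sqrtCK. Qed.

Definition weight_mx a (w : W) : 'M[C]_a := Srep_weights a (wroot w) (wroot w)^-1.

Lemma Srep_wdiag a w : Srep a (wdiag R w) = weight_mx a w.
Proof. by rewrite Srep_diag ?mxE. Qed.

Lemma wdiag1 a : Srep a (wdiag R w1) = 1%:M.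
Proof.
rewrite Srep_wdiag /weight_mx /wroot.
have -> : wnorm R w1 = 1 by rewrite /wnorm /= expr0z.
by rewrite sqrtC1 invr1 Srep_weights1.
Qed.

(** S_b contributes weights through its torus but the identity to the nilpotent, since the second
    SL_2 is restricted to [wdiag]. *)
Definition std_block (b : block) (g : option W) : 'M[C]_(block_dim b) :=
  if g is Some w then brho b w *t (weight_mx (ba b) w *t weight_mx (bb b) w)
  else 1%:M *t (shift_nat C (ba b) *t 1%:M).

Fixpoint std_sum (s : seq block) (g : option W) : 'M[C]_(sum_dim s) :=
  if s is b :: s' then block_mx (std_block b g) 0 0 (std_sum s' g) else 0.

Definition phi_sum (s : seq block) (g : W * SL) : 'M[C]_(sum_dim s) :=
  sum_rep s (g.1, g.2, wdiag R g.1).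

Definition phi_block (b : block) (g : W * SL) : 'M[C]_(block_dim b) :=
  block_rep b (g.1, g.2, wdiag R g.1).

Lemma std_block_iso b : brho b w1 = 1%:M ->
  (exists P, unip_polynomial (phi_block b) P) /\
  rep_iso (pair_of (phi_block b)) (std_block b).
Proof.
move=> b1; pose P : 'M[{poly C}]_(block_dim b) :=
  map_mx polyC 1%:M *t (unip_mx C (ba b) *t map_mx polyC 1%:M).
have hP : unip_polynomial (phi_block b) P.
  rewrite /unip_polynomial /phi_block /block_rep /= b1 wdiag1; split=> [t|].
    rewrite Srep_unip /P; apply/matrixP => i j; rewrite !mxE /=.
    by rewrite !hornerM !hornerC.
  by rewrite Srep_unip0 !tensmx1.
split; first by exists P.
(* The rescaling is diagonal, so it commutes with the weights and changes only the nilpotent. *)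
apply: (@unit_rep_iso _ _ _ _ _ (1%:M *t (invmx (ffact_mx C (ba b)) *t 1%:M))).
  apply: tensmx_unitmx; first exact: unitmx1.
  by apply: tensmx_unitmx; rewrite ?unitmx1 ?unitmx_inv ?ffact_mx_unit.
case=> [w|] /=.
  rewrite /inf_param /phi_block /block_rep /= !Srep_wdiag !tensmx_mul.
  by rewrite !mul1mx !mulmx1 ffact_weights.
rewrite (nilp_polynomial hP).
have -> : map_mx (coefp 1) P = 1%:M *t (map_mx (coefp 1) (unip_mx C (ba b)) *t 1%:M).
  apply/matrixP => i j; rewrite !mxE /=.
  by rewrite coefCM coefMC.
rewrite !tensmx_mul !mul1mx; congr (_ *t (_ *t _)).
apply: (can_inj (mulKmx (ffact_mx_unit C _))).
rewrite mulKVmx ?ffact_mx_unit// mulmxA -unip_mx_coef1.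
by rewrite mulmxK ?ffact_mx_unit.
Qed.

Lemma std_sum_iso s : List.Forall (fun b => brho b w1 = 1%:M) s ->
  (exists P, unip_polynomial (phi_sum s) P) /\
  rep_iso (pair_of (phi_sum s)) (std_sum s).
Proof.
elim: s => [_|b s IH hs].
  split; first by exists 0; split=> [t|]; apply/matrixP; case.
  by apply: rep_iso_eq => g; apply/matrixP; case.
have hb : brho b w1 = 1%:M by inversion hs.
have {IH hs} [[Q hQ] IH] : (exists P, unip_polynomial (phi_sum s) P) /\
    rep_iso (pair_of (phi_sum s)) (std_sum s) by apply: IH; inversion hs.
have [[P hP] hI] := std_block_iso hb.
have hPQ : unip_polynomial (phi_sum (b :: s)) (block_mx P 0 0 Q).
  split=> [t|]; last first.
    rewrite /phi_sum /=; move: hP.2 hQ.2; rewrite /phi_block /phi_sum /= => -> ->.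
    by rewrite -scalar_mx_block.
  rewrite /phi_sum /= map_block_mx -hP.1 -hQ.1; congr block_mx;
  by apply/matrixP => i j; rewrite !mxE horner0.
split; first by exists (block_mx P 0 0 Q).
apply: rep_iso_trans (rep_iso_sum hI IH).
apply: rep_iso_eq => -[w|] //=.
rewrite (nilp_polynomial hPQ) (nilp_polynomial hP) (nilp_polynomial hQ).
rewrite map_block_mx; congr block_mx; by apply/matrixP => i j; rewrite !mxE /= coef0.
Qed.

Lemma std_block_weight b w : std_block b (Some w) *m std_block b None =
  wnorm R w *: (std_block b None *m std_block b (Some w)).
Proof.
have e : weight_mx (ba b) w *m shift_nat C (ba b) =
    wnorm R w *: (shift_nat C (ba b) *m weight_mx (ba b) w).
  by rewrite -wroot_sqr; apply: shift_weights; exact: wroot_neq0.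
by rewrite /std_block !tensmx_mul !mulmx1 !mul1mx e tensmxZl tensmxZr.
Qed.

Lemma std_sum_weight s w : std_sum s (Some w) *m std_sum s None =
  wnorm R w *: (std_sum s None *m std_sum s (Some w)).
Proof.
elim: s => [|b s IH]; first by apply/matrixP; case.
rewrite [std_sum (b :: s) _]/= [std_sum (b :: s) None]/= 2!mul_block_diag.
by rewrite scale_block_diag -IH -std_block_weight.
Qed.

Definition has_unit_block (s : seq block) : Prop :=
  List.Forall (fun b => brho b w1 = 1%:M) s.

Lemma block_ok_unit s : List.Forall (@block_ok _ K _ iota R) s -> has_unit_block s.
Proof.
apply: List.Forall_impl => b [hb _ _]; apply: (brep1 hb).
by move=> x.
Qed.

Lemma sum_rep_pair m (psi : W * SL * SL -> 'M[C]_m) s :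
  has_unit_block s -> rep_iso psi (sum_rep s) ->
  let phi := fun g : W * SL => psi (g.1, g.2, wdiag R g.1) in
  (exists P, unip_polynomial phi P) /\ rep_iso (pair_of phi) (std_sum s).
Proof.
move=> hs hpsi phi; have [[P hP] hI] := std_sum_iso hs.
have [hP' hI'] := pair_of_iso hP
  (rep_iso_comp (fun g : W * SL => (g.1, g.2, wdiag R g.1)) hpsi : rep_iso phi _).
by split=> //; apply: rep_iso_trans hI' hI.
Qed.

(** The infinitesimal relation is the coefficient of t in P(t)^T B P(t) = B. *)
Lemma orthogonal_preserves m (phi : W * SL -> 'M[C]_m) P (B : 'M[C]_m) :
  unip_polynomial phi P -> (forall g, (phi g)^T *m B *m phi g = B) ->
  preserves B (pair_of phi).
Proof.
move=> hP hB; split=> [w|]; first exact: hB.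
rewrite /pair_of (nilp_polynomial hP).
pose Q := (P^T *m map_mx polyC B *m P).
have P0 : map_mx (coefp 0) P = 1%:M.
  rewrite -hP.2 hP.1; apply/matrixP => i j; rewrite !mxE /=.
  by rewrite -horner_coef0.
apply/matrixP => i j; rewrite [RHS]mxE.
have : (Q i j)`_1 = 0.
  rewrite -derive1_horner0 (_ : horner (Q i j) = cst (B i j)) ?derive1_cst//.
  apply: funext => t; rewrite /= -(hB (w1, sl2_unip t)) hP.1 /Q !mxE horner_sum.
  apply: eq_bigr => l _; rewrite !mxE hornerM horner_sum; congr (_ * _).
  by apply: eq_bigr => l' _; rewrite !mxE hornerM hornerC.
move=> <-.
have -> : (Q i j)`_1 = \sum_l \sum_l' ((P l' i)`_1 * B l' l * (P l j)`_0 +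
    (P l' i)`_0 * B l' l * (P l j)`_1).
  rewrite /Q mxE coef_sum; apply: eq_bigr => l _; rewrite mxE mulr_suml coef_sum.
  apply: eq_bigr => l' _; rewrite !mxE coefM !big_ord_recr big_ord0 /= add0r.
  by rewrite !coefMC subn0 subnn addrC.
under eq_bigr => l _ do rewrite big_split/=.
rewrite big_split/= mxE; congr (_ + _).
  transitivity (((map_mx (coefp 1) P)^T *m B *m map_mx (coefp 0) P) i j).
    by rewrite P0 mulmx1.
  rewrite mxE; apply: eq_bigr => l _; rewrite !mxE mulr_suml.
  by apply: eq_bigr => l' _; rewrite !mxE.
transitivity (((map_mx (coefp 0) P)^T *m B *m map_mx (coefp 1) P) i j).
  by rewrite P0 trmx1 mul1mx.
rewrite mxE; apply: eq_bigr => l _; rewrite !mxE mulr_suml.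
by apply: eq_bigr => l' _; rewrite !mxE.
Qed.

End Pairs.

(** * The closure order: representatives, transitivity, ranks *)

Section ClosureOrder.
Variables (F : fieldType) (K : local_field F).
Variables (Fbar : closedFieldType) (iota : {rmorphism F -> Fbar}).
Variable R : realType.
Local Notation W := (weil K iota).
Local Notation C := (Cplx R).
Local Notation SL := (SL2 C).
Variables (n : nat) (d : F).
Local Notation Psi := (Psi K iota R n d).
Implicit Types (psi : Psi) (phi : W * SL -> 'M[C]_(2 * n)).

Lemma two_neq0C : 2%:R != 0 :> C.
Proof. by rewrite pnatr_eq0. Qed.

Definition represents phi psi : Prop :=
  orthogonal_valued phi /\ rep_iso phi (phi_of psi).

Lemma represents_exists psi : exists phi, represents phi psi.
Proof.
have [s hs] := orthonormalize two_neq0C (psi_orth psi).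
move=> ho; exists (fun g => s (g.1, g.2, wdiag R g.1)); split=> [g|].
  exact: ho.
apply: rep_iso_sym.
exact: (rep_iso_comp (fun g : W * SL => (g.1, g.2, wdiag R g.1)) hs).
Qed.

Lemma phi_of_std psi s : has_unit_block s -> rep_iso psi (sum_rep s) ->
  (exists P, unip_polynomial (phi_of psi) P) /\
  rep_iso (pair_of (phi_of psi)) (std_sum s).
Proof. by move=> hs hpsi; have [] := sum_rep_pair hs hpsi. Qed.

Lemma phi_of_unip psi : exists P, unip_polynomial (phi_of psi) P.
Proof.
by have [s /block_ok_unit hs hpsi] := psi_sum psi; have [] := phi_of_std hs hpsi.
Qed.

Lemma represents_unip phi psi : represents phi psi ->
  (exists P, unip_polynomial phi P) /\ rep_iso (pair_of phi) (pair_of (phi_of psi)).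
Proof. by move=> [_ hphi]; have [P hP] := phi_of_unip psi; exact: pair_of_iso hP hphi. Qed.

Lemma represents_preserves phi psi : represents phi psi -> preserves 1%:M (pair_of phi).
Proof.
move=> h; have [[P hP] _] := represents_unip h.
by apply: (orthogonal_preserves hP) => g; rewrite mulmx1; exact: h.1.
Qed.

Lemma represents_weight phi psi : represents phi psi -> forall w,
  inf_param phi w *m Defs.nilp phi = wnorm R w *: (Defs.nilp phi *m inf_param phi w).
Proof.
move=> h w; have [_ h1] := represents_unip h.
have [s /block_ok_unit hs hpsi] := psi_sum psi.
have [_ h2] := phi_of_std hs hpsi.
have [A [A' [AA' A'A e]]] := rep_iso_trans h1 h2.
have pE g : pair_of phi g = A *m std_sum s g *m A' by rewrite -e -mulmxA AA' mulmx1.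
rewrite -[inf_param phi w]/(pair_of phi (Some w)) -[Defs.nilp phi]/(pair_of phi None) !pE.
exact: mulmx_conj_scale A'A (std_sum_weight s w).
Qed.

Lemma orthogonal_inv (U : 'M[C]_(2 * n)) : U^T *m U = 1%:M ->
  U \in unitmx /\ invmx U = U^T.
Proof.
move=> UU; have [_ uU] := mulmx1_unit UU; split=> //.
by rewrite -[LHS]mul1mx -UU mulmxK.
Qed.

Lemma nilp_in_V phi psi : represents phi psi ->
  forall h, H_of (inf_param phi) h ->
  V_of (inf_param phi) (h *m Defs.nilp phi *m invmx h).
Proof.
move=> hr h [hh hc]; have [uh ih] := orthogonal_inv hh; split.
  have [_] := represents_preserves hr; rewrite mulmx1 mul1mx => /eqP.
  rewrite addr_eq0 => /eqP nT.
  by rewrite ih !trmx_mul trmxK nT mulmxA mulmxN mulNmx.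
move=> w; have [uw _] : inf_param phi w \in unitmx /\ True.
  by split=> //; have [] := orthogonal_inv (hr.1 (w, wdiag R w)).
have e : inf_param phi w *m (h *m Defs.nilp phi *m invmx h) =
    wnorm R w *: (h *m Defs.nilp phi *m invmx h *m inf_param phi w).
  rewrite !mulmxA -hc -[h *m _ *m Defs.nilp phi]mulmxA (represents_weight hr).
  rewrite -scalemxAr -scalemxAl; congr (_ *: _).
  rewrite mulmxA -!mulmxA; congr (_ *m (_ *m _)).
  by rewrite -[inf_param phi w in LHS](mulKmx uh) hc -!mulmxA mulmxV// mulmx1.
by rewrite e -scalemxAl mulmxK.
Qed.

Lemma nilp_in_orbit phi : orbit_of phi (Defs.nilp phi).
Proof.
exists 1%:M; last by rewrite mul1mx invmx1 mulmx1.
by split=> [|w]; rewrite /orthogonal_mx ?trmx1 ?mul1mx ?mulmx1.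
Qed.

Lemma conj_orbit phi h Y : H_of (inf_param phi) h -> orbit_of phi Y ->
  orbit_of phi (h *m Y *m invmx h).
Proof.
move=> [hh hc] [g [gg gc] <-].
have [uh _] := orthogonal_inv hh; have [ug _] := orthogonal_inv gg.
exists (h *m g).
  split=> [|w].
    by rewrite /orthogonal_mx trmx_mul mulmxA -[_ *m h^T *m h]mulmxA hh mulmx1.
  by rewrite -mulmxA gc mulmxA hc mulmxA.
have -> : invmx (h *m g) = invmx g *m invmx h.
  apply: (can_inj (mulKmx (_ : h *m g \in unitmx))).
    by rewrite unitmx_mul uh.
  by rewrite mulmxV ?unitmx_mul ?uh// mulmxA -[h *m g *m _]mulmxA mulmxV// mulmx1 mulmxV.
by rewrite !mulmxA.
Qed.

(** One point of the smaller orbit suffices: conjugation is continuous, so the closure of an orbit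
    is stable under the centralizer. *)
Lemma geC_intro psi1 psi2 phi1 phi2 :
  represents phi1 psi1 -> represents phi2 psi2 ->
  inf_param phi1 =1 inf_param phi2 ->
  closure (orbit_of phi1) (Defs.nilp phi2) -> geC psi1 psi2.
Proof.
move=> h1 h2 e cl; exists phi1, phi2.
split; [exact: h1.1|exact: h1.2|exact: h2.1|exact: h2.2|split; first exact: e].
move=> _ [h [hh hc] <-].
have hH : H_of (inf_param phi1) h by split=> // w; rewrite e hc.
split.
  have := closure_mulmx (L := h) (M := (invmx h)) cl; apply: closureS => _ [Y oY <-].
  exact: conj_orbit.
rewrite (funext e); apply: (nilp_in_V h2).
by split.
Qed.

Lemma geC_elim psi1 psi2 : geC psi1 psi2 -> exists phi1 phi2,
  [/\ represents phi1 psi1, represents phi2 psi2,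
      inf_param phi1 =1 inf_param phi2 & closure (orbit_of phi1) (Defs.nilp phi2)].
Proof.
move=> [phi1 [phi2 [h1 i1 h2 i2 [e sub]]]]; exists phi1, phi2.
split; [by split|by split|exact: e|].
by have [] := sub _ (nilp_in_orbit phi2).
Qed.

Definition conj_phi (U : 'M[C]_(2 * n)) phi (g : W * SL) : 'M[C]_(2 * n) :=
  U *m phi g *m invmx U.

Lemma represents_conj U phi psi : U^T *m U = 1%:M -> represents phi psi ->
  represents (conj_phi U phi) psi /\
  Defs.nilp (conj_phi U phi) = U *m Defs.nilp phi *m invmx U.
Proof.
move=> UU h; have [uU iU] := orthogonal_inv UU.
have [[P hP] _] := represents_unip h.
have iso : rep_iso (conj_phi U phi) phi.
  by apply/rep_iso_sym/(unit_rep_iso uU) => g; rewrite /conj_phi mulmxKV.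
split.
  split=> [g|]; last exact: rep_iso_trans iso h.2.
  rewrite /orthogonal_mx /conj_phi !trmx_mul iU trmxK.
  rewrite !mulmxA -[_ *m U^T *m U]mulmxA UU mulmx1 -[U *m _ *m _]mulmxA.
  by rewrite (h.1 g) mulmx1; apply: mulmx1C.
have hP' : unip_polynomial (conj_phi U phi)
    (map_mx polyC U *m P *m map_mx polyC (invmx U)).
  split=> [t|]; first by rewrite map_horner_mul /conj_phi hP.1.
  by rewrite /conj_phi hP.2 mulmx1 mulmxV.
by rewrite (nilp_polynomial hP') (nilp_polynomial hP) map_coefp1_mul.
Qed.

(* [preserves] requires an infinitesimal component; it is taken to be 0 here. *)
Lemma represents_unique phi phi' psi : represents phi psi -> represents phi' psi ->
  exists2 U : 'M[C]_(2 * n), U^T *m U = 1%:M & forall g, U *m phi g = phi' g *m U.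
Proof.
move=> h h'.
pose ext (f : W * SL -> 'M[C]_(2 * n)) (g : option (W * SL)) := if g is Some g then f g else 0.
have hext f : orthogonal_valued f -> preserves 1%:M (ext f).
  by move=> hf; split=> [g|]; rewrite ?mulmx1 ?mulmx0 ?addr0 ?trmx0//; exact: hf.
have [A [A' [e1 e2 e3]]] := rep_iso_trans h.2 (rep_iso_sym h'.2).
have [|U UU Uc] := orthogonal_conj two_neq0C (hext phi h.1) (hext phi' h'.1).
  by exists A, A'; split=> // -[g|] /=; rewrite ?mul0mx ?mulmx0.
by exists U => // g; exact: (Uc (Some g)).
Qed.

Lemma conj_orbit_of U phi phi' Y : U^T *m U = 1%:M ->
  (forall g, U *m phi g = phi' g *m U) ->
  Defs.nilp phi' = U *m Defs.nilp phi *m invmx U ->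
  orbit_of phi Y -> orbit_of phi' (U *m Y *m invmx U).
Proof.
move=> UU Uc nE [h [hh hc] <-]; have [uU iU] := orthogonal_inv UU.
have [uh ih] := orthogonal_inv hh.
have UUT : U *m U^T = 1%:M by exact: mulmx1C.
have oo : (U *m h *m invmx U)^T *m (U *m h *m invmx U) = 1%:M.
  rewrite !trmx_mul iU trmxK !mulmxA -[_ *m U^T *m U]mulmxA UU mulmx1.
  by rewrite -[U *m h^T *m h]mulmxA hh mulmx1.
have [_ ioo] := orthogonal_inv oo.
exists (U *m h *m invmx U).
  split=> // w; have Uw : U *m inf_param phi w = inf_param phi' w *m U by exact: Uc.
  have Uw' : invmx U *m inf_param phi' w = inf_param phi w *m invmx U.
    by rewrite -[inf_param phi w](mulKmx uU) Uw -!mulmxA mulmxV// mulmx1.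
  by rewrite -mulmxA Uw' mulmxA -[U *m h *m _]mulmxA hc !mulmxA Uw.
have -> : invmx (U *m h *m invmx U) = U *m invmx h *m invmx U.
  by rewrite ioo !trmx_mul ih iU trmxK mulmxA.
have e := mulVmx uU.
by rewrite nE (mulmx_conj _ _ e) (mulmx_conj _ _ e).
Qed.

(** The two comparisons may use different representatives of psi2; an orthogonal conjugation,
    applied to that of psi3 as well, aligns them. *)
Lemma geC_trans psi1 psi2 psi3 : geC psi1 psi2 -> geC psi2 psi3 -> geC psi1 psi3.
Proof.
move=> /geC_elim [phi1 [phi2 [r1 r2 e12 c12]]] /geC_elim [phi2' [phi3 [r2' r3 e23 c23]]].
have [U UU Uc] := represents_unique r2' r2; have [uU iU] := orthogonal_inv UU.
have [r3' n3'] := represents_conj UU r3.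
have cE g : phi2 g = U *m phi2' g *m invmx U by rewrite Uc mulmxK.
have nE : Defs.nilp phi2 = U *m Defs.nilp phi2' *m invmx U.
  have [_ <-] := represents_conj UU r2'.
  by congr (Defs.nilp _); exact: funext cE.
apply: (geC_intro r1 r3').
  by move=> w; rewrite e12 /inf_param cE /conj_phi -[phi3 _]/(inf_param phi3 w) -e23.
rewrite n3'; have := closure_mulmx (L := U) (M := (invmx U)) c23.
have sub : [set U *m Y *m invmx U | Y in orbit_of phi2'] `<=` closure (orbit_of phi1).
  move=> _ [Y oY <-]; have [h [hh hc] <-] := conj_orbit_of UU Uc nE oY.
  have hH : H_of (inf_param phi1) h by split=> // w; rewrite e12 hc.
  have := closure_mulmx (L := h) (M := (invmx h)) c12; apply: closureS => _ [Z oZ <-].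
  exact: conj_orbit.
by move=> cl; apply: (@closed_closure _ (orbit_of phi1)); exact: closureS sub _ cl.
Qed.

Lemma geC_same psi1 psi2 : same_param psi1 psi2 -> geC psi1 psi2.
Proof.
move=> h; have [phi [h1 i]] := represents_exists psi1.
have r2 : represents phi psi2.
  split; first exact: h1.
  apply: rep_iso_trans i _.
  exact: (rep_iso_comp (fun g : W * SL => (g.1, g.2, wdiag R g.1)) h).
by apply: (geC_intro (conj h1 i) r2) => //; apply: subset_closure; exact: nilp_in_orbit.
Qed.

Definition nilp_rank psi e : nat := \rank (Defs.nilp (phi_of psi) ^+ e).

Lemma rep_iso_rank p q (x : option W -> 'M[C]_p) (y : option W -> 'M[C]_q) e :
  rep_iso x y -> \rank (x None ^+ e) = \rank (y None ^+ e).
Proof.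
move=> h; have epq := rep_iso_dim h; case: q / epq y h => y.
move=> /rep_iso_unit [P uP Pe].
by rewrite Pe; exact/esym/rank_exp_conj.
Qed.

Lemma represents_rank phi psi e : represents phi psi ->
  nilp_rank psi e = \rank (Defs.nilp phi ^+ e).
Proof.
by move=> h; have [_ /(rep_iso_rank e)/= ->] := represents_unip h.
Qed.

Lemma std_rank psi s e : has_unit_block s -> rep_iso psi (sum_rep s) ->
  nilp_rank psi e = \rank (std_sum s None ^+ e).
Proof. by move=> hs hpsi; have [_ /(rep_iso_rank e)/= <-] := phi_of_std hs hpsi. Qed.

Lemma geC_rank psi1 psi2 e : geC psi1 psi2 -> (nilp_rank psi2 e <= nilp_rank psi1 e)%N.
Proof.
move=> /geC_elim [phi1 [phi2 [r1 r2 _ cl]]].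
rewrite (represents_rank e r1) (represents_rank e r2); apply: rank_closure cl.
move=> _ [h [hh _] <-]; have [uh _] := orthogonal_inv hh.
by rewrite (rank_exp_conj _ _ uh).
Qed.

End ClosureOrder.

(** * The form on rho and its sign *)

Section TensorForms.
Variables (k : numClosedFieldType) (m : nat).

(** The inclusion of k^m as k^m (x) e_u. *)
Definition tens_incl N (u : 'I_N) : 'M[k]_(m * N, m) :=
  \matrix_(x, i) (x == mxtens_index (i, u))%:R.

Lemma tens_incl_mul N (X : 'M[k]_N) (r : 'M[k]_m) u v s :
  (forall w, X w u = s *+ (w == v)) ->
  (r *t X) *m tens_incl u = s *: (tens_incl v *m r).
Proof.
move=> hX; apply/matrixP => x i; case: (mxtens_indexP x) => x1 x2.
rewrite mxE (bigD1 (mxtens_index (i, u)))//= big1 ?addr0 => [|y /negPf ne]; last first.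
  by rewrite [X in _ * X]mxE ne mulr0.
rewrite tensmxE [X in _ * X]mxE eqxx mulr1 hX !mxE.
rewrite (bigD1 x1)//= big1 ?addr0 => [|y ne]; last first.
  rewrite mxE (can_eq (@mxtens_indexK _ _)) xpair_eqE eq_sym (negPf ne) mul0r.
  by [].
rewrite mxE (can_eq (@mxtens_indexK _ _)) xpair_eqE eqxx /=.
by case: (x2 == v); rewrite ?mulr1n ?mulr0n ?mul1r ?mul0r ?mulr0// mulrC.
Qed.

Lemma tens_incl_tr N (u v : 'I_N) :
  (tens_incl u)^T *m tens_incl v = (u == v)%:R%:M.
Proof.
apply/matrixP => i j; rewrite mxE (bigD1 (mxtens_index (i, u)))//= big1 ?addr0.
  rewrite !mxE eqxx mul1r (can_eq (@mxtens_indexK _ _)) xpair_eqE.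
  by case: (i == j); case: (u == v).
by move=> x /negPf ne; rewrite !mxE ne mul0r.
Qed.

Lemma det_two : \det (mx2 (2 : k) 0 0 2^-1) = 1.
Proof. by rewrite det_mx2 mul0r subr0 divff// pnatr_eq0. Qed.

Lemma det_weyl : \det (mx2 (0 : k) 1 (-1) 0) = 1.
Proof. by rewrite det_mx2 mul0r sub0r mul1r opprK. Qed.

Lemma two_exp_inj (a b : nat) : (2 : k) ^+ a = 2 ^+ b -> a = b.
Proof. by move/eqP; rewrite -!natrX eqr_nat eqn_exp2l// => /eqP. Qed.

End TensorForms.

Section SymmetricForm.
Variables (k : numClosedFieldType) (T : Type) (m a b : nat) (r : T -> 'M[k]_m).
Variable t1 : T.
Hypotheses (r1 : r t1 = 1%:M) (a_gt0 : (0 < a)%N) (b_gt0 : (0 < b)%N).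
Let rep (g : T * SL2 k * SL2 k) := r g.1.1 *t (Srep a g.1.2 *t Srep b g.2).

Definition ord_top n (h : (0 < n)%N) : 'I_n := Ordinal (ltac:(by rewrite prednK) : (n.-1 < n)%N).
Definition ord_bot n (h : (0 < n)%N) : 'I_n := Ordinal h.

(* [c] is the form restricted to the extreme weight spaces of S_a (x) S_b, which
   the Weyl element exchanges. *)
Lemma good_parity_form : rep_orthogonal rep ->
  exists c : 'M[k]_m, [/\ c \in unitmx, forall w, (r w)^T *m c *m r w = c &
    c^T = (-1) ^+ (a + b) *: c].
Proof.
move=> [B [BT uB hB]].
pose E (u : 'I_(a * b)) := tens_incl k m u.
pose top := mxtens_index (ord_top a_gt0, ord_top b_gt0).
pose bot := mxtens_index (ord_bot a_gt0, ord_bot b_gt0).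
pose one : SL2 k := sl2_unip 0.
pose two : SL2 k := MkSL2 (det_two k).
pose wey : SL2 k := MkSL2 (det_weyl k).
(* Invariance under diag(2, 1/2) in either SL_2 allows only opposite weights to pair; powers of 2
   being distinct, this single torus element separates all weights. *)
have c0 u v : (E u)^T *m B *m E v != 0 ->
    ((mxtens_unindex u).1 + (mxtens_unindex v).1 = a.-1 /\
     (mxtens_unindex u).2 + (mxtens_unindex v).2 = b.-1)%N.
  case: (mxtens_indexP u) => u1 u2; case: (mxtens_indexP v) => v1 v2.
  rewrite !mxtens_indexK /=.
  have key (x y : SL2 k) s : (forall u, rep (t1, x, y) *m E u = s u *: E u) ->
      s (mxtens_index (u1, u2)) * s (mxtens_index (v1, v2)) != 1 ->
      (E (mxtens_index (u1, u2)))^T *m B *m E (mxtens_index (v1, v2)) = 0.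
    move=> hs s1; set u0 := mxtens_index _ in s1 *; set v0 := mxtens_index _ in s1 *.
    have : (E u0)^T *m B *m E v0 = (s u0 * s v0) *: ((E u0)^T *m B *m E v0).
      rewrite -{1}(hB (t1, x, y)) -!mulmxA hs !mulmxA -trmx_mul hs.
      by rewrite [(_ *: _)^T]linearZ/= -!scalemxAl -scalemxAr scalerA.
    move/eqP; rewrite -subr_eq0 -{1}[_ *m E v0]scale1r -scalerBl scaler_eq0.
    by rewrite subr_eq0 eq_sym (negPf s1) => /eqP.
  have wE n (w : 'I_n) : Srep_weights n (2 : k) 2^-1 w w = 2 ^+ w / 2 ^+ (n.-1 - w).
    by rewrite !mxE eqxx mulr1n exprVn.
  have prod1 n (w w' : 'I_n) : (2 : k) ^+ w / 2 ^+ (n.-1 - w) * (2 ^+ w' / 2 ^+ (n.-1 - w')) = 1 ->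
      (w + w' = n.-1)%N.
    move=> e; have : (2 : k) ^+ (w + w') = 2 ^+ (n.-1 - w + (n.-1 - w')).
      by rewrite !exprD; apply: divr1_eq; rewrite -mulf_div.
    by move/two_exp_inj; have := ltn_ord w; have := ltn_ord w'; lia.
  have sw n (x : SL2 k) : x = two \/ x = one -> forall i j : 'I_n,
      Srep n x i j = Srep n x j j *+ (i == j).
    move=> hx i j; rewrite Srep_diag; [|by case: hx => ->; rewrite mxE..].
    by rewrite !mxE eqxx; case: eqP => [->//|_]; rewrite !mulr0n.
  have swE n (w : 'I_n) : Srep n two w w = 2 ^+ w / 2 ^+ (n.-1 - w).
    have [t00 t11] : two 0 0 = 2 /\ two 1 1 = 2^-1 by rewrite !mxE.
    by rewrite Srep_diag ?t00 ?t11 ?wE// mxE.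
  have oE n (w : 'I_n) : Srep n one w w = 1 by rewrite Srep_unip0 mxE eqxx.
  have act (x y : SL2 k) : (x = two \/ x = one) -> (y = two \/ y = one) ->
      forall u, rep (t1, x, y) *m E u = (Srep a x (mxtens_unindex u).1 (mxtens_unindex u).1 *
        Srep b y (mxtens_unindex u).2 (mxtens_unindex u).2) *: E u.
    move=> hx hy u0; rewrite -[E u0 in RHS]mulmx1 -r1; apply: tens_incl_mul => w.
    case: (mxtens_indexP u0) => u3 u4; case: (mxtens_indexP w) => w1 w2.
    rewrite tensmxE !mxtens_indexK (can_eq (@mxtens_indexK _ _)) xpair_eqE /=.
    rewrite (sw _ _ hx w1) (sw _ _ hy w2).
    by case: (w1 == u3); case: (w2 == u4); rewrite ?mulr0n ?mulr0 ?mul0r.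
  move=> nz; split.
    apply: prod1; apply/eqP; apply: contraNT nz => ne; apply/eqP.
    apply: (key _ _ _ (act two one (or_introl erefl) (or_intror erefl))).
    by rewrite !mxtens_indexK /= !oE !mulr1 !swE.
  apply: prod1; apply/eqP; apply: contraNT nz => ne; apply/eqP.
  apply: (key _ _ _ (act one two (or_intror erefl) (or_introl erefl))).
  by rewrite !mxtens_indexK /= !oE !mul1r !swE.
pose c := (E top)^T *m B *m E bot.
(* The top weight space pairs only with the bottom one, so invertibility of B passes to c. *)
have EB : (E top)^T *m B = c *m (E bot)^T.
  apply/matrixP => i x; case: (mxtens_indexP x) => j v.
  have -> : ((E top)^T *m B) i (mxtens_index (j, v)) = ((E top)^T *m B *m E v) i j.
    rewrite [RHS]mxE (bigD1 (mxtens_index (j, v)))//= big1 ?addr0 => [|y /negPf ne].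
      by rewrite [X in _ * X]mxE eqxx mulr1.
    by rewrite [X in _ * X]mxE ne mulr0.
  have -> : (c *m (E bot)^T) i (mxtens_index (j, v)) = if v == bot then c i j else 0.
    rewrite mxE (bigD1 j)//= big1 ?addr0 => [|y ne].
      rewrite !mxE (can_eq (@mxtens_indexK _ _)) xpair_eqE eqxx /=.
      by case: (v == bot); rewrite ?mulr1 ?mulr0.
    rewrite !mxE (can_eq (@mxtens_indexK _ _)) xpair_eqE eq_sym (negPf ne).
    by rewrite mulr0.
  case: eqP => [->//|ne].
  have [->|nz] := eqVneq ((E top)^T *m B *m E v) 0; first by rewrite mxE.
  have [h1 h2] := c0 _ _ nz; case: ne; move: h1 h2.
  case: (mxtens_indexP v) => v1 v2.
  rewrite !mxtens_indexK /= => h1 h2; congr mxtens_index.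
  by apply/eqP; rewrite xpair_eqE -!val_eqE /=; lia.
have uc : c \in unitmx.
  have : c *m ((E bot)^T *m (invmx B *m E top)) = 1%:M.
    by rewrite !mulmxA -EB mulmxK// tens_incl_tr eqxx.
  by case/mulmx1_unit.
exists c; split=> // [w|].
  have e u : rep (w, one, one) *m E u = E u *m r w.
    rewrite -[RHS]scale1r; apply: tens_incl_mul => v.
    by rewrite /= !Srep_unip0 tensmx1 mxE.
  transitivity ((E top)^T *m ((rep (w, one, one))^T *m B *m rep (w, one, one)) *m E bot).
    by rewrite -!mulmxA e !mulmxA -[in RHS]trmx_mul e trmx_mul ?mulmxA.
  by rewrite hB.
have weyE n (i j : 'I_n) : Srep n wey i j = (-1) ^+ j *+ (i + j == n.-1)%N.
  by apply: Srep_weyl; rewrite mxE.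
(* The sign is (-1)^(a-1) (-1)^(b-1); in the other direction the sign is 1, and comparing c with its
   transpose leaves (-1)^(a+b). *)
have e1 : rep (t1, wey, wey) *m E top = (-1) ^+ (a + b) *: E bot.
  rewrite -[E bot]mulmx1 -r1; apply: tens_incl_mul => w.
  case: (mxtens_indexP w) => w1 w2; rewrite tensmxE !weyE /=.
  rewrite (can_eq (@mxtens_indexK _ _)) xpair_eqE -!val_eqE /=.
  rewrite (_ : (w1 + a.-1 == a.-1)%N = (w1 == 0 :> nat)); last by lia.
  rewrite (_ : (w2 + b.-1 == b.-1)%N = (w2 == 0 :> nat)); last by lia.
  case: (w1 == 0 :> nat); case: (w2 == 0 :> nat); rewrite ?mulr0n ?mulr0 ?mul0r//.
  by rewrite !mulr1n -exprD; apply: sign_parity; lia.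
have e2 : rep (t1, wey, wey) *m E bot = E top.
  rewrite -[E top]mulmx1 -r1 -[RHS]scale1r; apply: tens_incl_mul => w.
  case: (mxtens_indexP w) => w1 w2; rewrite tensmxE !weyE /=.
  rewrite (can_eq (@mxtens_indexK _ _)) xpair_eqE -!val_eqE /= !expr0 !addn0.
  by case: (w1 == a.-1 :> nat); case: (w2 == b.-1 :> nat); rewrite ?mulr0n ?mulr0 ?mul0r ?mulr1.
have e3 : c = (-1) ^+ (a + b) *: ((E bot)^T *m B *m E top).
  transitivity ((E top)^T *m ((rep (t1, wey, wey))^T *m B *m rep (t1, wey, wey)) *m E bot).
    by rewrite hB.
  rewrite -!mulmxA e2 !mulmxA -trmx_mul e1.
  by rewrite [(_ *: _)^T]linearZ/= -!scalemxAl.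
by rewrite {2}e3 scalerA -expr2 sqrr_sign scale1r /c !trmx_mul trmxK BT mulmxA.
Qed.

End SymmetricForm.

(** * Two standard summands in monomial coordinates *)

Section MonomialModel.
Variables (k : numClosedFieldType) (a1 b1 a2 b2 : nat).
Local Notation mon := (@mon_of a1 b1 a2 b2).

Lemma block_shift_mon :
  block_mx (shift_nat k a1 *t (1%:M : 'M[k]_b1)) 0 0 (shift_nat k a2 *t (1%:M : 'M[k]_b2)) =
  shift_mx k mon.
Proof.
apply/matrixP => x y; rewrite -[x]splitK -[y]splitK [RHS]mxE /mon_of !unsplitK.
have e n c (u v : 'I_(n * c)) t :
    (shift_nat k n *t (1%:M : 'M[k]_c)) u v =
    ((t, (mxtens_unindex u).1 : nat, (mxtens_unindex u).2 : nat) ==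
      mshift (t, (mxtens_unindex v).1 : nat, (mxtens_unindex v).2 : nat) :> monom)%:R.
  case: (mxtens_indexP u) => u1 u2; case: (mxtens_indexP v) => v1 v2.
  by rewrite tensmxE !mxE !mxtens_indexK /mshift /= !xpair_eqE eqxx -natrM mulnb.
case: (fintype.split x) (fintype.split y) => [u|u] [v|v] /=.
- by rewrite block_mxEul; apply: e.
- by rewrite block_mxEur mxE.
- by rewrite block_mxEdl mxE.
- by rewrite block_mxEdr; apply: e.
Qed.

(** One degree counts for z^2, and the weights of each pair of lengths are centred. The second pair
    is shorter by 2 al in total, so it starts at degree al. *)
Lemma block_weights_mon al M (z : k) : z != 0 ->
  (a1 + b1 = M + 2)%N -> (a2 + b2 + 2 * al = M + 2)%N ->
  block_mx (Srep_weights a1 z z^-1 *t Srep_weights b1 z z^-1) 0 0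
           (Srep_weights a2 z z^-1 *t Srep_weights b2 z z^-1) =
  diag_mx (\row_x (z ^+ (2 * mdeg al (mon x)) / z ^+ M)).
Proof.
move=> z0 e1 e2; have zz n : z ^+ n != 0 by rewrite expf_neq0.
apply/matrixP => x y; rewrite -[x]splitK -[y]splitK [RHS]mxE [in RHS]mxE /mon_of !unsplitK.
rewrite (can_eq (@unsplitK _ _)).
have wE i j a b (M' : nat) : (i < a)%N -> (j < b)%N -> (a + b = M' + 2)%N ->
   z ^+ i * z^-1 ^+ (a.-1 - i) * (z ^+ j * z^-1 ^+ (b.-1 - j)) =
   z ^+ (2 * (i + j)) / z ^+ M'.
  move=> ia jb e; rewrite !exprVn mulf_div; apply/eqP.
  by rewrite eqr_div ?mulf_neq0 ?zz// -!exprD; apply/eqP; congr (_ ^+ _); lia.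
have tE a b M' (u v : 'I_(a * b)) : (a + b = M' + 2)%N ->
    (Srep_weights a z z^-1 *t Srep_weights b z z^-1) u v =
    z ^+ (2 * ((mxtens_unindex u).1 + (mxtens_unindex u).2)) / z ^+ M' *+ (u == v).
  move=> e; case: (mxtens_indexP u) => u1 u2; case: (mxtens_indexP v) => v1 v2.
  rewrite tensmxE !mxE !mxtens_indexK (can_eq (@mxtens_indexK _ _)) xpair_eqE /=.
  case: (u1 =P v1) => [_|_]; last by rewrite mulr0n mul0r.
  case: (u2 =P v2) => [_|_]; last by rewrite !mulr0n mulr0.
  by rewrite !mulr1n; apply: wE.
case: (fintype.split x) (fintype.split y) => [u|u] [v|v].
- rewrite block_mxEul (tE _ _ M)//; congr (_ ^+ _ / _ *+ _).
  by rewrite /mdeg /=; lia.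
- by rewrite block_mxEur mxE.
- by rewrite block_mxEdl mxE.
have mE i j : mdeg al (false, i, j) = (i + j + al)%N by rewrite /mdeg /= mul1n.
(* An index of the second block exists, so its sides are positive and [a2 + b2 - 2] is not
   truncated. *)
have := ltn_ord (mxtens_unindex u).2; have := ltn_ord (mxtens_unindex u).1.
rewrite block_mxEdr mE => l1 l2; rewrite (tE _ _ (a2 + b2 - 2)%N); last by lia.
congr (_ *+ _); apply/eqP; rewrite eqr_div ?zz// -!exprD; apply/eqP; congr (_ ^+ _).
by lia.
Qed.

End MonomialModel.

(** * Polynomial families of matrices *)

Section PolynomialFamilies.
Variable k : fieldType.

Definition polynomial_family m n (X : k -> 'M[k]_(m, n)) : Prop :=
  exists P : 'M[{poly k}]_(m, n), forall t, X t = map_mx (fun p => p.[t]) P.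

Lemma polynomial_family_entries m n (X : k -> 'M[k]_(m, n)) :
  (forall i j, exists P : {poly k}, forall t, X t i j = P.[t]) -> polynomial_family X.
Proof.
move=> h; have h' i : exists f : 'I_n -> {poly k}, forall j t, X t i j = (f j).[t].
  by have [f hf] := fin_all_exists (h i); exists f.
have [f hf] := fin_all_exists h'; exists (\matrix_(i, j) f i j) => t.
by apply/matrixP => i j; rewrite !mxE.
Qed.

Lemma polynomial_family_const m n (A : 'M[k]_(m, n)) : polynomial_family (fun=> A).
Proof. by exists (map_mx polyC A) => t; apply/matrixP => i j; rewrite !mxE hornerC. Qed.

Lemma polynomial_family_mul m n p q (A : 'M[k]_(m, n)) (B : 'M[k]_(p, q)) X :
  polynomial_family X -> polynomial_family (fun t => A *m X t *m B).
Proof.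
move=> [P hP]; exists (map_mx polyC A *m P *m map_mx polyC B) => t.
rewrite hP; apply/matrixP => i j; rewrite !mxE horner_sum; apply: eq_bigr => l _.
rewrite !mxE hornerM hornerC horner_sum; congr (_ * _); apply: eq_bigr => l' _.
by rewrite !mxE hornerM hornerC.
Qed.

Lemma polynomial_family_block m n m' n' (X : k -> 'M[k]_(m, n)) (Y : k -> 'M[k]_(m', n')) :
  polynomial_family X -> polynomial_family Y ->
  polynomial_family (fun t => block_mx (X t) 0 0 (Y t)).
Proof.
move=> [P hP] [Q hQ]; exists (block_mx P 0 0 Q) => t.
by rewrite map_block_mx -hP -hQ; congr block_mx; apply/matrixP => i j; rewrite !mxE horner0.
Qed.

Lemma polynomial_family_tens_blocks m n m1 m2 n1 n2 (c : 'M[k]_(m, n))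
    (X : k -> 'M[k]_(m1 + m2, n1 + n2)) :
  polynomial_family X -> polynomial_family (fun t => tens_blocks c (X t)).
Proof.
move=> [P hP]; exists (block_mx (map_mx polyC c *t ulsubmx P) (map_mx polyC c *t ursubmx P)
  (map_mx polyC c *t dlsubmx P) (map_mx polyC c *t drsubmx P)) => t.
rewrite map_block_mx /tens_blocks hP; congr block_mx; apply/matrixP => i j;
  by rewrite !mxE hornerM hornerC.
Qed.

End PolynomialFamilies.

(** * A criterion for the closure order *)

Section DegenerationCriterion.
Variables (F : fieldType) (K : local_field F).
Variables (Fbar : closedFieldType) (iota : {rmorphism F -> Fbar}).
Variable R : realType.
Local Notation W := (weil K iota).
Local Notation C := (Cplx R).
Variables (n : nat) (d : F).
Local Notation Psi := (Psi K iota R n d).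

(** The family may live on any model with a symmetric form. It is carried into the orthogonal group
    so that its value at t = 0 is the pair of a representative of psi2; as the infinitesimal
    parameter is constant, the members with t nonzero lie in a single orbit of its centralizer. *)
Lemma geC_of_degeneration (psi1 psi2 : Psi) N (B : 'M[C]_N)
    (y : C -> option W -> 'M[C]_N) :
  B^T = B -> B \in unitmx -> (forall t, preserves B (y t)) ->
  (forall t w, y t (Some w) = y 0 (Some w)) ->
  polynomial_family (fun t => y t None) ->
  rep_iso (pair_of (phi_of psi2)) (y 0) ->
  (forall t, t != 0 -> rep_iso (pair_of (phi_of psi1)) (y t)) ->
  geC psi1 psi2.
Proof.
move=> BT uB yB yS yP i2 i1.
have [phi2 r2] := represents_exists psi2; have [_ j2] := represents_unip r2.
have {i2 j2} i2 := rep_iso_trans j2 i2.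
have eN := rep_iso_dim i2; case: N / eN B y BT uB yB yS yP i1 i2 => B y BT uB yB yS yP i1 i2.
have [A [A' [AA' A'A hA]]] := i2.
have [_ uA'] := mulmx1_unit AA'.
have hA' g : A' *m pair_of phi2 g = y 0 g *m A'.
  by rewrite -[pair_of phi2 g]mulmx1 -AA' mulmxA [A' *m _ *m (_ *m _)]mulmxA
    -[A' *m _ *m A]mulmxA hA mulmxA A'A mul1mx.
pose B2 := A'^T *m B *m A'.
have p2 := represents_preserves r2.
(* The transported form B2 need not be the standard one; S corrects this without moving the pair of
   phi2. *)
have [||S [uS SS] Sc] := preserved_form_conj (two_neq0C R) p2 (preserves_conj hA' (yB 0)).
- by rewrite !trmx_mul trmxK BT mulmxA.
- by rewrite !unitmx_mul unitmx_tr uA' uB.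
have [Q QE] : exists Q, Q = A' *m invmx S by exists (A' *m invmx S).
have [Q' Q'E] : exists Q', Q' = S *m A by exists (S *m A).
have Q'Q : Q' *m Q = 1%:M.
  by rewrite QE Q'E mulmxA -[S *m A *m A']mulmxA AA' mulmx1 mulmxV.
have QQ' : Q *m Q' = 1%:M by exact: mulmx1C.
pose z t g := Q' *m y t g *m Q.
have Qz t g : Q *m z t g = y t g *m Q by rewrite /z !mulmxA QQ' mul1mx.
have zp t : preserves 1%:M (z t).
  have := preserves_conj (Qz t) (yB t).
  have -> // : Q^T *m B *m Q = 1%:M.
  rewrite QE trmx_mul trmx_inv !mulmxA -[invmx S^T *m _ *m B]mulmxA.
  rewrite -[invmx S^T *m _ *m A']mulmxA -SS -mulmxA -mulmxA mulmxV// mulmx1.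
  by rewrite mulVmx// unitmx_tr.
have z0 g : z 0 g = pair_of phi2 g.
  have e : Q' *m y 0 g = pair_of phi2 g *m Q'.
    by rewrite Q'E -mulmxA -hA !mulmxA Sc.
  by rewrite /z e -mulmxA Q'Q mulmx1.
have zS t w : z t (Some w) = inf_param phi2 w.
  by rewrite /z yS -[LHS]/(z 0 (Some w)) z0.
have yz t : rep_iso (y t) (z t).
  apply: rep_iso_sym; exists Q', Q; split; [exact: Q'Q|exact: QQ'|move=> g].
  by rewrite /z -[_ *m Q *m Q']mulmxA QQ' mulmx1.
have [phi r1] := represents_exists psi1; have [_ j1] := represents_unip r1.
have iz t : t != 0 -> rep_iso (pair_of phi) (z t).
  by move=> t0; apply: rep_iso_trans (rep_iso_trans j1 (i1 t t0)) (yz t).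
have [U UU Uc] := orthogonal_conj (two_neq0C R) (represents_preserves r1) (zp 1)
  (iz 1 (oner_neq0 _)).
have [uU _] := orthogonal_inv UU.
have [r1' n1] := represents_conj UU r1.
have p1 w : inf_param (conj_phi U phi) w = z 1 (Some w).
  rewrite -[LHS]/(U *m pair_of phi (Some w) *m invmx U).
  by rewrite Uc mulmxK.
have q1 : Defs.nilp (conj_phi U phi) = z 1 None.
  by rewrite n1 -[Defs.nilp phi]/(pair_of phi None) Uc mulmxK.
apply: (geC_intro r1' r2) => [w|]; first by rewrite p1 zS.
rewrite -[Defs.nilp phi2]/(pair_of phi2 None) -z0.
apply: (@closure_horner _ _ _ (fun t => z t None)) => [i j|t t0].
  have [P hP] := polynomial_family_mul Q' Q yP.
  by exists (P i j) => t; rewrite /z hP mxE.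
(* V intertwines the equal values of z 1 and z t on the Weil group, so it lies in the
   centralizer. *)
have [V VV Vc] := orthogonal_conj (two_neq0C R) (zp 1) (zp t)
  (rep_iso_trans (rep_iso_sym (iz 1 (oner_neq0 _))) (iz t t0)).
have [uV _] := orthogonal_inv VV.
exists V; last by rewrite q1 Vc (mulmxK uV).
by split=> // w; rewrite p1 Vc !zS.
Qed.

End DegenerationCriterion.

(** * The uniform move degenerates *)

Section UniformRaise.
Variables (F : fieldType) (K : local_field F).
Variables (Fbar : closedFieldType) (iota : {rmorphism F -> Fbar}).
Variable R : realType.
Local Notation W := (weil K iota).
Local Notation C := (Cplx R).
Local Notation w1 := (weil1 K iota).
Local Notation block := (block K iota R).
Variables (n : nat) (d : F).
Local Notation Psi := (Psi K iota R n d).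
Variables (m : nat) (r : W -> 'M[C]_m) (r1 : r w1 = 1%:M).

Definition two_weights a1 b1 a2 b2 (w : W) : 'M[C]_(a1 * b1 + a2 * b2) :=
  block_mx (weight_mx R a1 w *t weight_mx R b1 w) 0 0
           (weight_mx R a2 w *t weight_mx R b2 w).

Definition two_blocks a1 b1 a2 b2 (X : 'M[C]_(a1 * b1 + a2 * b2)) (g : option W) :
    'M[C]_(m * (a1 * b1) + m * (a2 * b2)) :=
  if g is Some w then tens_blocks (r w) (two_weights a1 b1 a2 b2 w)
  else tens_blocks 1%:M X.

Lemma std_two_blocks a1 b1 a2 b2 rest :
  rep_iso (std_sum [:: Block r a1 b1, Block r a2 b2 & rest])
    (fun g => block_mx (two_blocks (shift_mx C (@mon_of a1 b1 a2 b2)) g) 0 0 (std_sum rest g)).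
Proof.
apply: rep_iso_trans (rep_iso_assoc _ _ _) _.
apply: rep_iso_eq => g; congr block_mx; case: g => [w|].
  by rewrite /two_blocks /two_weights tens_blocks_diag.
by rewrite /two_blocks -block_shift_mon tens_blocks_diag.
Qed.

(** The remaining summands need not be orthogonal one by one; their sum is, by cancelling the two
    good summands from psi. *)
Lemma rest_orthogonal (psi : Psi) b1 b2 rest :
  has_unit_block rest -> rep_iso psi (sum_rep [:: b1, b2 & rest]) ->
  good_parity b1 -> good_parity b2 -> pair_orthogonal (std_sum rest).
Proof.
move=> hrest hpsi g1 g2.
have h0 : rep_orthogonal (sum_rep [:: b1, b2 & rest]).
  exact: rep_orthogonal_iso (rep_iso_sym hpsi) (psi_orth psi).
have h1 : rep_orthogonal (sum_rep (b2 :: rest)) := rep_orthogonal_cancel h0 g1.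
have [B [BT uB hB]] : rep_orthogonal (sum_rep rest) := rep_orthogonal_cancel h1 g2.
have [[P hP] hI] := std_sum_iso hrest.
apply: pair_orthogonal_iso (rep_iso_sym hI) _.
exists B; split=> //; apply: (orthogonal_preserves hP) => g; exact: hB.
Qed.

Variables (p q al be : nat) (al_gt0 : (0 < al)%N) (be_gt0 : (0 < be)%N).
Local Notation old1 := (Block r (p + al) (q + al + be)).
Local Notation old2 := (Block r (p + be) q).
Local Notation new1 := (Block r (p + (al + be)) (q + al)).
Local Notation new2 := (Block r p (q + be)).
Variables (rest : seq block) (psi Tpsi : Psi).
Hypothesis rest1 : has_unit_block rest.
Hypothesis psi_iso : rep_iso psi (sum_rep [:: old1, old2 & rest]).
Hypothesis Tpsi_iso : rep_iso Tpsi (sum_rep [:: new1, new2 & rest]).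
Hypotheses (good1 : good_parity old1) (good2 : good_parity old2).

(** The sum of the degrees of two indices paired by J; the subtraction is exact because al and be
    are positive. *)
Let M := (p + q + (al + be) + al - 2)%N.

Lemma old_weights w : two_weights (p + al) (q + al + be) (p + be) q w =
  diag_mx (\row_x (wroot R w ^+ (2 * mdeg al (mon_of x)) / wroot R w ^+ M)).
Proof. by apply: block_weights_mon; rewrite ?wroot_neq0// /M; lia. Qed.

Lemma new_weights w : two_weights (p + (al + be)) (q + al) p (q + be) w =
  diag_mx (\row_x (wroot R w ^+ (2 * mdeg al (mon_of x)) / wroot R w ^+ M)).
Proof. by apply: block_weights_mon; rewrite ?wroot_neq0// /M; lia. Qed.

Lemma uniform_raise_geC : geC Tpsi psi.
Proof.
have [Br [BrT uBr hBr]] := rest_orthogonal rest1 psi_iso good1 good2.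
have a0 : (0 < p + al)%N by lia.
have b0 : (0 < q + al + be)%N by lia.
have [c [uc hc cT]] := good_parity_form r1 a0 b0 good1.
have [J [Nt [[JT uJ Jdeg] [NJ N0 NP NK]]]] :=
  string_degeneration p q (two_neq0C R) al_gt0 be_gt0.
pose y t (g : option W) := block_mx (two_blocks (Nt t) g) 0 0 (std_sum rest g).
apply: (@geC_of_degeneration _ _ _ _ _ _ _ _ _ _ (block_mx (tens_blocks c J) 0 0 Br) y).
- rewrite tr_block_diag BrT tens_blocks_tr cT JT tens_blocksZ -exprD.
  (* The signs of the form on rho and of J cancel, so their tensor product is symmetric. *)
  have -> : (-1) ^+ (p + al + (q + al + be) + (p + q + be)) = 1 :> C.
    by rewrite (@sign_parity _ _ 0)//; lia.
  by rewrite scale1r.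
- by apply: block_diag_unit => //; apply: tens_blocks_unit.
- move=> t; split=> [w|].
    rewrite /y tr_block_diag !mul_block_diag hBr.1; congr block_mx.
    rewrite /two_blocks tens_blocks_tr !tens_blocks_mul hc; congr tens_blocks.
    rewrite old_weights tr_diag_mx; apply/matrixP => i j.
    rewrite mul_mx_diag mul_diag_mx !mxE.
    have [->|/Jdeg e] := eqVneq (J i j) 0; first by rewrite mulr0 mul0r.
    (* Paired indices have opposite weights, so the torus preserves J. *)
    have eM : (2 * mdeg al (mon_of i) + 2 * mdeg al (mon_of j) = M + M)%N.
      by rewrite /M; lia.
    by rewrite mulrAC mulf_div -!exprD eM divff ?mul1r// expf_neq0// wroot_neq0.
  rewrite /y tr_block_diag !mul_block_diag add_block_diag hBr.2.
  by rewrite (tens_blocks_skew _ (NJ t)) block_mx0.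
- by [].
- apply: polynomial_family_block; last exact: polynomial_family_const.
  by apply: polynomial_family_tens_blocks; apply: polynomial_family_entries.
- have hu : has_unit_block [:: old1, old2 & rest] by do 2![constructor=> //].
  have [_ h] := phi_of_std hu psi_iso.
  apply: rep_iso_trans h _; rewrite /y N0; exact: std_two_blocks.
move=> t t0.
have hu : has_unit_block [:: new1, new2 & rest] by do 2![constructor=> //].
have [_ h] := phi_of_std hu Tpsi_iso.
apply: rep_iso_trans h _; apply: rep_iso_trans (std_two_blocks _ _ _ _ _) _.
have [K1 [K2 [K12 K21 NtK Kdeg]]] := NK t t0.
apply: rep_iso_sum; last exact: rep_iso_eq.
apply: rep_iso_sym; exists (tens_blocks 1%:M K1), (tens_blocks 1%:M K2); split.
- by rewrite tens_blocks_mul K12 mulmx1 tens_blocks1.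
- by rewrite tens_blocks_mul K21 mulmx1 tens_blocks1.
case=> [w|]; last exact: (tens_blocks_intertwine 1%:M NtK).
apply: tens_blocks_intertwine.
(* Old and new weights are the same function of the degree, which K1 preserves. *)
rewrite old_weights new_weights; apply/matrixP => i j.
rewrite mul_mx_diag mul_diag_mx !mxE.
have [->|/Kdeg e] := eqVneq (K1 i j) 0; first by rewrite mulr0 mul0r.
by rewrite e mulrC.
Qed.

End UniformRaise.

(** * Strictness, and reduction of the raising operators to the uniform move *)

Section Raises.
Variables (F : fieldType) (K : local_field F).
Variables (Fbar : closedFieldType) (iota : {rmorphism F -> Fbar}).
Variable R : realType.
Local Notation W := (weil K iota).
Local Notation C := (Cplx R).
Local Notation w1 := (weil1 K iota).
Local Notation block := (block K iota R).
Variables (n : nat) (d : F).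
Local Notation Psi := (Psi K iota R n d).

Lemma std_block_exp (b : block) e :
  std_block b None ^+ e = 1%:M *t (shift_nat C (ba b) ^+ e *t 1%:M).
Proof. by rewrite -tensmx1X -tensmxX1. Qed.

Lemma std_block_nilpotent (b : block) e : (ba b <= e)%N -> std_block b None ^+ e = 0.
Proof.
move=> h; rewrite std_block_exp (_ : shift_nat C (ba b) ^+ e = 0) ?tens0mx ?tensmx0//.
apply/matrixP => i j; rewrite shift_nat_exp mxE (_ : _ == _ = false)//.
by have := ltn_ord i; lia.
Qed.

Lemma std_block_exp_neq0 (b : block) e :
  (0 < bdim b)%N -> (0 < bb b)%N -> (e < ba b)%N -> std_block b None ^+ e != 0.
Proof.
move=> h1 h2 h3; have h4 : (0 < ba b)%N by lia.
apply/eqP => /matrixP /(_ (mxtens_index (Ordinal h1, mxtens_index (Ordinal h3, Ordinal h2)))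
  (mxtens_index (Ordinal h1, mxtens_index (Ordinal h4, Ordinal h2)))).
rewrite std_block_exp 2!tensmxE shift_nat_exp !mxE /= add0n !eqxx !mulr1.
by move/eqP; rewrite oner_eq0.
Qed.

Lemma rank_std_sum (b : block) s e :
  \rank (std_sum (b :: s) None ^+ e) =
  (\rank (std_block b None ^+ e) + \rank (std_sum s None ^+ e))%N.
Proof.
rewrite -[std_sum (b :: s) None]/(block_mx (std_block b None) 0 0 (std_sum s None)).
by rewrite exp_block_diag rank_diag_block_mx.
Qed.

Section Uniform.
Variables (m : nat) (r : W -> 'M[C]_m) (m_gt0 : (0 < m)%N) (r1 : r w1 = 1%:M).
Variables (p q al be : nat) (al_gt0 : (0 < al)%N) (be_gt0 : (0 < be)%N).
Local Notation old1 := (Block r (p + al) (q + al + be)).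
Local Notation old2 := (Block r (p + be) q).
Local Notation new1 := (Block r (p + (al + be)) (q + al)).
Local Notation new2 := (Block r p (q + be)).
Variables (rest : seq block) (psi Tpsi : Psi).
Hypothesis rest1 : has_unit_block rest.
Hypothesis psi_iso : rep_iso psi (sum_rep [:: old1, old2 & rest]).
Hypothesis Tpsi_iso : rep_iso Tpsi (sum_rep [:: new1, new2 & rest]).

Lemma uniform_raise_rank : exists2 e, (e < 2 * n)%N &
  (nilp_rank psi e < nilp_rank Tpsi e)%N.
Proof.
exists (p + (al + be) - 1)%N.
  (* The exponent has to be one of those summed in [height]; the longer new string fits into the
     space. *)
  rewrite (rep_iso_dim Tpsi_iso) /= /block_dim /=.
  have h : (p + (al + be) <= m * ((p + (al + be)) * (q + al)))%N.
    by rewrite mulnCA leq_pmulr// muln_gt0 m_gt0; lia.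
  by apply: (leq_trans _ (leq_addr _ _)); lia.
have ho : has_unit_block [:: old1, old2 & rest] by do 2![constructor=> //].
have hn : has_unit_block [:: new1, new2 & rest] by do 2![constructor=> //].
rewrite (std_rank _ ho psi_iso) (std_rank _ hn Tpsi_iso) !rank_std_sum.
have h : (0 < \rank (std_block new1 None ^+ (p + (al + be) - 1)))%N.
  by rewrite lt0n mxrank_eq0; apply: std_block_exp_neq0 => //=; lia.
rewrite (std_block_nilpotent (b := old1)); last by rewrite /=; lia.
rewrite (std_block_nilpotent (b := old2)); last by rewrite /=; lia.
by rewrite !mxrank0 !add0n -add1n; exact: leq_add h (leq_addl _ _).
Qed.

End Uniform.

Lemma sum_rep_swap (b1 b2 : block) s :
  rep_iso (sum_rep [:: b1, b2 & s]) (sum_rep [:: b2, b1 & s]).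
Proof. exact: rep_iso_swap. Qed.

Lemma sum_rep_insert0 (b1 b2 : block) s : block_dim b2 = 0%N ->
  rep_iso (sum_rep (b1 :: s)) (sum_rep [:: b1, b2 & s]).
Proof.
move=> h; apply: (rep_iso_sum (rep_iso_eq (frefl _))).
exact/rep_iso_sym/rep_iso_dim0.
Qed.

Lemma good_parity0 (b : block) : block_dim b = 0%N -> good_parity b.
Proof.
rewrite /good_parity; move: (block_rep b); case: (block_dim b) => // x _.
by exists 1%:M; split=> [||g]; [rewrite trmx1|exact: unitmx1|apply/matrixP; case].
Qed.

Lemma truncn_nat (x : rat) (k : nat) : x = k%:R -> Num.truncn x = k.
Proof. by move=> ->; rewrite natrK. Qed.

Lemma raise_blocks_uniform m (r : W -> 'M[C]_m) old new : raise_blocks r old new ->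
  exists p q al be : nat, [/\ (0 < al)%N, (0 < be)%N,
    forall rest, rep_iso (sum_rep (old ++ rest))
      (sum_rep [:: Block r (p + al) (q + al + be), Block r (p + be) q & rest]),
    forall rest, rep_iso (sum_rep (new ++ rest))
      (sum_rep [:: Block r (p + (al + be)) (q + al), Block r p (q + be) & rest]) &
    List.Forall (@good_parity _ _ _ _ _) old ->
      good_parity (Block r (p + al) (q + al + be)) /\ good_parity (Block r (p + be) q)].
Proof.
have natE (x y z : rat) (i j : nat) : x = i%:R -> y = j%:R -> z = x - y -> 0 <= z ->
    exists l : nat, z = l%:R.
  move=> -> -> ->; rewrite subr_ge0 ler_nat => h; exists (i - j)%N.
  by rewrite natrB.
have posE (x : rat) (l : nat) : x = l%:R -> 0 < x -> (0 < l)%N.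
  by move=> ->; rewrite ltr0n.
have key (A A' B B' : rat) : A' < A -> B' < B ->
    (exists l : nat, A' + B' + 1 = l%:R) -> (exists l : nat, A' - B + 1 = l%:R) ->
    (exists l : nat, A - A' = l%:R) -> (exists l : nat, B - B' = l%:R) ->
    exists p q al be : nat, [/\ (0 < al)%N, (0 < be)%N,
      jord r A B' = Block r (p + al) (q + al + be) /\ jord r A' B = Block r (p + be) q &
      jord r A B = Block r (p + (al + be)) (q + al) /\ jord r A' B' = Block r p (q + be)].
  move=> hA hB [p hp] [q hq] [al hal] [be hbe]; exists p, q, al, be.
  split; [by apply: (posE _ _ hal); lra|by apply: (posE _ _ hbe); lra|split|split];
    rewrite /jord; congr Block; apply: truncn_nat; rewrite ?natrD; lra.
case=> {old new}.
- move=> Ai Aj Bi Bj /andP[/natrP [i1 e1] /natrP [i2 e2]] /andP[/natrP [i3 e3] /natrP [i4 e4]]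
    /andP[/natrP [i5 e5] /natrP [i6 e6]] hA hB h.
  have [||||p [q [al [be [al0 be0 [u1 u2] [n1 n2]]]]]] := key Aj Ai Bj Bi hA hB.
  + by exists i1.+1; rewrite e1 natr1.
  (* q = Ai - Bj + 1 is an integer because (Ai - Bi) + (Aj - Bj) - (Aj - Bi) is one, and nonnegative
     by the side condition Bj - 1 <= Ai. The second move treats p in the same way. *)
  + have e7 : Ai - Bi + (Aj - Bj) + 1 = (i2 + i4).+1%:R by rewrite e2 e4 -natrD natr1.
    by apply: (natE _ _ _ _ _ e7 e6); lra.
  + by apply: (natE _ _ _ _ _ e5 e1); lra.
  + by apply: (natE _ _ _ _ _ e3 e5); lra.
  exists p, q, al, be; split=> [||rest|rest|]; [exact: al0|exact: be0|..].
  + by rewrite u1 u2; apply: rep_iso_eq.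
  + by rewrite n1 n2; exact: sum_rep_swap.
  by rewrite u1 u2 => hf; split; inversion hf => //; inversion H2.
- move=> Ai Aj Bi Bj /andP[/natrP [i1 e1] /natrP [i2 e2]] /andP[/natrP [i3 e3] /natrP [i4 e4]]
    /andP[/natrP [i5 e5] /natrP [i6 e6]] hA hB h.
  have hB' : Bj < Bi by lra.
  have [||||p [q [al [be [al0 be0 [u1 u2] [n1 n2]]]]]] := key Aj Ai Bi Bj hA hB'.
  + have e7 : Ai + Bi + (Aj + Bj) + 1 = (i1 + i3).+1%:R by rewrite e1 e3 -natrD natr1.
    by apply: (natE _ _ _ _ _ e7 e5); lra.
  + by exists i2.+1; rewrite e2 natr1.
  + by apply: (natE _ _ _ _ _ e5 e1); lra.
  + by apply: (natE _ _ _ _ _ e5 e3); lra.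
  exists p, q, al, be; split=> [||rest|rest|]; [exact: al0|exact: be0|..].
  + by rewrite u1 u2; exact: sum_rep_swap.
  + by rewrite n1 n2; apply: rep_iso_eq.
  by rewrite u1 u2 => hf; split; inversion hf => //; inversion H2.
move=> A /andP[/natrP [i1 e1] /natrP [i2 e2]].
have i1E : (0 : rat) <= i1%:R by rewrite ler0n.
(* The third move is the case p = q = 0, be = 1: its partners < -1/2, 1/2 > and < -1/2, -1/2 > have
   dimension zero and can be inserted freely. Here al = A + 1/2 is positive since A - 1/2 is a
   natural number. *)
have [||||||p [q [al [be [al0 be0 [u1 u2] [n1 n2]]]]]] := key A (- 2^-1) 2^-1 (- 2^-1).
- lra.
- lra.
- by exists 0%N; lra.
- by exists 0%N; lra.
- by exists i2; rewrite -e2; lra.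
- by exists 1%N; lra.
have z2 : block_dim (Block r (p + be) q) = 0%N.
  by rewrite -u2 /block_dim /jord /= (_ : _ - _ + 1 = 0) ?truncn0 ?muln0//; lra.
have z4 : block_dim (Block r p (q + be)) = 0%N.
  by rewrite -n2 /block_dim /jord /= (_ : _ + _ + 1 = 0) ?truncn0 ?mul0n ?muln0//; lra.
exists p, q, al, be; split=> [||rest|rest|]; [exact: al0|exact: be0|..].
- by rewrite u1; apply: sum_rep_insert0.
- by rewrite n1; apply: sum_rep_insert0.
by rewrite u1 => hf; split; [inversion hf|exact: good_parity0].
Qed.

End Raises.

Lemma ltn_sum_ord m (f g : nat -> nat) e : (forall i, f i <= g i)%N ->
  (e < m)%N -> (f e < g e)%N -> (\sum_(i < m) f i < \sum_(i < m) g i)%N.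
Proof.
move=> le_fg em lt_e; rewrite (bigD1 (Ordinal em)) // [ltnRHS](bigD1 (Ordinal em)) //=.
by rewrite -addSn leq_add// leq_sum.
Qed.

(** * Heights and extremal elements *)

Section Order.
Variables (F : fieldType) (K : local_field F).
Variables (Fbar : closedFieldType) (iota : {rmorphism F -> Fbar}).
Variable R : realType.
Variables (n : nat) (d : F).
Local Notation Psi := (Psi K iota R n d).
Implicit Types (psi : Psi).

Lemma raises_geC_rank psi Tpsi : raises psi Tpsi -> geC Tpsi psi /\
  exists2 e, (e < 2 * n)%N & (nilp_rank psi e < nilp_rank Tpsi e)%N.
Proof.
move=> [_ [m [r [rest [old [new [hr hrest hraise hgood [iold inew]]]]]]]].
have [p [q [al [be [al0 be0 eold enew egood]]]]] := raise_blocks_uniform hraise.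
have [g1 g2] := egood hgood.
have r1 : r (weil1 K iota) = 1%:M by exact: (brep1 hr).
have m0 := brep_dim hr.
have hu := block_ok_unit hrest.
have iold' := rep_iso_trans iold (eold rest).
have inew' := rep_iso_trans inew (enew rest).
split; first exact: (uniform_raise_geC r1 al0 be0 hu iold' inew' g1 g2).
exact: (uniform_raise_rank m0 r1 al0 be0 hu iold' inew').
Qed.

Lemma raises_gtC psi Tpsi : raises psi Tpsi -> gtC Tpsi psi.
Proof.
move=> h; have [h1 [e _ lt_e]] := raises_geC_rank h; split; first exact: h1.
by move=> /(geC_rank e); rewrite leqNgt lt_e.
Qed.

Lemma geO_geC psi psi' : geO psi psi' -> geC psi psi'.
Proof.
elim=> [psi1 psi2|psi1 psi0 psi2 h _ IH]; first exact: geC_same.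
by apply: geC_trans IH; have [] := raises_geC_rank h.
Qed.

Definition height psi : nat := \sum_(e < 2 * n) nilp_rank psi e.

Lemma height_le psi : (height psi <= 2 * n * (2 * n))%N.
Proof.
rewrite -[X in (_ <= X * _)%N]card_ord -sum_nat_const.
by apply: leq_sum => e _; exact: rank_leq_row.
Qed.

Lemma geC_height psi psi' : geC psi psi' -> (height psi' <= height psi)%N.
Proof. by move=> h; apply: leq_sum => e _; exact: geC_rank. Qed.

Lemma raises_height psi Tpsi : raises psi Tpsi -> (height psi < height Tpsi)%N.
Proof.
move=> /raises_geC_rank [h [e lt_e rk]].
exact: ltn_sum_ord (fun e => geC_rank e h) lt_e rk.
Qed.

(** Distinct parameters are joined by at least one move; the last one is strict and the earlier ones
    do not lower the height. *)
Lemma geO_height psi psi' : geO psi psi' -> ~ same_param psi psi' ->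
  (height psi' < height psi)%N.
Proof.
case=> {psi psi'} [psi1 psi2 h nh|psi1 psi0 psi2 h h' _]; first by have := nh h.
exact: leq_ltn_trans (geC_height (geO_geC h')) (raises_height h).
Qed.

Lemma not_maximal_in (P : Psi -> Prop) psi : P psi -> ~ maximal_in P psi ->
  exists psi', [/\ P psi', geC psi' psi & (height psi < height psi')%N].
Proof.
move=> hpsi nmax; apply: contrapT => hn; apply: nmax; split; first exact: hpsi.
move=> psi' hpsi' h; apply: contrapT => ns; apply: hn; exists psi'.
by split; [exact: hpsi'|exact: geO_geC|exact: geO_height].
Qed.

Lemma not_minimal_in (P : Psi -> Prop) psi : P psi -> ~ minimal_in P psi ->
  exists psi', [/\ P psi', geC psi psi' & (height psi' < height psi)%N].
Proof.
move=> hpsi nmin; apply: contrapT => hn; apply: nmin; split; first exact: hpsi.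
move=> psi' hpsi' h; apply: contrapT => ns; apply: hn; exists psi'.
split; [exact: hpsi'|exact: geO_geC|apply: geO_height; first exact: h].
by move=> /rep_iso_sym.
Qed.

(** Climb by induction on the distance between the height and its bound; uniqueness identifies the
    maximal element that is reached. *)
Lemma unique_maximal_geC (P : Psi -> Prop) psimax psi :
  unique_maximal P psimax -> P psi -> geC psimax psi.
Proof.
move=> [_ uniq_max]; have [k] := ubnP (2 * n * (2 * n) - height psi).
elim: k psi => // k IH psi hk hpsi.
have [hmax|] := EM (maximal_in P psi).
  exact/geC_same/rep_iso_sym/uniq_max.
move=> /(not_maximal_in hpsi) [psi' [hpsi' h lt_h]]; apply: geC_trans _ h.
by apply: IH hpsi'; have := height_le psi'; lia.
Qed.

Lemma unique_minimal_geC (P : Psi -> Prop) psimin psi :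
  unique_minimal P psimin -> P psi -> geC psi psimin.
Proof.
move=> [_ uniq_min]; have [k] := ubnP (height psi).
elim: k psi => // k IH psi hk hpsi.
have [hmin|] := EM (minimal_in P psi).
  exact/geC_same/uniq_min.
move=> /(not_minimal_in hpsi) [psi' [hpsi' h lt_h]]; apply: geC_trans h _.
by apply: IH hpsi'; lia.
Qed.

(** A strict move upwards would exceed the height of [psi]. This reduces uniqueness for the closure
    order to uniqueness of the maximal element for the raising order. *)
Lemma greatest_maximal_in (P : Psi -> Prop) psi :
  P psi -> (forall psi', P psi' -> geC psi psi') -> maximal_in P psi.
Proof.
move=> hpsi hge; apply: contrapT => /(not_maximal_in hpsi) [psi' [hpsi' _]].
by rewrite ltnNge geC_height//; exact: hge.
Qed.

Lemma least_minimal_in (P : Psi -> Prop) psi :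
  P psi -> (forall psi', P psi' -> geC psi' psi) -> minimal_in P psi.
Proof.
move=> hpsi hge; apply: contrapT => /(not_minimal_in hpsi) [psi' [hpsi' _]].
by rewrite ltnNge geC_height//; exact: hge.
Qed.

End Order.

Theorem theorem8p5
  (F : fieldType) (K : local_field F) (charF0 : [pchar F] =i pred0)
  (Fbar : closedFieldType) (iota : {rmorphism F -> Fbar})
  (Fbar_alg : forall x : Fbar, algebraicOver iota x)
  (R : realType)
  (n : nat) (Q : 'M[F]_(2 * n)) (Qsym : Q^T = Q) (Qnondeg : Q \in unitmx) :
  ((forall psi Tpsi : Psi K iota R n (disc Q),
      raises psi Tpsi -> gtC Tpsi psi) /\
   (forall psi psi' : Psi K iota R n (disc Q),
      geO psi psi' -> geC psi psi')) /\
  (forall (Pi : packets K iota R Q) (pi : irrep K R Q),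
     arthur_type Pi pi ->
     forall psimax psimin : Psi K iota R n (disc Q),
       unique_maximal (Psi_of Pi pi) psimax ->
       unique_minimal (Psi_of Pi pi) psimin ->
       [/\ Psi_of Pi pi psimax, Psi_of Pi pi psimin,
           forall psi, Psi_of Pi pi psi -> geC psimax psi /\ geC psi psimin &
           forall psi1 psi2, Psi_of Pi pi psi1 -> Psi_of Pi pi psi2 ->
             (forall psi, Psi_of Pi pi psi -> geC psi1 psi /\ geC psi psi2) ->
             same_param psi1 psimax /\ same_param psi2 psimin]).
Proof.
split; first by split; [exact: raises_gtC|exact: geO_geC].
move=> Pi pi _ psimax psimin hmax hmin.
have [[hmaxP _] uniq_max] := hmax; have [[hminP _] uniq_min] := hmin.
split; [exact: hmaxP|exact: hminP| |].
  move=> psi hpsi; split; first exact: unique_maximal_geC hmax hpsi.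
  exact: unique_minimal_geC hmin hpsi.
move=> psi1 psi2 h1 h2 h; split; [apply: uniq_max|apply: uniq_min].
  by apply: (greatest_maximal_in h1) => psi' /h [].
by apply: (least_minimal_in h2) => psi' /h [].
Qed.
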